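(* Let $f:\{z\in\mathbb{C}: |\operatorname{Im} z|\le 1\}\to\mathbb{C}$ be a continuous function. Suppose that for every $r\in\mathbb{R}$ the restriction of $f$ to the circle $\{z\in\mathbb{C}:|z-r|=1\}$ extends holomorphically inside the circle. Then $f$ is holomorphic in the open strip $\{z\in\mathbb{C}:|\operatorname{Im} z|<1\}$.
   Context: The restriction of $f$ to the circle $|z-r|=1$ ''extends holomorphically inside the circle'' means: there exists a function $f_r$, continuous on the closed disc $\{|z-r|\le 1\}$ and holomorphic in the open disc $\{|z-r|<1\}$, such that $f_r(z)=f(z)$ for all $z$ with $|z-r|=1$. (It is not assumed that $f_r$ agrees with $f$ inside the disc.) *)

(* Defs.v *)
From Stdlib Require Import Reals.
From Coquelicot Require Import Coquelicot.
Local Open Scope R_scope.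

(* Functions on a subset of the plane are represented by total functions
   [C -> C]; every hypothesis below only involves their values on that subset. *)

(* Continuity of the restriction of [f] to [D], for the subspace topology. *)
Definition continuous_on_C (D : C -> Prop) (f : C -> C) : Prop :=
  continuous_on (T := C_UniformSpace) (U := C_UniformSpace) D f.

(* Complex differentiability at every point of [D]: the scalar field of the
   derivative is C, not R.  Meant for open [D], where it depends only on the
   values of [f] on [D]. *)
Definition holomorphic_on (D : C -> Prop) (f : C -> C) : Prop :=
  forall z : C, D z -> ex_derive (K := C_AbsRing) (V := C_NormedModule) f z.

Definition closed_strip (z : C) : Prop := Rabs (Im z) <= 1.

Definition open_strip (z : C) : Prop := Rabs (Im z) < 1.

Definition unit_circle_at (r : R) (z : C) : Prop := Cmod (z - RtoC r)%C = 1.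

Definition closed_unit_disc_at (r : R) (z : C) : Prop :=
  Cmod (z - RtoC r)%C <= 1.

Definition open_unit_disc_at (r : R) (z : C) : Prop :=
  Cmod (z - RtoC r)%C < 1.

(* The extension [g] need not agree with [f] inside the disc. *)
Definition extends_holomorphically_inside (f : C -> C) (r : R) : Prop :=
  exists g : C -> C,
    continuous_on_C (closed_unit_disc_at r) g /\
    holomorphic_on (open_unit_disc_at r) g /\
    (forall z : C, unit_circle_at r z -> g z = f z).

(* Main.v *)
Require Import Defs.
From Stdlib Require Import Reals Lra Lia ClassicalEpsilon.
From Coquelicot Require Import Coquelicot.
Local Open Scope R_scope.

(** Put [w = r + 1 / (z - r)], so that [w] is the conjugate of [z] on the circle [|z - r| = 1], and let [G r]
    be the extension of [f] inside that circle.  For fixed [z] with [0 < Im z < 1] the values [G r z] live on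
    a closed curve of points [w] in the lower half plane, and their moments against functions of [w] holomorphic
    there are holomorphic in [z].  The curve shrinks to a point as [Im z -> 1], so the moments vanish; letting
    [Im z -> 0] they vanish at real [z], and symmetrically from below.  For real [z] the curve is the whole real
    line, so [r |-> G r z], as a function of [w], is a bounded function orthogonal to all differences of Poisson
    kernels, hence constant: [G r = f] on the real diameter.  By the identity theorem the [G r] agree with
    each other where they overlap, and therefore with [f].

    The vanishing of the moments at a real point is obtained at once, without studying them for complex [z]:
    apply Cauchy's theorem to [G r] times a weight on the upper half of each disc, and integrate over [r].
    Each point lies on two of the semicircles, to which it contributes with opposite signs, so these integrals
    cancel up to boundary terms, which are made negligible by high powers of the weight [1 - z^2 / 16]. *)

(** * Continuity and differentiability of complex-valued functions *)

(* Coquelicot's structures introduce points of [C] at types only convertible to [C],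
   which defeats [ring] and [field]. *)
Ltac introC w :=
  let w0 := fresh in intro w0; set (w := w0 : C); change w0 with w; clearbody w; clear w0.

(** A priori the extensions for different [r] share nothing but boundary values, so their agreement
    has to come from integrating over [r]. The weights face two opposite demands: holomorphic in [z]
    in each disc, for Cauchy's theorem, yet on the circles a function of the point alone, for the
    cancellation between circles. A function of [w] meets both. As [w] has a pole at the centre,
    each moment uses two poles [a] and [b]: the decay in [w^-2] absorbs the double pole of
    [dw / dr], which a single Cauchy kernel would not. Over the upper half disc [w] stays in the
    closed lower half plane, so [a] and [b] lie in the upper one; conjugating the family supplies
    the opposite poles, and partial fractions turn both together into Poisson kernels. Only centres
    in [-3, 3] are integrated, hence a point near the ends of the window may be met by one
    semicircle alone. The weight has to be small at abscissas between 2 and 4 in absolute value, and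
    holomorphic, which rules out a cutoff. Off the real axis near 0 it exceeds 1 in modulus, which
    is harmless because the cancellation there is exact. *)

Definition CInt (f : R -> C) (a b : R) : C := @RInt C_R_CompleteNormedModule f a b.

Lemma Cmod_le_sum (z : C) : Cmod z <= Rabs (fst z) + Rabs (snd z).
Proof.
  replace z with (RtoC (fst z) + (0, snd z))%C
    by (destruct z; unfold Cplus, RtoC; simpl; f_equal; ring).
  eapply Rle_trans; [apply Cmod_triangle|].
  rewrite Cmod_R. apply Rplus_le_compat; simpl.
  - rewrite Rplus_0_r. lra.
  - unfold Cmod; simpl.
    replace (0 * (0 * 1) + snd z * (snd z * 1)) with (Rsqr (snd z)) by (unfold Rsqr; ring).
    rewrite sqrt_Rsqr_abs, Rplus_0_l. lra.
Qed.

Lemma Rabs_fst_le_Cmod (z : C) : Rabs (fst z) <= Cmod z.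
Proof. eapply Rle_trans; [apply Rmax_l|apply Rmax_Cmod]. Qed.

Lemma Rabs_snd_le_Cmod (z : C) : Rabs (snd z) <= Cmod z.
Proof. eapply Rle_trans; [apply Rmax_r|apply Rmax_Cmod]. Qed.

(** The balls of the product uniform structure on [C] are squares; the modulus is comparable to them
    and suits the triangle inequality. *)
Lemma continuous_C_iff {T : UniformSpace} (f : T -> C) (x : T) :
  continuous (U := C_UniformSpace) f x <->
  forall eps : posreal, locally x (fun y => Cmod (f y - f x) < eps).
Proof.
  split.
  - intros H eps.
    assert (He : 0 < eps / 2) by (destruct eps; simpl; lra).
    generalize (proj1 (filterlim_locally f (f x)) H (mkposreal _ He)).
    apply filter_imp. intros y [H1 H2].
    eapply Rle_lt_trans; [apply Cmod_le_sum|].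
    change (Rabs (fst (f y) - fst (f x)) < eps / 2) in H1.
    change (Rabs (snd (f y) - snd (f x)) < eps / 2) in H2.
    change (Rabs (fst (f y) - fst (f x)) + Rabs (snd (f y) - snd (f x)) < eps). lra.
  - intros H. apply filterlim_locally. intros eps.
    generalize (H eps). apply filter_imp. intros y Hy. split.
    + eapply Rle_lt_trans; [apply (Rabs_fst_le_Cmod (f y - f x))|exact Hy].
    + eapply Rle_lt_trans; [apply (Rabs_snd_le_Cmod (f y - f x))|exact Hy].
Qed.

Lemma continuous_C_pair {T : UniformSpace} (f : T -> C) (x : T) :
  continuous (fun t => fst (f t)) x -> continuous (fun t => snd (f t)) x ->
  continuous (U := C_UniformSpace) f x.
Proof.
  intros H1 H2. apply filterlim_locally. intros eps.
  generalize (filter_and _ _ (proj1 (filterlim_locally _ _) H1 eps)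
                (proj1 (filterlim_locally _ _) H2 eps)).
  apply filter_imp. intros y [A B]; split; assumption.
Qed.

Lemma continuous_C_fst {T : UniformSpace} (f : T -> C) (x : T) :
  continuous (U := C_UniformSpace) f x -> continuous (fun t => fst (f t)) x.
Proof. intros H. apply (continuous_comp (V := C_UniformSpace) f fst); [exact H|destruct (f x); apply continuous_fst]. Qed.

Lemma continuous_C_snd {T : UniformSpace} (f : T -> C) (x : T) :
  continuous (U := C_UniformSpace) f x -> continuous (fun t => snd (f t)) x.
Proof. intros H. apply (continuous_comp (V := C_UniformSpace) f snd); [exact H|destruct (f x); apply continuous_snd]. Qed.

Section Continuity.
Context {T : UniformSpace}.
Implicit Types f g : T -> C.

Lemma continuous_R_plus (f g : T -> R) x :
  continuous f x -> continuous g x -> continuous (fun t => f t + g t) x.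
Proof. intros; apply (continuous_plus (V := R_NormedModule) f g); assumption. Qed.

Lemma continuous_R_minus (f g : T -> R) x :
  continuous f x -> continuous g x -> continuous (fun t => f t - g t) x.
Proof. intros; apply (continuous_minus (V := R_NormedModule) f g); assumption. Qed.

Lemma continuous_R_opp (f : T -> R) x :
  continuous f x -> continuous (fun t => - f t) x.
Proof. intros; apply (continuous_opp (V := R_NormedModule) f); assumption. Qed.

Lemma continuous_R_mult (f g : T -> R) x :
  continuous f x -> continuous g x -> continuous (fun t => f t * g t) x.
Proof. intros; apply (continuous_mult (K := R_AbsRing) f g); assumption. Qed.

Lemma continuous_R_comp (h : R -> R) (f : T -> R) x :
  continuity_pt h (f x) -> continuous f x -> continuous (fun t => h (f t)) x.
Proof. intros H1 H2. apply (continuous_comp f h); [exact H2|apply continuity_pt_filterlim; exact H1]. Qed.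

Lemma continuous_Cconst (c : C) x : continuous (U := C_UniformSpace) (fun _ : T => c) x.
Proof. apply (continuous_const (V := C_UniformSpace)). Qed.

Lemma continuous_RtoC (f : T -> R) x :
  continuous f x -> continuous (U := C_UniformSpace) (fun t => RtoC (f t)) x.
Proof. intros H. apply continuous_C_pair; simpl; [exact H|apply continuous_const]. Qed.

Lemma continuous_Cplus f g x :
  continuous (U := C_UniformSpace) f x -> continuous (U := C_UniformSpace) g x ->
  continuous (U := C_UniformSpace) (fun t => f t + g t)%C x.
Proof.
  intros Hf Hg. apply continuous_C_pair; simpl; apply continuous_R_plus;
  (apply continuous_C_fst || apply continuous_C_snd); assumption.
Qed.

Lemma continuous_Copp f x :
  continuous (U := C_UniformSpace) f x ->
  continuous (U := C_UniformSpace) (fun t => - f t)%C x.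
Proof.
  intros Hf. apply continuous_C_pair; simpl; apply continuous_R_opp;
  (apply continuous_C_fst || apply continuous_C_snd); assumption.
Qed.

Lemma continuous_Cminus f g x :
  continuous (U := C_UniformSpace) f x -> continuous (U := C_UniformSpace) g x ->
  continuous (U := C_UniformSpace) (fun t => f t - g t)%C x.
Proof. intros; apply continuous_Cplus; [|apply continuous_Copp]; assumption. Qed.

Lemma continuous_Cmult f g x :
  continuous (U := C_UniformSpace) f x -> continuous (U := C_UniformSpace) g x ->
  continuous (U := C_UniformSpace) (fun t => f t * g t)%C x.
Proof.
  intros Hf Hg.
  pose proof (continuous_C_fst _ _ Hf). pose proof (continuous_C_snd _ _ Hf).
  pose proof (continuous_C_fst _ _ Hg). pose proof (continuous_C_snd _ _ Hg).
  apply continuous_C_pair; simpl.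
  - apply continuous_R_minus; apply continuous_R_mult; assumption.
  - apply continuous_R_plus; apply continuous_R_mult; assumption.
Qed.

Lemma continuous_Cpow f n x :
  continuous (U := C_UniformSpace) f x ->
  continuous (U := C_UniformSpace) (fun t => f t ^ n)%C x.
Proof.
  intros Hf. induction n as [|n IH]; simpl.
  - apply continuous_Cconst.
  - apply continuous_Cmult; assumption.
Qed.

Lemma continuous_Cconj f x :
  continuous (U := C_UniformSpace) f x ->
  continuous (U := C_UniformSpace) (fun t => Cconj (f t)) x.
Proof.
  intros Hf. apply continuous_C_pair; simpl.
  - apply continuous_C_fst; assumption.
  - apply continuous_R_opp, continuous_C_snd; assumption.
Qed.

Lemma Cnorm2_neq_0 (z : C) : z <> 0%C -> fst z * (fst z * 1) + snd z * (snd z * 1) <> 0.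
Proof.
  intros Hz H. apply Hz. destruct z as [a b]; simpl in *.
  assert (a * a + b * b = 0) by lra.
  assert (a = 0) by nra. assert (b = 0) by nra. subst. reflexivity.
Qed.

Lemma continuous_Cinv f x :
  f x <> 0%C -> continuous (U := C_UniformSpace) f x ->
  continuous (U := C_UniformSpace) (fun t => / f t)%C x.
Proof.
  intros Hz Hf.
  pose proof (continuous_C_fst _ _ Hf) as H1. pose proof (continuous_C_snd _ _ Hf) as H2.
  assert (Hn : continuous (fun t => / (fst (f t) * (fst (f t) * 1) + snd (f t) * (snd (f t) * 1))) x).
  { apply (continuous_R_comp Rinv (fun t => fst (f t) * (fst (f t) * 1) + snd (f t) * (snd (f t) * 1))).
    - apply (continuity_pt_inv id); [apply derivable_continuous, derivable_id|].
      unfold id. apply Cnorm2_neq_0; assumption.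
    - apply continuous_R_plus; apply continuous_R_mult; try assumption;
      apply continuous_R_mult; try assumption; apply continuous_const. }
  apply continuous_C_pair; simpl; unfold Rdiv; apply continuous_R_mult; try assumption.
  apply continuous_R_opp; assumption.
Qed.

Lemma continuous_Cdiv f g x :
  g x <> 0%C ->
  continuous (U := C_UniformSpace) f x -> continuous (U := C_UniformSpace) g x ->
  continuous (U := C_UniformSpace) (fun t => f t / g t)%C x.
Proof. intros; apply continuous_Cmult; [|apply continuous_Cinv]; assumption. Qed.

Lemma continuous_Cmod f x :
  continuous (U := C_UniformSpace) f x -> continuous (fun t => Cmod (f t)) x.
Proof.
  intros Hf. apply filterlim_locally. intros eps.
  generalize (proj1 (continuous_C_iff f x) Hf eps). apply filter_imp. intros y Hy.
  change (Rabs (Cmod (f y) - Cmod (f x)) < eps).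
  eapply Rle_lt_trans; [|exact Hy].
  apply Rabs_le; split.
  - generalize (Cmod_triangle (f x - f y) (f y)).
    replace (f x - f y + f y)%C with (f x) by ring.
    rewrite <- (Cmod_opp (f x - f y)). replace (- (f x - f y))%C with (f y - f x)%C by ring. lra.
  - generalize (Cmod_triangle (f y - f x) (f x)).
    replace (f y - f x + f x)%C with (f y) by ring. lra.
Qed.

End Continuity.

(** Complex differentiability in Carathéodory's form: the product and chain rules
    then only manipulate difference quotients. *)
Definition cdiff (f : C -> C) (z : C) : Prop :=
  exists q : C -> C,
    locally (T := C_UniformSpace) z (fun w => f w = f z + q w * (w - z))%C /\
    continuous (T := C_UniformSpace) (U := C_UniformSpace) q z.

Lemma locally_Cmod (z : C) (P : C -> Prop) :
  locally (T := C_UniformSpace) z P <->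
  exists d : posreal, forall w, Cmod (w - z) < d -> P w.
Proof.
  split.
  - intros [d H]. exists d. intros w Hw. apply H. split.
    + eapply Rle_lt_trans; [apply (Rabs_fst_le_Cmod (w - z))|exact Hw].
    + eapply Rle_lt_trans; [apply (Rabs_snd_le_Cmod (w - z))|exact Hw].
  - intros [d H]. assert (Hd : 0 < d / 2) by (destruct d; simpl; lra).
    exists (mkposreal _ Hd). intros w [H1 H2]. apply H.
    eapply Rle_lt_trans; [apply Cmod_le_sum|].
    change (Rabs (fst w - fst z) < d / 2) in H1.
    change (Rabs (snd w - snd z) < d / 2) in H2.
    change (Rabs (fst w - fst z) + Rabs (snd w - snd z) < d). lra.
Qed.

Lemma cdiff_ex_derive (f : C -> C) (z : C) :
  cdiff f z <-> ex_derive (K := C_AbsRing) (V := C_NormedModule) f z.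
Proof.
  split.
  - intros [q [Hq Cq]]. exists (q z). split.
    + apply is_linear_scal_l.
    + intros x Hx. apply (is_filter_lim_locally_unique (V := AbsRing_NormedModule C_AbsRing)) in Hx. subst x.
      intros eps.
      assert (L := filter_and _ _ Hq (proj1 (continuous_C_iff q z) Cq eps)).
      apply locally_C. revert L. apply filter_imp. intros w [E1 E2].
      change (Cmod ((f w - f z) - (w - z) * q z) <= eps * Cmod (w - z)).
      rewrite E1. replace (f z + q w * (w - z) - f z - (w - z) * q z)%C with ((q w - q z) * (w - z))%C by ring.
      rewrite Cmod_mult. apply Rmult_le_compat_r; [apply Cmod_ge_0|lra].
  - intros [l [_ H]]. specialize (H z (fun P HP => HP)).
    exists (fun w => if excluded_middle_informative (w = z) then l else ((f w - f z) / (w - z))%C).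
    split.
    + apply filter_forall. introC w. destruct (excluded_middle_informative (w = z)) as [Ew|Hw]; [rewrite Ew|].
      * ring.
      * field. intros E. apply Hw. rewrite <- (Cplus_0_r z), <- E. ring.
    + apply continuous_C_iff. intros eps.
      assert (He : 0 < eps / 2) by (destruct eps; simpl; lra).
      specialize (H (mkposreal _ He)). apply locally_C in H. revert H. apply filter_imp.
      introC w. intros Hw. change (Cmod ((f w - f z) - (w - z) * l) <= eps / 2 * Cmod (w - z)) in Hw.
      destruct (excluded_middle_informative (z = z)) as [_|N]; [|now elim N].
      destruct (excluded_middle_informative (w = z)) as [->|Hn].
      * replace (l - l)%C with (RtoC 0) by ring. rewrite Cmod_0. apply eps.
      * assert (N : (w - z)%C <> 0%C).
        { intros E. apply Hn. rewrite <- (Cplus_0_r z), <- E. ring. }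
        replace ((f w - f z) / (w - z) - l)%C with ((f w - f z - (w - z) * l) / (w - z))%C
          by (field; exact N).
        rewrite Cmod_div by exact N.
        apply Cmod_gt_0 in N.
        apply Rle_lt_trans with (eps / 2); [|lra].
        apply Rmult_le_reg_r with (Cmod (w - z)); [exact N|].
        unfold Rdiv at 1. rewrite Rmult_assoc, Rinv_l, Rmult_1_r; lra.
Qed.

Lemma cdiff_continuous f z :
  cdiff f z -> continuous (T := C_UniformSpace) (U := C_UniformSpace) f z.
Proof.
  intros [q [Hq Cq]].
  apply (continuous_ext_loc (T := C_UniformSpace) (U := C_UniformSpace)) with (fun w => f z + q w * (w - z))%C.
  - revert Hq. apply filter_imp. intros w E. symmetry. exact E.
  - apply continuous_Cplus; [apply continuous_Cconst|].
    apply continuous_Cmult; [exact Cq|].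
    apply continuous_Cminus; [apply (continuous_id (U:=C_UniformSpace))|apply continuous_Cconst].
Qed.

Lemma cdiff_ext_loc f g z :
  locally (T := C_UniformSpace) z (fun w => f w = g w) -> cdiff f z -> cdiff g z.
Proof.
  intros H [q [Hq Cq]]. exists q. split; [|exact Cq].
  pose proof (locally_singleton _ _ H) as E. simpl in E.
  generalize (filter_and _ _ H Hq). apply filter_imp. intros w [<- Ew].
  rewrite <- E. exact Ew.
Qed.

Lemma cdiff_const c z : cdiff (fun _ => c) z.
Proof.
  exists (fun _ => RtoC 0). split; [|apply continuous_Cconst].
  apply filter_forall. introC w. ring.
Qed.

Lemma cdiff_id z : cdiff (fun w => w) z.
Proof.
  exists (fun _ => RtoC 1). split; [|apply continuous_Cconst].
  apply filter_forall. introC w. ring.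
Qed.

Lemma cdiff_plus f g z : cdiff f z -> cdiff g z -> cdiff (fun w => f w + g w)%C z.
Proof.
  intros [q [Hq Cq]] [p [Hp Cp]]. exists (fun w => q w + p w)%C.
  split; [|apply continuous_Cplus; assumption].
  generalize (filter_and _ _ Hq Hp). apply filter_imp. introC w. intros [E1 E2].
  rewrite E1, E2. ring.
Qed.

Lemma cdiff_mult f g z : cdiff f z -> cdiff g z -> cdiff (fun w => f w * g w)%C z.
Proof.
  intros Hf Hg. pose proof (cdiff_continuous g z Hg) as Cg.
  destruct Hf as [q [Hq Cq]], Hg as [p [Hp Cp]]. exists (fun w => q w * g w + f z * p w)%C.
  split.
  - generalize (filter_and _ _ Hq Hp). apply filter_imp. introC w. intros [E1 E2].
    rewrite E1, E2. ring.
  - apply continuous_Cplus; apply continuous_Cmult; try assumption. apply continuous_Cconst.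
Qed.

Lemma cdiff_opp f z : cdiff f z -> cdiff (fun w => - f w)%C z.
Proof.
  intros [q [Hq Cq]]. exists (fun w => - q w)%C.
  split; [|apply continuous_Copp; assumption].
  revert Hq. apply filter_imp. introC w. intros E. rewrite E. ring.
Qed.

Lemma cdiff_minus f g z : cdiff f z -> cdiff g z -> cdiff (fun w => f w - g w)%C z.
Proof. intros; apply cdiff_plus; [|apply cdiff_opp]; assumption. Qed.

Lemma cdiff_pow f n z : cdiff f z -> cdiff (fun w => f w ^ n)%C z.
Proof.
  intros H. induction n as [|n IH]; simpl; [apply cdiff_const|apply cdiff_mult; assumption].
Qed.

Lemma cdiff_comp f g z : cdiff f (g z) -> cdiff g z -> cdiff (fun w => f (g w)) z.
Proof.
  intros [q [Hq Cq]] Hg. pose proof (cdiff_continuous g z Hg) as Cg.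
  destruct Hg as [p [Hp Cp]]. exists (fun w => q (g w) * p w)%C. split.
  - generalize (filter_and _ _ Hp (Cg _ Hq)). apply filter_imp. introC w. intros [E1 E2].
    rewrite E2, E1. ring.
  - apply continuous_Cmult; [|exact Cp].
    apply (continuous_comp (U := C_UniformSpace) (V := C_UniformSpace) (W := C_UniformSpace) g q); assumption.
Qed.

Lemma locally_neq_0 (z : C) : z <> 0%C -> locally (T := C_UniformSpace) z (fun w : C => w <> 0%C).
Proof.
  intros Hz. apply locally_Cmod.
  exists (mkposreal _ (proj1 (Cmod_gt_0 z) Hz)). simpl. intros w Hw E. subst w.
  replace (0 - z)%C with (- z)%C in Hw by ring. rewrite Cmod_opp in Hw. lra.
Qed.

Lemma cdiff_inv (f : C -> C) (z : C) : f z <> 0%C -> cdiff f z -> cdiff (fun w => / f w)%C z.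
Proof.
  intros Hz Hf. apply (cdiff_comp Cinv f); [|exact Hf].
  revert Hz. generalize (f z). clear. intros z Hz.
  exists (fun w => - / (w * z))%C. split.
  - generalize (locally_neq_0 z Hz). apply filter_imp. introC w. intros Hw. field. tauto.
  - apply continuous_Copp, continuous_Cinv; [apply Cmult_neq_0; assumption|].
    apply continuous_Cmult; [apply (continuous_id (U:=C_UniformSpace))|apply continuous_Cconst].
Qed.

Lemma cdiff_conj f z : cdiff f (Cconj z) -> cdiff (fun w => Cconj (f (Cconj w))) z.
Proof.
  intros [q [Hq Cq]]. exists (fun w => Cconj (q (Cconj w))).
  assert (Cc : continuous (T := C_UniformSpace) (U := C_UniformSpace) Cconj z)
    by (apply continuous_Cconj, (continuous_id (U:=C_UniformSpace))).
  split.
  - pose proof (Cc _ Hq) as L. unfold filtermap in L. revert L. apply filter_imp. introC w. intros E. rewrite E.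
    unfold Cconj, Cplus, Cminus, Cmult, Copp; simpl. f_equal; simpl; ring.
  - apply continuous_Cconj.
    apply (continuous_comp (U := C_UniformSpace) (V := C_UniformSpace) (W := C_UniformSpace) Cconj q); assumption.
Qed.

(** * Derivatives and integrals of complex-valued functions of a real variable *)

Lemma norm_C_R (v : C) : norm (V := C_R_NormedModule) v = Cmod v.
Proof.
  change (sqrt (Rabs (fst v) ^ 2 + Rabs (snd v) ^ 2) = Cmod v).
  unfold Cmod. now rewrite !pow2_abs.
Qed.

Lemma is_derive_C_pair (f : R -> C) (t : R) (l : C) :
  is_derive (fun s => fst (f s)) t (fst l) -> is_derive (fun s => snd (f s)) t (snd l) ->
  is_derive (V := C_R_NormedModule) f t l.
Proof.
  intros [_ H1] [_ H2]. split; [apply is_linear_scal_l|].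
  intros x Hx. specialize (H1 x Hx). specialize (H2 x Hx). intros eps.
  assert (He : 0 < eps / 2) by (destruct eps; simpl; lra).
  generalize (filter_and _ _ (H1 (mkposreal _ He)) (H2 (mkposreal _ He))).
  apply filter_imp. intros y [E1 E2].
  rewrite norm_C_R. match goal with |- Cmod ?v <= _ => set (V := v : C) end.
  match type of E1 with _ <= _ * ?n => change (Rabs (fst V) <= eps / 2 * n) in E1 end.
  match type of E2 with _ <= _ * ?n => change (Rabs (snd V) <= eps / 2 * n) in E2 end.
  eapply Rle_trans; [apply Cmod_le_sum|]. lra.
Qed.

Lemma is_derive_C_fst (f : R -> C) (t : R) (l : C) :
  is_derive (V := C_R_NormedModule) f t l -> is_derive (fun s => fst (f s)) t (fst l).
Proof.
  intros [_ H1]. split; [apply is_linear_scal_l|].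
  intros x Hx. specialize (H1 x Hx). intros eps. generalize (H1 eps).
  apply filter_imp. intros y E.
  rewrite norm_C_R in E.
  match type of E with Cmod ?v <= _ * ?n =>
    set (V := v : C) in E; change (Rabs (fst V) <= eps * n) end.
  eapply Rle_trans; [apply Rabs_fst_le_Cmod|exact E].
Qed.

Lemma is_derive_C_snd (f : R -> C) (t : R) (l : C) :
  is_derive (V := C_R_NormedModule) f t l -> is_derive (fun s => snd (f s)) t (snd l).
Proof.
  intros [_ H1]. split; [apply is_linear_scal_l|].
  intros x Hx. specialize (H1 x Hx). intros eps. generalize (H1 eps).
  apply filter_imp. intros y E.
  rewrite norm_C_R in E.
  match type of E with Cmod ?v <= _ * ?n =>
    set (V := v : C) in E; change (Rabs (snd V) <= eps * n) end.
  eapply Rle_trans; [apply Rabs_snd_le_Cmod|exact E].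
Qed.

Lemma is_derive_Cmult (f g : R -> C) (t : R) (df dg : C) :
  is_derive (V := C_R_NormedModule) f t df -> is_derive (V := C_R_NormedModule) g t dg ->
  is_derive (V := C_R_NormedModule) (fun s => f s * g s)%C t (df * g t + f t * dg)%C.
Proof.
  intros Hf Hg.
  pose proof (is_derive_C_fst _ _ _ Hf). pose proof (is_derive_C_snd _ _ _ Hf).
  pose proof (is_derive_C_fst _ _ _ Hg). pose proof (is_derive_C_snd _ _ _ Hg).
  apply is_derive_C_pair; simpl.
  - evar_last; [apply (is_derive_minus (V := R_NormedModule)); apply (is_derive_mult (K := R_AbsRing));
      [eassumption|eassumption|exact Rmult_comm|eassumption|eassumption|exact Rmult_comm]|].
    unfold minus, plus, opp, mult; simpl. ring.
  - evar_last; [apply (is_derive_plus (V := R_NormedModule)); apply (is_derive_mult (K := R_AbsRing));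
      [eassumption|eassumption|exact Rmult_comm|eassumption|eassumption|exact Rmult_comm]|].
    unfold minus, plus, opp, mult; simpl. ring.
Qed.

Lemma is_derive_Cconst (c : C) (t : R) :
  is_derive (V := C_R_NormedModule) (fun _ => c) t (RtoC 0).
Proof. apply (is_derive_const (V := C_R_NormedModule)). Qed.

Lemma is_derive_Cplus (f g : R -> C) (t : R) (df dg : C) :
  is_derive (V := C_R_NormedModule) f t df -> is_derive (V := C_R_NormedModule) g t dg ->
  is_derive (V := C_R_NormedModule) (fun s => f s + g s)%C t (df + dg)%C.
Proof. intros; apply (is_derive_plus (V := C_R_NormedModule)); assumption. Qed.

Lemma is_derive_RtoC (f : R -> R) (t l : R) :
  is_derive f t l -> is_derive (V := C_R_NormedModule) (fun s => RtoC (f s)) t (RtoC l).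
Proof.
  intros H. apply is_derive_C_pair; simpl; [exact H|apply (is_derive_const (V := R_NormedModule))].
Qed.

Lemma is_derive_C_continuous (f : R -> C) (t : R) (l : C) :
  is_derive (V := C_R_NormedModule) f t l -> continuous (U := C_UniformSpace) f t.
Proof. intros H. apply (ex_derive_continuous (V := C_R_NormedModule)). exists l; exact H. Qed.

Lemma ex_CInt (f : R -> C) (a b : R) :
  a <= b -> (forall t, a <= t <= b -> continuous (U := C_UniformSpace) f t) ->
  ex_RInt (V := C_R_CompleteNormedModule) f a b.
Proof.
  intros Hab H. apply (ex_RInt_continuous (V := C_R_CompleteNormedModule)).
  rewrite Rmin_left, Rmax_right by exact Hab. exact H.
Qed.

Lemma CInt_ext (f g : R -> C) (a b : R) :
  a <= b -> (forall t, a <= t <= b -> f t = g t) -> CInt f a b = CInt g a b.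
Proof.
  intros Hab H. apply (RInt_ext (V := C_R_CompleteNormedModule)).
  rewrite Rmin_left, Rmax_right by exact Hab. intros t Ht. apply H. lra.
Qed.

Lemma CInt_plus (f g : R -> C) (a b : R) :
  ex_RInt (V := C_R_CompleteNormedModule) f a b -> ex_RInt (V := C_R_CompleteNormedModule) g a b ->
  CInt (fun t => f t + g t)%C a b = (CInt f a b + CInt g a b)%C.
Proof. intros; apply (RInt_plus (V := C_R_CompleteNormedModule)); assumption. Qed.

Lemma CInt_minus (f g : R -> C) (a b : R) :
  ex_RInt (V := C_R_CompleteNormedModule) f a b -> ex_RInt (V := C_R_CompleteNormedModule) g a b ->
  CInt (fun t => f t - g t)%C a b = (CInt f a b - CInt g a b)%C.
Proof. intros; apply (RInt_minus (V := C_R_CompleteNormedModule)); assumption. Qed.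

Lemma CInt_Chasles (f : R -> C) (a b c : R) :
  ex_RInt (V := C_R_CompleteNormedModule) f a b -> ex_RInt (V := C_R_CompleteNormedModule) f b c ->
  (CInt f a b + CInt f b c = CInt f a c)%C.
Proof. intros; apply (RInt_Chasles (V := C_R_CompleteNormedModule)); assumption. Qed.

Lemma CInt_components (f : R -> C) (a b : R) :
  ex_RInt (V := C_R_CompleteNormedModule) f a b ->
  ex_RInt (fun t => fst (f t)) a b /\ ex_RInt (fun t => snd (f t)) a b /\
  CInt f a b = (RInt (fun t => fst (f t)) a b, RInt (fun t => snd (f t)) a b).
Proof.
  intros [l Hl].
  assert (H1 := is_RInt_fct_extend_fst (U := R_NormedModule) (V := R_NormedModule) f a b l Hl).
  assert (H2 := is_RInt_fct_extend_snd (U := R_NormedModule) (V := R_NormedModule) f a b l Hl).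
  split; [exists (fst l); exact H1|]. split; [exists (snd l); exact H2|].
  assert (E1 : RInt (fun t => fst (f t)) a b = fst l) by (apply is_RInt_unique; exact H1).
  assert (E2 : RInt (fun t => snd (f t)) a b = snd l) by (apply is_RInt_unique; exact H2).
  rewrite E1, E2.
  rewrite <- surjective_pairing. apply (is_RInt_unique (V := C_R_CompleteNormedModule)), Hl.
Qed.

Lemma is_CInt_pair (f : R -> C) (a b : R) (l : C) :
  is_RInt (fun t => fst (f t)) a b (fst l) -> is_RInt (fun t => snd (f t)) a b (snd l) ->
  is_RInt (V := C_R_CompleteNormedModule) f a b l.
Proof.
  intros H1 H2. rewrite (surjective_pairing l).
  apply (is_RInt_fct_extend_pair (U := R_NormedModule) (V := R_NormedModule)); assumption.
Qed.

(** The integral takes its values in a real module, so linearity over complex scalars is checked on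
    components. *)
Lemma CInt_scal (c : C) (f : R -> C) (a b : R) :
  ex_RInt (V := C_R_CompleteNormedModule) f a b ->
  CInt (fun t => c * f t)%C a b = (c * CInt f a b)%C.
Proof.
  intros H. destruct (CInt_components f a b H) as [H1 [H2 E]]. rewrite E.
  apply (is_RInt_unique (V := C_R_CompleteNormedModule)).
  apply (RInt_correct (V := R_CompleteNormedModule)) in H1.
  apply (RInt_correct (V := R_CompleteNormedModule)) in H2.
  apply is_CInt_pair; simpl.
  - apply (is_RInt_minus (V := R_NormedModule)); apply (is_RInt_scal (V := R_NormedModule)); assumption.
  - apply (is_RInt_plus (V := R_NormedModule)); apply (is_RInt_scal (V := R_NormedModule)); assumption.
Qed.

Lemma Cmod_CInt_le (f : R -> C) (a b M : R) :
  a <= b -> ex_RInt (V := C_R_CompleteNormedModule) f a b ->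
  (forall t, a <= t <= b -> Cmod (f t) <= M) -> Cmod (CInt f a b) <= (b - a) * M.
Proof.
  intros Hab H HM.
  rewrite <- norm_C_R.
  apply (norm_RInt_le_const (V := C_R_NormedModule) f a b (CInt f a b) M Hab).
  { intros t Ht. rewrite norm_C_R. apply HM, Ht. }
  apply (RInt_correct (V := C_R_CompleteNormedModule)), H.
Qed.

Lemma CInt_derive (f df : R -> C) (a b : R) :
  a <= b -> (forall t, a <= t <= b -> is_derive (V := C_R_NormedModule) f t (df t)) ->
  (forall t, a <= t <= b -> continuous (U := C_UniformSpace) df t) ->
  CInt df a b = (f b - f a)%C.
Proof.
  intros Hab H1 H2. apply (is_RInt_unique (V := C_R_CompleteNormedModule)).
  apply (is_RInt_derive (V := C_R_CompleteNormedModule));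
    rewrite Rmin_left, Rmax_right by exact Hab; assumption.
Qed.

Lemma Cmod_increment_le (f df : R -> C) (a b M : R) :
  a <= b -> (forall t, a <= t <= b -> is_derive (V := C_R_NormedModule) f t (df t)) ->
  (forall t, a <= t <= b -> continuous (U := C_UniformSpace) df t) ->
  (forall t, a <= t <= b -> Cmod (df t) <= M) -> Cmod (f b - f a) <= (b - a) * M.
Proof.
  intros Hab H1 H2 HM. rewrite <- (CInt_derive f df a b Hab H1 H2).
  apply Cmod_CInt_le; try assumption. apply ex_CInt; assumption.
Qed.

(* The affine part integrates exactly, to the increment of its primitive [P]. *)
Lemma curve_integral_affine (F : C -> C) (g dg : R -> C) (a b : R) (A B : C) (eta L : R) :
  a <= b -> 0 <= eta ->
  (forall t, a <= t <= b -> is_derive (V := C_R_NormedModule) g t (dg t)) ->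
  (forall t, a <= t <= b -> continuous (U := C_UniformSpace) dg t) ->
  (forall t, a <= t <= b -> continuous (U := C_UniformSpace) (fun s => F (g s)) t) ->
  (forall t, a <= t <= b -> Cmod (dg t) <= L) ->
  (forall t, a <= t <= b -> Cmod (F (g t) - (A + B * g t)) <= eta) ->
  let P z := (A * z + B / 2 * (z * z))%C in
  Cmod (CInt (fun t => F (g t) * dg t)%C a b - (P (g b) - P (g a))) <= (b - a) * (eta * L).
Proof.
  intros Hab Heta Hg Hc HF HL He P.
  assert (Hgc : forall t, a <= t <= b -> continuous (U := C_UniformSpace) g t).
  { intros t Ht. eapply is_derive_C_continuous, Hg, Ht. }
  assert (C1 : forall t, a <= t <= b -> continuous (U := C_UniformSpace) (fun t => F (g t) * dg t)%C t).
  { intros t Ht. apply continuous_Cmult; auto. }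
  assert (C2 : forall t, a <= t <= b -> continuous (U := C_UniformSpace) (fun t => (A + B * g t) * dg t)%C t).
  { intros t Ht. apply continuous_Cmult; auto. apply continuous_Cplus; [apply continuous_Cconst|].
    apply continuous_Cmult; [apply continuous_Cconst|auto]. }
  rewrite <- (CInt_derive (fun t => P (g t)) (fun t => (A + B * g t) * dg t)%C a b Hab).
  - rewrite <- CInt_minus by (apply ex_CInt; assumption).
    apply Cmod_CInt_le; [exact Hab| |].
    + apply ex_CInt; [exact Hab|]. intros t Ht. apply continuous_Cminus; auto.
    + intros t Ht.
      replace (F (g t) * dg t - (A + B * g t) * dg t)%C with ((F (g t) - (A + B * g t)) * dg t)%C by ring.
      rewrite Cmod_mult. apply Rmult_le_compat; auto using Cmod_ge_0.
  - intros t Ht. unfold P. evar_last.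
    + apply is_derive_Cplus; apply is_derive_Cmult;
        [apply is_derive_Cconst|apply Hg, Ht|apply is_derive_Cconst|apply is_derive_Cmult; apply Hg, Ht].
    + simpl. field.
  - exact C2.
Qed.

(** * Goursat's theorem *)

Lemma nested_intervals (p q : nat -> R) :
  (forall n, p n <= p (S n)) -> (forall n, q (S n) <= q n) -> (forall n, p n <= q n) ->
  exists s, forall n, p n <= s <= q n.
Proof.
  intros Hp Hq Hpq.
  assert (Mp : forall n k, p n <= p (n + k)%nat).
  { intros n k; induction k as [|k IH]; [rewrite Nat.add_0_r; lra|].
    rewrite Nat.add_succ_r. generalize (Hp (n + k)%nat). lra. }
  assert (Mq : forall n k, q (n + k)%nat <= q n).
  { intros n k; induction k as [|k IH]; [rewrite Nat.add_0_r; lra|].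
    rewrite Nat.add_succ_r. generalize (Hq (n + k)%nat). lra. }
  assert (Mpq : forall m n, p m <= q n).
  { intros m n. generalize (Mp m n) (Mq n m) (Hpq (m + n)%nat).
    rewrite (Nat.add_comm n m). lra. }
  destruct (completeness (fun x => exists n, x = p n)) as [s [Hs1 Hs2]].
  - exists (q 0%nat). intros x [n ->]. apply Mpq.
  - exists (p 0%nat), 0%nat. reflexivity.
  - exists s. intros n. split.
    + apply Hs1. exists n. reflexivity.
    + apply Hs2. intros x [m ->]. apply Mpq.
Qed.

(** The integral of the form [X ds + Y dt] around the rectangle [[p, q] x [a, b]],
    counterclockwise. *)
Definition rect_boundary (X Y : R -> R -> C) (p q a b : R) : C :=
  (CInt (fun t => Y q t) a b - CInt (fun t => Y p t) a b
   - (CInt (fun s => X s b) p q - CInt (fun s => X s a) p q))%C.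

Section Bisection.
Variables (X Y : R -> R -> C) (P Q A B : R).
Hypothesis HPQ : P <= Q.
Hypothesis HAB : A <= B.
Hypothesis cX : forall s t, P <= s <= Q -> A <= t <= B ->
  continuous (U := C_UniformSpace) (fun s => X s t) s.
Hypothesis cY : forall s t, P <= s <= Q -> A <= t <= B ->
  continuous (U := C_UniformSpace) (fun t => Y s t) t.

Lemma rect_boundary_split p q a b m n :
  P <= p <= m -> m <= q <= Q -> A <= a <= n -> n <= b <= B ->
  (rect_boundary X Y p q a b =
   rect_boundary X Y p m a n + rect_boundary X Y m q a n
   + rect_boundary X Y p m n b + rect_boundary X Y m q n b)%C.
Proof.
  intros H1 H2 H3 H4. unfold rect_boundary.
  assert (EY : forall s, P <= s <= Q ->
     CInt (fun t => Y s t) a b = (CInt (fun t => Y s t) a n + CInt (fun t => Y s t) n b)%C).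
  { intros s Hs. symmetry. apply CInt_Chasles; apply ex_CInt; try lra; intros; apply cY; lra. }
  assert (EX : forall t, A <= t <= B ->
     CInt (fun s => X s t) p q = (CInt (fun s => X s t) p m + CInt (fun s => X s t) m q)%C).
  { intros t Ht. symmetry. apply CInt_Chasles; apply ex_CInt; try lra; intros; apply cX; lra. }
  rewrite !EY, !EX by lra. ring.
Qed.

(** The nested rectangles all contain their limit point [(s, t)], so an estimate for rectangles
    around one fixed point is enough. *)
Hypothesis Hloc : forall s t, P <= s <= Q -> A <= t <= B -> forall eps, 0 < eps ->
  exists d, 0 < d /\ forall p q a b, P <= p <= s -> s <= q <= Q -> A <= a <= t -> t <= b <= B ->
  q - p < d -> b - a < d -> Cmod (rect_boundary X Y p q a b) <= eps * (q - p + (b - a)) ^ 2.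

(** Half the perimeter. Its square is divided by 4 when the sides are halved, exactly like the
    average of the boundary integral over four quarters. *)
Let size (r : (R * R) * (R * R)) := snd (fst r) - fst (fst r) + (snd (snd r) - fst (snd r)).
Let bd (r : (R * R) * (R * R)) :=
  Cmod (rect_boundary X Y (fst (fst r)) (snd (fst r)) (fst (snd r)) (snd (snd r))).
Let sub (r : (R * R) * (R * R)) :=
  P <= fst (fst r) <= snd (fst r) /\ snd (fst r) <= Q /\
  A <= fst (snd r) <= snd (snd r) /\ snd (snd r) <= B.

(** The first quarter exceeding the bound; the last one is taken untested, since it must exceed the
    bound when the three others do not. *)
Let next (eps : R) (r : (R * R) * (R * R)) :=
  let '((p, q), (a, b)) := r in
  let m := (p + q) / 2 in let n := (a + b) / 2 in
  let big r' := Rlt_dec (eps * size r' ^ 2) (bd r') in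
  if big ((p, m), (a, n)) then ((p, m), (a, n)) else
  if big ((m, q), (a, n)) then ((m, q), (a, n)) else
  if big ((p, m), (n, b)) then ((p, m), (n, b)) else ((m, q), (n, b)).

Lemma next_spec eps r : sub r -> eps * size r ^ 2 < bd r ->
  let r' := next eps r in
  sub r' /\ eps * size r' ^ 2 < bd r' /\
  (fst (fst r) <= fst (fst r') /\ snd (fst r') <= snd (fst r) /\
   fst (snd r) <= fst (snd r') /\ snd (snd r') <= snd (snd r)) /\
  snd (fst r') - fst (fst r') = (snd (fst r) - fst (fst r)) / 2 /\
  snd (snd r') - fst (snd r') = (snd (snd r) - fst (snd r)) / 2.
Proof.
  destruct r as [[p q] [a b]]. intros Hsub Hb.
  assert (Hm : exists m, m = (p + q) / 2) by eauto. assert (Hn : exists n, n = (a + b) / 2) by eauto.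
  destruct Hm as [m Em], Hn as [n En].
  assert (Hr : forall r', r' = ((p, m), (a, n)) \/ r' = ((m, q), (a, n)) \/
                          r' = ((p, m), (n, b)) \/ r' = ((m, q), (n, b)) ->
     sub r' /\ (p <= fst (fst r') /\ snd (fst r') <= q /\ a <= fst (snd r') /\ snd (snd r') <= b) /\
     snd (fst r') - fst (fst r') = (q - p) / 2 /\ snd (snd r') - fst (snd r') = (b - a) / 2).
  { clear Hb. unfold sub in *; simpl in Hsub.
    intros r' [-> | [-> | [-> | ->]]]; cbn [fst snd]; repeat split; lra. }
  assert (Hs : forall r', r' = ((p, m), (a, n)) \/ r' = ((m, q), (a, n)) \/
                          r' = ((p, m), (n, b)) \/ r' = ((m, q), (n, b)) ->
     size r' = size ((p, q), (a, b)) / 2).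
  { intros r' H. unfold size. destruct (Hr r' H) as [_ [_ [-> ->]]]. simpl. field. }
  assert (Hbig : bd ((p, q), (a, b)) <=
    bd ((p, m), (a, n)) + bd ((m, q), (a, n)) + bd ((p, m), (n, b)) + bd ((m, q), (n, b))).
  { unfold bd. cbn [fst snd]. unfold sub in Hsub; cbn [fst snd] in Hsub. clear - Hsub cX cY Em En.
    rewrite (rect_boundary_split p q a b m n) by lra.
    eapply Rle_trans; [apply Cmod_triangle|]. apply Rplus_le_compat_r.
    eapply Rle_trans; [apply Cmod_triangle|]. apply Rplus_le_compat_r. apply Cmod_triangle. }
  assert (Hn : exists r', next eps ((p, q), (a, b)) = r' /\ eps * size r' ^ 2 < bd r' /\
     (r' = ((p, m), (a, n)) \/ r' = ((m, q), (a, n)) \/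
      r' = ((p, m), (n, b)) \/ r' = ((m, q), (n, b)))).
  { unfold next. rewrite <- Em, <- En.
    destruct (Rlt_dec _ _) as [L1|L1]; [eauto 7|].
    destruct (Rlt_dec _ _) as [L2|L2]; [eauto 7|].
    destruct (Rlt_dec _ _) as [L3|L3]; [eauto 7|].
    (* Each quarter has a fourth of the original bound. Three quarters within it and a total above
       the whole bound leave the excess to the last one. *)
    eexists. split; [reflexivity|]. split; [|tauto].
    rewrite Hs in L1, L2, L3 |- * by tauto.
    generalize dependent (size ((p, q), (a, b))). intros S. intros.
    clear - L1 L2 L3 Hb Hbig. apply Rnot_lt_le in L1, L2, L3.
    replace (eps * (S / 2) ^ 2) with (eps * S ^ 2 / 4) in * by field. lra. }
  destruct Hn as [r' [-> [H1 H2]]]. cbv zeta. cbn [fst snd].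
  destruct (Hr r' H2) as [U1 [U2 U3]]. tauto.
Qed.

(** A nonzero value makes the whole rectangle exceed the bound for some [eps]. Successive bad
    quarters shrink to a point, where [Hloc] forbids them. *)
Lemma rect_boundary_zero : rect_boundary X Y P Q A B = 0%C.
Proof.
  apply Cmod_eq_0. apply Rle_antisym; [|apply Cmod_ge_0].
  apply Rnot_lt_le. intros Hpos.
  assert (Hex : exists eps, 0 < eps /\ eps * size ((P, Q), (A, B)) ^ 2 < bd ((P, Q), (A, B))).
  { set (S2 := size ((P, Q), (A, B)) ^ 2). assert (0 <= S2) by apply pow2_ge_0.
    (* The [+ 1] avoids a division by zero for a degenerate rectangle. *)
    exists (Cmod (rect_boundary X Y P Q A B) / 2 / (S2 + 1)). split.
    - apply Rdiv_lt_0_compat; lra.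
    - unfold bd; simpl. apply Rle_lt_trans with (Cmod (rect_boundary X Y P Q A B) / 2); [|lra].
      apply Rmult_le_reg_r with (S2 + 1); [lra|].
      unfold Rdiv at 1. replace (Cmod (rect_boundary X Y P Q A B) / 2 * / (S2 + 1) * S2 * (S2 + 1))
        with (Cmod (rect_boundary X Y P Q A B) / 2 * S2) by (field; lra). nra. }
  destruct Hex as [eps [Heps Hbad]].
  set (r := fun n => Nat.iter n (next eps) ((P, Q), (A, B))).
  assert (Hr : forall n, sub (r n) /\ eps * size (r n) ^ 2 < bd (r n)).
  { induction n as [|n [IH1 IH2]]; simpl.
    - split; [unfold sub; simpl; lra|exact Hbad].
    - destruct (next_spec eps (r n) IH1 IH2) as [U1 [U2 _]]. split; assumption. }
  assert (Hw : forall n, snd (fst (r n)) - fst (fst (r n)) = (Q - P) / 2 ^ n /\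
                         snd (snd (r n)) - fst (snd (r n)) = (B - A) / 2 ^ n).
  { induction n as [|n IH]; simpl; [lra|]. destruct (Hr n) as [U1 U2].
    destruct (next_spec eps (r n) U1 U2) as [_ [_ [_ [V1 V2]]]].
    unfold r in *. rewrite V1, V2. destruct IH as [-> ->].
    assert (2 ^ n <> 0) by (apply pow_nonzero; lra). split; field; assumption. }
  destruct (nested_intervals (fun n => fst (fst (r n))) (fun n => snd (fst (r n)))) as [s Hs];
    [intros n; destruct (Hr n) as [U1 U2]; apply (next_spec eps (r n) U1 U2)..
    |intros n; apply (proj1 (Hr n))|].
  destruct (nested_intervals (fun n => fst (snd (r n))) (fun n => snd (snd (r n)))) as [t Ht];
    [intros n; destruct (Hr n) as [U1 U2]; apply (next_spec eps (r n) U1 U2)..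
    |intros n; apply (proj1 (Hr n))|].
  destruct (Hloc s t (Hs 0%nat) (Ht 0%nat) eps Heps) as [d [Hd Hl]].
  destruct (pow_lt_1_zero (1 / 2)) with (y := d / (Q - P + (B - A) + 1)) as [N HN].
  { rewrite Rabs_pos_eq; lra. }
  { apply Rdiv_lt_0_compat; lra. }
  specialize (HN N (le_n _)).
  assert (E2 : (1 / 2) ^ N = / 2 ^ N) by (unfold Rdiv; rewrite Rmult_1_l, pow_inv; reflexivity).
  assert (P2 : 0 < / 2 ^ N) by (apply Rinv_0_lt_compat, pow_lt; lra).
  rewrite E2, Rabs_pos_eq in HN by lra.
  assert (HN' : (Q - P + (B - A) + 1) * / 2 ^ N < d).
  { apply Rmult_lt_compat_l with (r := Q - P + (B - A) + 1) in HN; [|lra].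
    replace ((Q - P + (B - A) + 1) * (d / (Q - P + (B - A) + 1))) with d in HN by (field; lra). exact HN. }
  destruct (Hr N) as [[U1 [U2 [U3 U4]]] Hbig]. destruct (Hw N) as [W1 W2].
  specialize (Hs N). specialize (Ht N).
  apply (Rlt_not_le _ _ Hbig). unfold bd, size.
  apply Hl; lra.
Qed.
End Bisection.

(** Goursat's argument for the pullback of [F dz] by a parametrised surface [G]. This form serves
    both polar coordinates and homotopies contracting an arc to a point. Near a point [F] is affine
    up to a small error; the affine part has a primitive and contributes nothing around a closed
    contour. *)
Lemma Goursat (F : C -> C) (G Gs Gt : R -> R -> C) (P Q A B L : R) :
  P <= Q -> A <= B ->
  (forall s t, P <= s <= Q -> A <= t <= B ->
     is_derive (V := C_R_NormedModule) (fun s => G s t) s (Gs s t)) ->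
  (forall s t, P <= s <= Q -> A <= t <= B ->
     is_derive (V := C_R_NormedModule) (fun t => G s t) t (Gt s t)) ->
  (forall s t, P <= s <= Q -> A <= t <= B ->
     continuous (U := C_UniformSpace) (fun s => Gs s t) s) ->
  (forall s t, P <= s <= Q -> A <= t <= B ->
     continuous (U := C_UniformSpace) (fun t => Gt s t) t) ->
  (forall s t, P <= s <= Q -> A <= t <= B -> Cmod (Gs s t) <= L /\ Cmod (Gt s t) <= L) ->
  (forall s t, P <= s <= Q -> A <= t <= B -> cdiff F (G s t)) ->
  rect_boundary (fun s t => F (G s t) * Gs s t)%C (fun s t => F (G s t) * Gt s t)%C P Q A B = 0%C.
Proof.
  intros HPQ HAB Ds Dt Cs Ct HL HF.
  assert (L0 : 0 <= L).
  { eapply Rle_trans; [apply Cmod_ge_0|apply (HL P A); lra]. }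
  assert (CFs : forall s t, P <= s <= Q -> A <= t <= B ->
     continuous (U := C_UniformSpace) (fun s => F (G s t)) s).
  { intros s t Hs Ht.
    apply (continuous_comp (V := C_UniformSpace) (W := C_UniformSpace) (fun s => G s t) F).
    - eapply is_derive_C_continuous, Ds; assumption.
    - apply cdiff_continuous, HF; assumption. }
  assert (CFt : forall s t, P <= s <= Q -> A <= t <= B ->
     continuous (U := C_UniformSpace) (fun t => F (G s t)) t).
  { intros s t Hs Ht.
    apply (continuous_comp (V := C_UniformSpace) (W := C_UniformSpace) (fun t => G s t) F).
    - eapply is_derive_C_continuous, Dt; assumption.
    - apply cdiff_continuous, HF; assumption. }
  apply rect_boundary_zero; try assumption.
  - intros s t Hs Ht. apply continuous_Cmult; auto.
  - intros s t Hs Ht. apply continuous_Cmult; auto.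
  - intros s t Hs Ht eps Heps.
    destruct (HF s t Hs Ht) as [k [Hk Ck]].
    (* Chosen so that [2 * L * L * eta <= eps], with [L + 1] positive even if [L = 0]. *)
    set (eta := eps / (2 * (L + 1) * (L + 1))).
    assert (Heta : 0 < eta) by (apply Rdiv_lt_0_compat; nra).
    generalize (filter_and _ _ Hk (proj1 (continuous_C_iff k _) Ck (mkposreal _ Heta))).
    intros Hlc. apply locally_Cmod in Hlc. destruct Hlc as [d Hd]. simpl in Hd.
    (* Sides shorter than this keep the image of the rectangle within [d] of [G s t], where [k]
       varies by less than [eta]. *)
    exists (d / (2 * (L + 1))). split; [apply Rdiv_lt_0_compat; [apply d|lra]|].
    intros p q a b H1 H2 H3 H4 Hw Hh.
    set (sz := q - p + (b - a)).
    assert (Hsz : (L + 1) * sz < d).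
    { apply Rmult_lt_compat_l with (r := 2 * (L + 1)) in Hw; [|lra].
      apply Rmult_lt_compat_l with (r := 2 * (L + 1)) in Hh; [|lra].
      replace (2 * (L + 1) * (d / (2 * (L + 1)))) with (pos d) in Hw, Hh by (field; lra).
      unfold sz. lra. }
    assert (Incr : forall s' t', p <= s' <= q -> a <= t' <= b -> Cmod (G s' t' - G s t) <= L * sz).
    { intros s' t' Hs' Ht'.
      assert (I1 : Cmod (G s' t' - G s t') <= L * (q - p)).
      { destruct (Rle_dec s s') as [D|D].
        - eapply Rle_trans; [apply (Cmod_increment_le (fun s => G s t') (fun s => Gs s t') s s' L D)|];
            try (intros; (apply Ds || apply Cs || apply HL); lra). nra.
        - apply Rnot_le_lt in D. rewrite <- Cmod_opp, Copp_minus_distr.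
          eapply Rle_trans; [apply (Cmod_increment_le (fun s => G s t') (fun s => Gs s t') s' s L)|];
            try (intros; (apply Ds || apply Cs || apply HL); lra); [lra|nra]. }
      assert (I2 : Cmod (G s t' - G s t) <= L * (b - a)).
      { destruct (Rle_dec t t') as [D|D].
        - eapply Rle_trans; [apply (Cmod_increment_le (fun t => G s t) (fun t => Gt s t) t t' L D)|];
            try (intros; (apply Dt || apply Ct || apply HL); lra). nra.
        - apply Rnot_le_lt in D. rewrite <- Cmod_opp, Copp_minus_distr.
          eapply Rle_trans; [apply (Cmod_increment_le (fun t => G s t) (fun t => Gt s t) t' t L)|];
            try (intros; (apply Dt || apply Ct || apply HL); lra); [lra|nra]. }
      replace (G s' t' - G s t)%C with ((G s' t' - G s t') + (G s t' - G s t))%C by ring.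
      eapply Rle_trans; [apply Cmod_triangle|]. unfold sz. lra. }
    assert (Sz0 : 0 <= sz) by (unfold sz; lra).
    (* The tangent affine map of [F] at [G s t], with primitive [Pr] below. *)
    set (B0 := k (G s t)). set (A0 := (F (G s t) - B0 * G s t)%C).
    assert (Aff : forall s' t', p <= s' <= q -> a <= t' <= b ->
      Cmod (F (G s' t') - (A0 + B0 * G s' t')) <= eta * (L * sz)).
    { intros s' t' Hs' Ht'. pose proof (Incr s' t' Hs' Ht') as I.
      destruct (Hd (G s' t')) as [E1 E2]; [lra|].
      rewrite E1. unfold A0, B0.
      replace (F (G s t) + k (G s' t') * (G s' t' - G s t) - (F (G s t) - k (G s t) * G s t + k (G s t) * G s' t'))%C
        with ((k (G s' t') - k (G s t)) * (G s' t' - G s t))%C by ring.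
      rewrite Cmod_mult. apply Rmult_le_compat; auto using Cmod_ge_0. lra. }
    assert (N0 : 0 <= eta * (L * sz)) by (apply Rmult_le_pos; [lra|apply Rmult_le_pos; lra]).
    set (Pr := fun z => (A0 * z + B0 / 2 * (z * z))%C).
    assert (Et : forall s', p <= s' <= q ->
      Cmod (CInt (fun t => F (G s' t) * Gt s' t)%C a b - (Pr (G s' b) - Pr (G s' a)))
        <= (b - a) * (eta * (L * sz) * L)).
    { intros s' Hs'. apply (curve_integral_affine F (fun t => G s' t) (fun t => Gt s' t));
        try (intros; (apply Dt || apply Ct || apply CFt || apply Aff || apply HL); lra); lra. }
    assert (Es : forall t', a <= t' <= b ->
      Cmod (CInt (fun s => F (G s t') * Gs s t')%C p q - (Pr (G q t') - Pr (G p t')))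
        <= (q - p) * (eta * (L * sz) * L)).
    { intros t' Ht'. apply (curve_integral_affine F (fun s => G s t') (fun s => Gs s t'));
        try (intros; (apply Ds || apply Cs || apply CFs || apply Aff || apply HL); lra); lra. }
    pose proof (Et p ltac:(lra)) as T1. pose proof (Et q ltac:(lra)) as T2.
    pose proof (Es a ltac:(lra)) as S1. pose proof (Es b ltac:(lra)) as S2.
    unfold rect_boundary. cbv beta.
    match type of T1 with Cmod (?I - ?J) <= _ => set (IT1 := I) in *; set (JT1 := J) in * end.
    match type of T2 with Cmod (?I - ?J) <= _ => set (IT2 := I) in *; set (JT2 := J) in * end.
    match type of S1 with Cmod (?I - ?J) <= _ => set (IS1 := I) in *; set (JS1 := J) in * end.
    match type of S2 with Cmod (?I - ?J) <= _ => set (IS2 := I) in *; set (JS2 := J) in * end.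
    (* The increments of [Pr] along the four sides add up to zero, so only the four remainders are
       left. *)
    replace (IT2 - IT1 - (IS2 - IS1))%C
      with ((IT2 - JT2) + - (IT1 - JT1) + - (IS2 - JS2) + (IS1 - JS1))%C
      by (unfold JT1, JT2, JS1, JS2, Pr; ring).
    eapply Rle_trans; [apply Cmod_triangle|].
    eapply Rle_trans; [apply Rplus_le_compat_r, Cmod_triangle|].
    eapply Rle_trans; [apply Rplus_le_compat_r, Rplus_le_compat_r, Cmod_triangle|].
    rewrite !Cmod_opp.
    apply Rle_trans with (2 * sz * (eta * (L * sz) * L)).
    { unfold sz in *. lra. }
    replace (2 * sz * (eta * (L * sz) * L)) with ((2 * L * L * eta) * sz ^ 2) by ring.
    apply Rmult_le_compat_r; [apply pow2_ge_0|].
    assert (Ee : eps = 2 * (L + 1) * (L + 1) * eta) by (unfold eta; field; lra).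
    clearbody eta. rewrite Ee. clear - L0 Heta.
    replace (2 * (L + 1) * (L + 1) * eta) with (2 * L * L * eta + (4 * L + 2) * eta) by ring.
    assert (0 <= (4 * L + 2) * eta) by (apply Rmult_le_pos; lra). lra.
Qed.

(** * Integrals with a parameter *)

(* Composition with [clamp] turns continuity relative to a closed set into continuity at every point. *)
Definition clamp (a b t : R) : R := Rmax a (Rmin t b).

Lemma clamp_in a b t : a <= b -> a <= clamp a b t <= b.
Proof. intros H. unfold clamp, Rmax, Rmin. destruct (Rle_dec t b), (Rle_dec a _); lra. Qed.

Lemma clamp_id a b t : a <= t <= b -> clamp a b t = t.
Proof. intros H. unfold clamp. rewrite Rmin_left, Rmax_right; lra. Qed.

Lemma clamp_lipschitz a b s t : Rabs (clamp a b s - clamp a b t) <= Rabs (s - t).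
Proof.
  unfold clamp, Rmax, Rmin.
  destruct (Rle_dec t b), (Rle_dec s b); repeat destruct (Rle_dec a _);
    unfold Rabs; repeat destruct (Rcase_abs _); lra.
Qed.

Lemma continuous_clamp {T : UniformSpace} a b (f : T -> R) x :
  continuous f x -> continuous (fun y => clamp a b (f y)) x.
Proof.
  intros Hf. apply filterlim_locally. intros eps.
  generalize (proj1 (filterlim_locally _ _) Hf eps). apply filter_imp. intros y Hy.
  change (Rabs (f y - f x) < eps) in Hy.
  change (Rabs (clamp a b (f y) - clamp a b (f x)) < eps).
  eapply Rle_lt_trans; [apply clamp_lipschitz|exact Hy].
Qed.

Definition continuous2 (k : R -> R -> C) : Prop :=
  forall p : R * R, continuous (U := C_UniformSpace) (fun p => k (fst p) (snd p)) p.

Lemma continuous2_l k t s : continuous2 k -> continuous (U := C_UniformSpace) (fun s => k s t) s.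
Proof.
  intros H. apply (continuous_comp_2 (W := R_UniformSpace) (X := C_UniformSpace) (fun s => s) (fun _ => t) k).
  - apply continuous_id.
  - apply continuous_const.
  - apply (H (s, t)).
Qed.

Lemma continuous2_r k s t : continuous2 k -> continuous (U := C_UniformSpace) (fun t => k s t) t.
Proof.
  intros H. apply (continuous_comp_2 (W := R_UniformSpace) (X := C_UniformSpace) (fun _ => s) (fun t => t) k).
  - apply continuous_const.
  - apply continuous_id.
  - apply (H (s, t)).
Qed.

Lemma continuous2_swap k : continuous2 k -> continuous2 (fun t s => k s t).
Proof.
  intros H [t s]. apply (continuous_comp_2 (W := R_UniformSpace) (X := C_UniformSpace) snd fst k).
  - apply continuous_snd.
  - apply continuous_fst.
  - apply (H (s, t)).
Qed.

Lemma ex_CInt_r k a b s : a <= b -> continuous2 k ->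
  ex_RInt (V := C_R_CompleteNormedModule) (fun t => k s t) a b.
Proof. intros Hab H. apply ex_CInt; [exact Hab|]. intros; apply continuous2_r, H. Qed.

Lemma Heine2 k P Q a b eps : continuous2 k -> 0 < eps ->
  exists d, 0 < d /\ forall s s' t t', P <= s <= Q -> P <= s' <= Q -> a <= t <= b -> a <= t' <= b ->
    Rabs (s' - s) < d -> Rabs (t' - t) < d -> Cmod (k s' t' - k s t) < eps.
Proof.
  intros H He. assert (He2 : 0 < eps / 2) by lra.
  destruct (uniform_continuity_2d (fun s t => fst (k s t)) P Q a b) with (eps := mkposreal _ He2) as [d1 H1].
  { intros s t _ _. apply continuity_2d_pt_filterlim.
    apply (continuous_C_fst (fun p => k (fst p) (snd p)) (s, t)), H. }
  destruct (uniform_continuity_2d (fun s t => snd (k s t)) P Q a b) with (eps := mkposreal _ He2) as [d2 H2].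
  { intros s t _ _. apply continuity_2d_pt_filterlim.
    apply (continuous_C_snd (fun p => k (fst p) (snd p)) (s, t)), H. }
  exists (Rmin d1 d2). split; [apply Rmin_pos; [apply d1|apply d2]|].
  intros s s' t t' Hs Hs' Ht Ht' D1 D2.
  pose proof (Rmin_l d1 d2). pose proof (Rmin_r d1 d2).
  assert (A1 := H1 s t s' t' Hs Ht Hs' Ht' ltac:(lra) ltac:(lra)).
  assert (A2 := H2 s t s' t' Hs Ht Hs' Ht' ltac:(lra) ltac:(lra)). simpl in A1, A2.
  eapply Rle_lt_trans; [apply Cmod_le_sum|].
  change (Rabs (fst (k s' t') - fst (k s t)) + Rabs (snd (k s' t') - snd (k s t)) < eps). lra.
Qed.

(** Walking from the corner [(P, a)] in steps shorter than the modulus of continuity for 1, the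
    modulus grows by at most 1 per step. *)
Lemma bounded2 k P Q a b : continuous2 k ->
  exists M, 0 <= M /\ forall s t, P <= s <= Q -> a <= t <= b -> Cmod (k s t) <= M.
Proof.
  intros H. destruct (Heine2 k P Q a b 1 H Rlt_0_1) as [d [Hd Hk]].
  destruct (Rle_dec P Q) as [HPQ|HPQ]; [|exists 0; split; [lra|intros; lra]].
  destruct (Rle_dec a b) as [Hab|Hab]; [|exists 0; split; [lra|intros; lra]].
  assert (Hstep : forall n s t, P <= s <= Q -> a <= t <= b -> s <= P + INR n * (d / 2) ->
     t <= a + INR n * (d / 2) -> Cmod (k s t) <= Cmod (k P a) + INR n).
  { induction n as [|n IH]; intros s t Hs Ht Hsn Htn.
    - simpl in *. replace s with P by lra. replace t with a by lra. lra.
    - rewrite S_INR in *.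
      set (s0 := Rmax P (s - d / 2)). set (t0 := Rmax a (t - d / 2)).
      assert (0 <= INR n * (d / 2)) by (apply Rmult_le_pos; [apply pos_INR|lra]).
      assert (Hs0 : P <= s0 <= s /\ s - d / 2 <= s0 /\ s0 <= P + INR n * (d / 2))
        by (unfold s0, Rmax; destruct (Rle_dec _ _); lra).
      assert (Ht0 : a <= t0 <= t /\ t - d / 2 <= t0 /\ t0 <= a + INR n * (d / 2))
        by (unfold t0, Rmax; destruct (Rle_dec _ _); lra).
      specialize (IH s0 t0 ltac:(lra) ltac:(lra) ltac:(lra) ltac:(lra)).
      assert (K := Hk s0 s t0 t ltac:(lra) ltac:(lra) ltac:(lra) ltac:(lra)
        ltac:(rewrite Rabs_pos_eq; lra) ltac:(rewrite Rabs_pos_eq; lra)).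
      replace (k s t) with (k s0 t0 + (k s t - k s0 t0))%C by ring.
      eapply Rle_trans; [apply Cmod_triangle|]. lra. }
  destruct (INR_unbounded ((Q - P + (b - a)) / (d / 2))) as [n Hn].
  assert (Hn' : Q - P + (b - a) <= INR n * (d / 2)).
  { apply Rmult_lt_compat_r with (r := d / 2) in Hn; [|lra].
    unfold Rdiv at 1 in Hn. rewrite Rmult_assoc, Rinv_l, Rmult_1_r in Hn; lra. }
  exists (Cmod (k P a) + INR n). split.
  - generalize (Cmod_ge_0 (k P a)) (pos_INR n). lra.
  - intros s t Hs Ht. apply Hstep; try assumption; lra.
Qed.

Lemma continuous_CInt_param k a b : a <= b -> continuous2 k ->
  forall s, continuous (U := C_UniformSpace) (fun s => CInt (fun t => k s t) a b) s.
Proof.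
  intros Hab H s. apply continuous_C_iff. intros eps.
  assert (He : 0 < eps / (b - a + 1)) by (apply Rdiv_lt_0_compat; [apply eps|lra]).
  destruct (Heine2 k (s - 1) (s + 1) a b _ H He) as [d [Hd Hk]].
  assert (Hm : 0 < Rmin d 1) by (apply Rmin_pos; lra).
  exists (mkposreal _ Hm). intros s' Hs'. change (Rabs (s' - s) < Rmin d 1) in Hs'.
  pose proof (Rmin_l d 1). pose proof (Rmin_r d 1). simpl in *.
  assert (Hs'' : -1 <= s' - s <= 1) by (apply Rabs_le_between; lra).
  rewrite <- CInt_minus by (apply ex_CInt_r; assumption).
  apply Rle_lt_trans with ((b - a) * (eps / (b - a + 1))).
  - apply Cmod_CInt_le; [exact Hab| |].
    + apply ex_CInt; [exact Hab|]. intros; apply continuous_Cminus; apply continuous2_r, H.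
    + intros t Ht. left. apply Hk; try lra. rewrite Rminus_diag, Rabs_R0. lra.
  - assert (E : eps / (b - a + 1) * (b - a + 1) = eps) by (field; lra).
    set (e := eps / (b - a + 1)) in *. clearbody e.
    assert (0 < e) by lra. nra.
Qed.

Lemma CInt_rscal (c : R) (f : R -> C) (a b : R) :
  ex_RInt (V := C_R_CompleteNormedModule) f a b ->
  CInt (fun t => scal (V := C_R_NormedModule) c (f t)) a b = scal (V := C_R_NormedModule) c (CInt f a b).
Proof. intros; apply (RInt_scal (V := C_R_CompleteNormedModule)); assumption. Qed.

Lemma CInt_const (a b : R) (c : C) : CInt (fun _ => c) a b = scal (V := C_R_NormedModule) (b - a) c.
Proof. apply (RInt_const (V := C_R_CompleteNormedModule)). Qed.

Lemma CInt_point (f : R -> C) a : CInt f a a = RtoC 0.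
Proof. apply (RInt_point (V := C_R_CompleteNormedModule)). Qed.

Lemma Cmod_CInt_abs_le (f : R -> C) (x y M : R) :
  (forall t, continuous (U := C_UniformSpace) f t) ->
  (forall t, Rabs (t - x) <= Rabs (y - x) -> Cmod (f t) <= M) ->
  Cmod (CInt f x y) <= Rabs (y - x) * M.
Proof.
  intros Hc HM. rewrite <- norm_C_R.
  apply (norm_RInt_le_const_abs (V := C_R_NormedModule) f x y).
  - intros t Ht. rewrite norm_C_R. apply HM.
    unfold Rmin, Rmax in Ht. destruct (Rle_dec x y).
    + rewrite !Rabs_pos_eq; lra.
    + rewrite !Rabs_left1; lra.
  - apply (RInt_correct (V := C_R_CompleteNormedModule)).
    apply (ex_RInt_continuous (V := C_R_CompleteNormedModule)). intros; apply Hc.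
Qed.

Lemma ex_CInt_any (f : R -> C) (x y : R) :
  (forall t, continuous (U := C_UniformSpace) f t) ->
  ex_RInt (V := C_R_CompleteNormedModule) f x y.
Proof. intros Hc. apply (ex_RInt_continuous (V := C_R_CompleteNormedModule)). intros; apply Hc. Qed.

Lemma continuous_CInt_param_any k a b : continuous2 k ->
  forall s, continuous (U := C_UniformSpace) (fun s => CInt (fun t => k s t) a b) s.
Proof.
  intros H s. destruct (Rle_dec a b) as [Hab|Hab]; [apply continuous_CInt_param; assumption|].
  apply (continuous_ext (T := R_UniformSpace) (U := C_UniformSpace) (fun s => - CInt (fun t => k s t) b a)%C).
  - intros s'. apply (opp_RInt_swap (V := C_R_CompleteNormedModule)).
    apply ex_CInt_any. intros; apply continuous2_r, H.
  - apply continuous_Copp, continuous_CInt_param; [lra|exact H].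
Qed.

Lemma is_derive_CInt (f : R -> C) (a x : R) :
  (forall t, continuous (U := C_UniformSpace) f t) ->
  is_derive (V := C_R_NormedModule) (fun x => CInt f a x) x (f x).
Proof.
  intros Hc. apply (is_derive_RInt (V := C_R_NormedModule) f (fun x => CInt f a x) a x).
  - apply filter_forall. intros y.
    apply (RInt_correct (V := C_R_CompleteNormedModule)), ex_CInt_any, Hc.
  - apply Hc.
Qed.

(** Uniform continuity of [k] makes the error of the inner increments uniform in [t]. *)
Lemma is_derive_CInt_CInt k a c d x : c <= d -> continuous2 k ->
  is_derive (V := C_R_NormedModule) (fun x => CInt (fun t => CInt (fun s => k s t) a x) c d) x
    (CInt (fun t => k x t) c d).
Proof.
  intros Hcd H. split; [apply is_linear_scal_l|].
  intros x' Hx'. apply (is_filter_lim_locally_unique (V := AbsRing_NormedModule R_AbsRing)) in Hx'. subst x'.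
  intros eps.
  assert (He : 0 < eps / (d - c + 1)) by (apply Rdiv_lt_0_compat; [apply eps|lra]).
  destruct (Heine2 k (x - 1) (x + 1) c d _ H He) as [e [He0 Hk]].
  assert (Hm : 0 < Rmin e 1) by (apply Rmin_pos; lra).
  exists (mkposreal _ Hm). intros y Hy. change (Rabs (y - x) < Rmin e 1) in Hy.
  pose proof (Rmin_l e 1). pose proof (Rmin_r e 1).
  rewrite norm_C_R. change (norm (minus y x)) with (Rabs (y - x)).
  match goal with |- Cmod ?v <= _ => change v with
    (CInt (fun t => CInt (fun s => k s t) a y) c d - CInt (fun t => CInt (fun s => k s t) a x) c d
      - scal (V := C_R_NormedModule) (y - x)%R (CInt (fun t => k x t) c d))%C end.
  assert (CC : forall y t, continuous (U := C_UniformSpace) (fun t => CInt (fun s => k s t) a y) t).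
  { intros y0 t0. apply (continuous_CInt_param_any (fun t s => k s t) a y0), continuous2_swap, H. }
  assert (Cr : forall t, continuous (U := C_UniformSpace) (fun t => k x t) t) by (intros; apply continuous2_r, H).
  rewrite <- CInt_rscal by (apply ex_CInt_any, Cr).
  assert (Cs : forall t, continuous (U := C_UniformSpace) (fun t => scal (V := C_R_NormedModule) (y - x) (k x t)) t).
  { intros t. apply (continuous_scal_r (V := C_R_NormedModule)), Cr. }
  rewrite <- !CInt_minus; try (apply ex_CInt_any; auto; intros; apply continuous_Cminus; auto).
  apply Rle_trans with ((d - c) * (Rabs (y - x) * (eps / (d - c + 1)))).
  - apply Cmod_CInt_le; [exact Hcd| |].
    { apply ex_CInt_any. intros; apply continuous_Cminus; [apply continuous_Cminus|]; auto. }
    intros t Ht.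
    assert (Cl : forall s, continuous (U := C_UniformSpace) (fun s => k s t) s) by (intros; apply continuous2_l, H).
    rewrite <- (CInt_Chasles (fun s => k s t) a x y) by (apply ex_CInt_any, Cl).
    replace (CInt (fun s => k s t) a x + CInt (fun s => k s t) x y - CInt (fun s => k s t) a x)%C
      with (CInt (fun s => k s t) x y) by ring.
    rewrite <- CInt_const.
    rewrite <- CInt_minus by (apply ex_CInt_any; auto; intros; apply continuous_Cconst).
    apply Cmod_CInt_abs_le.
    + intros; apply continuous_Cminus; auto. apply continuous_Cconst.
    + intros s Hs. assert (-1 <= s - x <= 1) by (apply Rabs_le_between; lra).
      left. apply Hk; try lra. rewrite Rminus_diag, Rabs_R0. lra.
  - assert (E : eps / (d - c + 1) * (d - c + 1) = eps) by (field; lra).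
    set (q := eps / (d - c + 1)) in *. clearbody q. rewrite <- E.
    assert (0 <= Rabs (y - x) * q) by (apply Rmult_le_pos; [apply Rabs_pos|lra]). nra.
Qed.

Lemma CInt_zero_derivative (f : R -> C) a b :
  (forall t, is_derive (V := C_R_NormedModule) f t (RtoC 0)) -> f a = f b.
Proof.
  intros H. assert (HH : forall x y, x <= y -> f x = f y).
  { intros x y Hxy. generalize (CInt_derive f (fun _ => RtoC 0) x y Hxy (fun t _ => H t)
      (fun t _ => continuous_Cconst _ t)).
    rewrite CInt_const. intros E.
    apply eq_sym. apply Ceq_minus. rewrite <- E.
    apply (scal_zero_r (V := C_R_NormedModule)). }
  destruct (Rle_dec a b); [apply HH; lra|symmetry; apply HH; lra].
Qed.

(** As functions of the upper bound [b], both sides have the same derivative and vanish at [a]. *)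
Lemma Fubini_C k a b c d : a <= b -> c <= d -> continuous2 k ->
  CInt (fun s => CInt (fun t => k s t) c d) a b = CInt (fun t => CInt (fun s => k s t) a b) c d.
Proof.
  intros Hab Hcd H.
  set (D := fun x => (CInt (fun s => CInt (fun t => k s t) c d) a x
                      + - (1) * CInt (fun t => CInt (fun s => k s t) a x) c d)%C).
  assert (E : D b = D a).
  { apply CInt_zero_derivative. intros x. unfold D. evar_last.
    - apply is_derive_Cplus; [|apply is_derive_Cmult; [apply is_derive_Cconst|]].
      + apply (is_derive_CInt (fun s => CInt (fun t => k s t) c d)).
        intros; apply continuous_CInt_param; assumption.
      + apply is_derive_CInt_CInt; assumption.
    - simpl. ring. }
  unfold D in E. rewrite CInt_point in E.
  rewrite (CInt_ext (fun t => CInt (fun s => k s t) a a) (fun _ => RtoC 0)) in E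
    by (try exact Hcd; intros; apply CInt_point).
  rewrite (CInt_const c d) in E.
  rewrite (scal_zero_r (V := C_R_NormedModule) (d - c) : scal (V := C_R_NormedModule) (d - c) (RtoC 0) = RtoC 0) in E.
  apply Ceq_minus.
  transitivity (0 + - (1) * 0)%C; [rewrite <- E; ring|ring].
Qed.

(** * Cauchy's theorem on the half disc *)

(** A map with all its values in [D] turns relative continuity into continuity; this is where
    clamped arguments are used. *)
Lemma continuous_on_C_comp {T : UniformSpace} (D : C -> Prop) (f : C -> C) (g : T -> C) (x : T) :
  continuous_on_C D f -> (forall y, D (g y)) -> continuous (U := C_UniformSpace) g x ->
  continuous (U := C_UniformSpace) (fun y => f (g y)) x.
Proof.
  intros Hf HD Hg. apply (filterlim_comp _ _ _ g f (locally x) (within D (locally (T := C_UniformSpace) (g x)))).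
  - intros P HP. generalize (Hg _ HP). unfold filtermap. apply filter_imp. intros y Hy. apply Hy, HD.
  - apply Hf, HD.
Qed.

Lemma continuous_on_C_iff (D : C -> Prop) (f : C -> C) :
  continuous_on_C D f <->
  forall z, D z -> forall eps, 0 < eps -> exists d, 0 < d /\
    forall w, D w -> Cmod (w - z) < d -> Cmod (f w - f z) < eps.
Proof.
  split.
  - intros H z Hz eps He. specialize (H z Hz).
    assert (L : locally (T := C_UniformSpace) (f z) (fun w => Cmod (w - f z) < eps)).
    { apply locally_Cmod. exists (mkposreal _ He). intros w Hw. exact Hw. }
    apply H in L. unfold filtermap, within in L. apply locally_Cmod in L.
    destruct L as [d Hd]. exists d. split; [apply d|]. intros w Hw Hwz. apply (Hd w Hwz Hw).
  - intros H z Hz P HP. apply locally_Cmod in HP. destruct HP as [eps Heps].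
    destruct (H z Hz eps (cond_pos eps)) as [d [Hd Hw]].
    unfold filtermap, within. apply locally_Cmod. exists (mkposreal _ Hd).
    intros w Hwz HD. apply Heps, Hw; assumption.
Qed.

Lemma continuous_on_C_comp_2 (D : C -> Prop) (f g : C -> C) (h : C -> C -> C) (z : C) : D z ->
  continuous_on_C D f -> continuous_on_C D g ->
  continuous (T := prod_UniformSpace C_UniformSpace C_UniformSpace) (U := C_UniformSpace)
    (fun p => h (fst p) (snd p)) (f z, g z) ->
  filterlim (fun z => h (f z) (g z)) (within D (locally (T := C_UniformSpace) z))
    (locally (T := C_UniformSpace) (h (f z) (g z))).
Proof.
  intros Hz Hf Hg Hh P HP. destruct (Hh P HP) as [d Hd].
  pose proof (Hf z Hz _ (locally_ball (T := C_UniformSpace) (f z) d)) as L1.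
  pose proof (Hg z Hz _ (locally_ball (T := C_UniformSpace) (g z) d)) as L2.
  unfold filtermap, within in *. generalize (filter_and _ _ L1 L2). apply filter_imp. intros w [H1 H2] Hw.
  apply (Hd (f w, g w)). split; [apply H1|apply H2]; exact Hw.
Qed.

Lemma continuous_on_C_mult D f g :
  continuous_on_C D f -> continuous_on_C D g -> continuous_on_C D (fun z => f z * g z)%C.
Proof.
  intros Hf Hg z Hz.
  assert (Hm : continuous (T := prod_UniformSpace C_UniformSpace C_UniformSpace) (U := C_UniformSpace) (fun p => fst p * snd p)%C (f z, g z)).
  { apply (continuous_Cmult (T := prod_UniformSpace C_UniformSpace C_UniformSpace) fst snd);
      [apply (continuous_fst (U := C_UniformSpace) (V := C_UniformSpace))
      |apply (continuous_snd (U := C_UniformSpace) (V := C_UniformSpace))]. }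
  exact (continuous_on_C_comp_2 D f g _ z Hz Hf Hg Hm).
Qed.

Lemma continuous_on_C_plus D f g :
  continuous_on_C D f -> continuous_on_C D g -> continuous_on_C D (fun z => f z + g z)%C.
Proof.
  intros Hf Hg z Hz.
  assert (Hm : continuous (T := prod_UniformSpace C_UniformSpace C_UniformSpace) (U := C_UniformSpace) (fun p => fst p + snd p)%C (f z, g z)).
  { apply (continuous_Cplus (T := prod_UniformSpace C_UniformSpace C_UniformSpace) fst snd);
      [apply (continuous_fst (U := C_UniformSpace) (V := C_UniformSpace))
      |apply (continuous_snd (U := C_UniformSpace) (V := C_UniformSpace))]. }
  exact (continuous_on_C_comp_2 D f g _ z Hz Hf Hg Hm).
Qed.

Lemma continuous_on_C_of_continuous (D : C -> Prop) (f : C -> C) :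
  (forall z, D z -> continuous (T := C_UniformSpace) (U := C_UniformSpace) f z) -> continuous_on_C D f.
Proof.
  intros H z Hz P HP. generalize (H z Hz P HP). unfold filtermap, within.
  apply filter_imp. auto.
Qed.

Lemma continuous_on_C_subset (D D' : C -> Prop) f :
  (forall z, D' z -> D z) -> continuous_on_C D f -> continuous_on_C D' f.
Proof.
  intros H Hf z Hz P HP. generalize (Hf z (H z Hz) P HP). unfold filtermap, within.
  apply filter_imp. auto.
Qed.

Lemma continuous_on_C_precomp (D D' : C -> Prop) (f g : C -> C) :
  continuous_on_C D f -> (forall z, continuous (T := C_UniformSpace) (U := C_UniformSpace) g z) ->
  (forall z, D' z -> D (g z)) -> continuous_on_C D' (fun z => f (g z)).
Proof.
  intros Hf Hg H z Hz P HP. pose proof (Hg z _ (Hf (g z) (H z Hz) P HP)) as L.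
  revert L. unfold filtermap, within. apply filter_imp. auto.
Qed.

Lemma continuous_on_C_pow D f n :
  continuous_on_C D f -> continuous_on_C D (fun z => f z ^ n)%C.
Proof.
  intros H. induction n as [|n IH]; simpl.
  - apply continuous_on_C_of_continuous. intros; apply continuous_Cconst.
  - apply continuous_on_C_mult; assumption.
Qed.

Definition cis (t : R) : C := (cos t, sin t).

Lemma continuous_cis {T : UniformSpace} (f : T -> R) x :
  continuous f x -> continuous (U := C_UniformSpace) (fun y => cis (f y)) x.
Proof.
  intros H. apply continuous_C_pair; simpl; apply continuous_R_comp; try exact H.
  - apply continuity_cos.
  - apply continuity_sin.
Qed.

Lemma is_derive_cis t : is_derive (V := C_R_NormedModule) cis t (Ci * cis t)%C.
Proof.
  apply is_derive_C_pair; simpl; auto_derive; auto; ring.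
Qed.

Lemma Cmod_cis t : Cmod (cis t) = 1.
Proof.
  unfold Cmod, cis; simpl. replace (cos t * (cos t * 1) + sin t * (sin t * 1)) with 1.
  - apply sqrt_1.
  - generalize (sin2_cos2 t). unfold Rsqr. lra.
Qed.

Lemma cis_neq_0 t : cis t <> 0%C.
Proof. apply Cmod_gt_0. rewrite Cmod_cis. lra. Qed.

Lemma cis_0 : cis 0 = 1%C.
Proof. unfold cis. now rewrite cos_0, sin_0. Qed.

Lemma cis_PI : cis PI = (- (1))%C.
Proof. unfold cis. rewrite cos_PI, sin_PI. unfold Copp, RtoC; simpl. f_equal; ring. Qed.

Lemma cis_2PI : cis (2 * PI) = 1%C.
Proof. unfold cis. now rewrite cos_2PI, sin_2PI. Qed.

(** Passage to radius 1, where differentiability is lost and only continuity remains. *)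
Lemma continuous_left_eq (f g : R -> C) :
  continuous (U := C_UniformSpace) f 1 -> continuous (U := C_UniformSpace) g 1 ->
  (forall s, 0 < s < 1 -> f s = g s) -> f 1 = g 1.
Proof.
  intros Hf Hg H. apply Ceq_minus, Cmod_eq_0, Rle_antisym; [|apply Cmod_ge_0].
  apply le_epsilon. intros eps He. rewrite Rplus_0_l.
  assert (He2 : 0 < eps / 2) by lra.
  destruct (filter_and _ _ (proj1 (continuous_C_iff f 1) Hf (mkposreal _ He2))
    (proj1 (continuous_C_iff g 1) Hg (mkposreal _ He2))) as [d Hd].
  set (s := Rmax (1 / 2) (1 - d / 2)).
  assert (Hs : 1 / 2 <= s < 1 /\ 1 - d / 2 <= s).
  { destruct d as [d d0]; simpl in *. unfold s, Rmax. destruct (Rle_dec _ _); lra. }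
  destruct (Hd s) as [H1 H2].
  { change (Rabs (s - 1) < d). destruct d as [d d0]; simpl in *. rewrite Rabs_left; lra. }
  simpl in H1, H2.
  replace (f 1 - g 1)%C with (- (f s - f 1) + (g s - g 1))%C by (rewrite (H s) by lra; ring).
  eapply Rle_trans; [apply Cmod_triangle|]. rewrite Cmod_opp. lra.
Qed.

Lemma CInt_neg (f : R -> C) (a : R) : 0 <= a -> (forall t, - a <= t <= 0 -> continuous (U := C_UniformSpace) f t) ->
  CInt (fun s => f (- s)) 0 a = CInt f (- a) 0.
Proof.
  intros Ha Hc.
  assert (Ex : ex_RInt (V := C_R_CompleteNormedModule) f (- a) 0) by (apply ex_CInt; [lra|exact Hc]).
  generalize (RInt_comp_lin (V := C_R_CompleteNormedModule) f (-1) 0 0 a).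
  replace (-1 * 0 + 0) with 0 by ring. replace (-1 * a + 0) with (- a) by ring.
  intros H. specialize (H (ex_RInt_swap (V := C_R_CompleteNormedModule) _ _ _ Ex)).
  transitivity (opp (RInt (V := C_R_CompleteNormedModule) f 0 (- a))).
  - rewrite <- H. rewrite <- (RInt_opp (V := C_R_CompleteNormedModule)).
    + apply CInt_ext; [exact Ha|]. intros t _. replace (-1 * t + 0) with (- t) by ring.
      apply injective_projections; simpl; unfold scal, opp; simpl; unfold mult; simpl; ring.
    + apply ex_CInt; [exact Ha|]. intros t Ht.
      apply (continuous_scal_r (V := C_R_NormedModule) (-1)).
      apply (continuous_comp (V := R_UniformSpace) (W := C_UniformSpace) (fun t => -1 * t + 0) f).
      * apply continuous_R_plus; [apply continuous_R_mult|]; try apply continuous_const. apply continuous_id.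
      * apply Hc. lra.
  - apply (opp_RInt_swap (V := C_R_CompleteNormedModule)), (ex_RInt_swap (V := C_R_CompleteNormedModule)), Ex.
Qed.

Definition closed_upper_half_disc (z : C) : Prop := Cmod z <= 1 /\ 0 <= Im z.

Lemma Cmod_scal_cis s t : 0 <= s -> Cmod (RtoC s * cis t) = s.
Proof. intros Hs. rewrite Cmod_mult, Cmod_R, Cmod_cis, Rabs_pos_eq; lra. Qed.

Lemma Im_scal_cis s t : 0 <= s -> 0 <= t <= PI -> 0 <= Im (RtoC s * cis t).
Proof.
  intros Hs Ht. unfold cis, Im; simpl. rewrite Rmult_0_l, Rplus_0_r.
  apply Rmult_le_pos; [exact Hs|apply sin_ge_0; lra].
Qed.

(** Goursat in polar coordinates. The side at radius 0 vanishes, the sides [t = 0] and [t = PI] form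
    the diameter, and the last one is the arc. *)
Lemma half_disc_Cauchy (F : C -> C) :
  continuous_on_C closed_upper_half_disc F ->
  (forall z, Cmod z < 1 -> 0 <= Im z -> cdiff F z) ->
  (CInt (fun t => F (RtoC t)) (-1) 1 + CInt (fun t => F (cis t) * (Ci * cis t)) 0 PI = 0)%C.
Proof.
  intros HF Hd. pose proof PI_RGT_0 as HPI.
  set (K := fun s t => (F (RtoC (clamp 0 1 s) * cis (clamp 0 PI t)) * (Ci * cis t))%C).
  set (N := fun s => (F (RtoC (clamp 0 1 s) * cis PI) * cis PI - F (RtoC (clamp 0 1 s) * cis 0) * cis 0)%C).
  assert (Hcl : forall s t, closed_upper_half_disc (RtoC (clamp 0 1 s) * cis (clamp 0 PI t))).
  { intros s t. pose proof (clamp_in 0 1 s ltac:(lra)). pose proof (clamp_in 0 PI t ltac:(lra)).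
    split; [rewrite Cmod_scal_cis|apply Im_scal_cis]; lra. }
  assert (Hcl1 : forall t0, 0 <= t0 <= PI -> forall s, closed_upper_half_disc (RtoC (clamp 0 1 s) * cis t0)).
  { intros t0 Ht0 s. rewrite <- (clamp_id 0 PI t0) by lra. apply Hcl. }
  assert (CK : continuous2 K).
  { intros p. apply continuous_Cmult.
    - apply (continuous_on_C_comp _ F (fun p : R * R => (RtoC (clamp 0 1 (fst p)) * cis (clamp 0 PI (snd p)))%C) p HF).
      + intros y; apply Hcl.
      + apply continuous_Cmult; [apply continuous_RtoC|apply continuous_cis]; apply continuous_clamp;
          destruct p; [apply continuous_fst|apply continuous_snd].
    - apply continuous_Cmult; [apply continuous_Cconst|apply continuous_cis]. destruct p; apply continuous_snd. }
  assert (CFs : forall t0, 0 <= t0 <= PI -> forall s,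
    continuous (U := C_UniformSpace) (fun s => F (RtoC (clamp 0 1 s) * cis t0)%C) s).
  { intros t0 Ht0 s. apply (continuous_on_C_comp _ F (fun s => (RtoC (clamp 0 1 s) * cis t0)%C) s HF).
    - intros y; apply Hcl1, Ht0.
    - apply continuous_Cmult; [apply continuous_RtoC, continuous_clamp, continuous_id|apply continuous_Cconst]. }
  assert (CN : forall s, continuous (U := C_UniformSpace) N s).
  { intros s. apply continuous_Cminus; apply continuous_Cmult; try apply continuous_Cconst; apply CFs; lra. }
  (* For [s < 1] the rectangle [[0, s] x [0, PI]] gives the same identity with radius [s] in place
     of 1. [N] collects the two radial sides. *)
  assert (E : (1 * CInt (fun t => K 1 t) 0 PI = CInt N 0 1)%C).
  { apply (continuous_left_eq (fun s => RtoC s * CInt (fun t => K s t) 0 PI)%C (fun s => CInt N 0 s)).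
    - apply continuous_Cmult; [apply continuous_RtoC, continuous_id|apply continuous_CInt_param; [lra|exact CK]].
    - eapply is_derive_C_continuous, is_derive_CInt, CN.
    - intros s Hs.
      assert (G := Goursat F (fun s t => RtoC s * cis t)%C (fun s t => cis t) (fun s t => RtoC s * (Ci * cis t))%C
        0 s 0 PI 1).
      unfold rect_boundary in G.
      assert (Z : forall a b : C, (a - b = 0 -> a = b)%C) by (intros a b; apply Ceq_minus).
      rewrite (CInt_ext (fun t => K s t) (fun t => F (RtoC s * cis t) * (Ci * cis t))%C) by
        (try lra; intros t Ht; unfold K; rewrite !clamp_id by lra; reflexivity).
      rewrite (CInt_ext N (fun s => F (RtoC s * cis PI) * cis PI - F (RtoC s * cis 0) * cis 0)%C) by
        (try lra; intros t Ht; unfold N; rewrite !clamp_id by lra; reflexivity).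
      assert (CFs' : forall t0, 0 <= t0 <= PI -> forall s', 0 <= s' <= s ->
         continuous (U := C_UniformSpace) (fun s => F (RtoC s * cis t0)%C) s').
      { intros t0 Ht0 s' Hs'.
        apply (continuous_comp (V := C_UniformSpace) (W := C_UniformSpace) (fun s => RtoC s * cis t0)%C F).
        - apply continuous_Cmult; [apply continuous_RtoC, continuous_id|apply continuous_Cconst].
        - apply cdiff_continuous, Hd; [rewrite Cmod_scal_cis; lra|apply Im_scal_cis; lra]. }
      rewrite CInt_minus by (apply ex_CInt; try lra; intros t Ht; apply continuous_Cmult;
         [apply CFs'; lra|apply continuous_Cconst]).
      rewrite <- CInt_scal.
      2:{ apply ex_CInt; [lra|]. intros t Ht. apply continuous_Cmult.
          - apply (continuous_comp (V := C_UniformSpace) (W := C_UniformSpace) (fun t => RtoC s * cis t)%C F).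
            + apply continuous_Cmult; [apply continuous_Cconst|apply continuous_cis, continuous_id].
            + apply cdiff_continuous, Hd; [rewrite Cmod_scal_cis; lra|apply Im_scal_cis; lra].
          - apply continuous_Cmult; [apply continuous_Cconst|apply continuous_cis, continuous_id]. }
      apply Z. rewrite <- G; clear G.
      + rewrite (CInt_ext (fun t => F (0 * cis t) * (0 * (Ci * cis t)))%C (fun _ => RtoC 0)) by
          (try lra; intros; ring).
        rewrite CInt_const. rewrite (scal_zero_r (V := C_R_NormedModule) (PI - 0) : scal (V := C_R_NormedModule) (PI - 0) (RtoC 0) = RtoC 0).
        rewrite (CInt_ext (fun t => RtoC s * (F (RtoC s * cis t) * (Ci * cis t)))%C
                   (fun t => F (RtoC s * cis t) * (RtoC s * (Ci * cis t)))%C) by (try lra; intros; ring).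
        ring.
      + lra.
      + lra.
      + intros s' t' _ _. evar_last; [apply is_derive_Cmult; [apply is_derive_RtoC; auto_derive; auto|apply is_derive_Cconst]|].
        simpl. ring.
      + intros s' t' _ _. evar_last; [apply is_derive_Cmult; [apply is_derive_Cconst|apply is_derive_cis]|].
        simpl. ring.
      + intros; apply continuous_Cconst.
      + intros. apply continuous_Cmult; [apply continuous_Cconst|].
        apply continuous_Cmult; [apply continuous_Cconst|apply continuous_cis, continuous_id].
      + intros s' t' Hs' Ht'. rewrite !Cmod_mult, Cmod_cis, Cmod_Ci, Cmod_R, Rabs_pos_eq; lra.
      + intros s' t' Hs' Ht'. apply Hd; [rewrite Cmod_scal_cis; lra|apply Im_scal_cis; lra]. }
  rewrite (CInt_ext (fun t => K 1 t) (fun t => F (cis t) * (Ci * cis t))%C) in E.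
  2: lra.
  2:{ intros t Ht. unfold K. rewrite !clamp_id by lra. f_equal. f_equal. ring. }
  rewrite Cmult_1_l in E. rewrite E. unfold N. clear E.
  set (H := fun t => F (RtoC (clamp (-1) 1 t))).
  assert (CH : forall t, continuous (U := C_UniformSpace) H t).
  { intros t. apply (continuous_on_C_comp _ F (fun t => RtoC (clamp (-1) 1 t)) t HF).
    - intros y. pose proof (clamp_in (-1) 1 y ltac:(lra)). split; [rewrite Cmod_R; apply Rabs_le; lra|simpl; lra].
    - apply continuous_RtoC, continuous_clamp, continuous_id. }
  rewrite (CInt_ext (fun t => F (RtoC t)) H) by (try lra; intros; unfold H; rewrite clamp_id by lra; reflexivity).
  rewrite (CInt_ext (fun s => F (RtoC (clamp 0 1 s) * cis PI) * cis PI - F (RtoC (clamp 0 1 s) * cis 0) * cis 0)%C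
    (fun s => - (1) * H (- s)%R - H s)%C).
  2: lra.
  2:{ intros t Ht. unfold H. rewrite !clamp_id, cis_PI, cis_0 by lra.
      replace (RtoC t * - (1))%C with (RtoC (- t)) by (rewrite RtoC_opp; ring).
      replace (RtoC t * 1)%C with (RtoC t) by ring. ring. }
  assert (CHn : forall t, continuous (U := C_UniformSpace) (fun t => H (- t)) t).
  { intros t. apply (continuous_comp (V := R_UniformSpace) (W := C_UniformSpace) Ropp H); [apply continuous_R_opp, continuous_id|apply CH]. }
  rewrite CInt_minus.
  2:{ apply ex_CInt_any. intros. apply continuous_Cmult; [apply continuous_Cconst|apply CHn]. }
  2:{ apply ex_CInt_any, CH. }
  rewrite CInt_scal by apply ex_CInt_any, CHn.
  rewrite CInt_neg by (try lra; intros; apply CH). replace (Ropp 1) with (-1) by ring.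
  rewrite <- (CInt_Chasles H (-1) 0 1) by apply ex_CInt_any, CH.
  ring.
Qed.

(** * Maximum principles *)

(* The last clause says that the arc turns strictly counterclockwise around [c]. *)
Definition star_arc (c : C) (u du : R -> C) (a b : R) : Prop :=
  a < b /\
  (forall t, is_derive (V := C_R_NormedModule) u t (du t)) /\
  (forall t, continuous (U := C_UniformSpace) du t) /\
  (forall t, a <= t <= b -> u t <> c /\ 0 < Im (du t / (u t - c))).

Definition toward (c : C) (u : R -> C) (s t : R) : C := (c + RtoC s * (u t - c))%C.

(** The integral of [v z / (z - c) dz] along the arc shrunk by [s] towards [c]: the factor [s]
    cancels in [dz / (z - c)]. In this form it also makes sense at [s = 0], where [v] is frozen at
    [c]. *)
Definition arc_integral (v : C -> C) (c : C) (u du : R -> C) (a b s : R) : C :=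
  CInt (fun t => v (toward c u s t) * (du t / (u t - c)))%C a b.

Lemma bounded1 (f : R -> C) a b :
  (forall t, a <= t <= b -> continuous (U := C_UniformSpace) f t) ->
  exists M, 0 < M /\ forall t, a <= t <= b -> Cmod (f t) <= M.
Proof.
  intros H. destruct (Rle_dec a b) as [Hab|Hab]; [|exists 1; split; [lra|intros; lra]].
  destruct (continuity_ab_maj (fun t => Cmod (f t)) a b Hab) as [x [Hx _]].
  - intros t Ht. apply continuity_pt_filterlim. apply (continuous_Cmod f t), H, Ht.
  - exists (Cmod (f x) + 1). split; [generalize (Cmod_ge_0 (f x)); lra|].
    intros t Ht. generalize (Hx t Ht). lra.
Qed.

Lemma Cminus_neq_0 (z w : C) : z <> w -> (z - w)%C <> 0%C.
Proof. intros H E. apply H, Ceq_minus, E. Qed.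

Section Arc.
Variables (v : C -> C) (D : C -> Prop) (c : C) (u du : R -> C) (a b : R).
Hypothesis Harc : star_arc c u du a b.
Hypothesis HD : forall s t, 0 <= s <= 1 -> a <= t <= b -> D (toward c u s t).
Hypothesis Hv : continuous_on_C D v.
Hypothesis Hdv : forall s t, 0 <= s < 1 -> a <= t <= b -> cdiff v (toward c u s t).

Let cu t : continuous (U := C_UniformSpace) u t.
Proof. destruct Harc as [_ [H _]]. eapply is_derive_C_continuous, H. Qed.

Lemma arc_integral_kernel : continuous2 (fun s t =>
  v (toward c u (clamp 0 1 s) (clamp a b t)) * (du (clamp a b t) / (u (clamp a b t) - c)))%C.
Proof.
  destruct Harc as [Hab [H1 [H2 H3]]].
  assert (Ca : forall p : R * R, continuous (fun p => clamp a b (snd p)) p)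
    by (intros []; apply continuous_clamp, continuous_snd).
  assert (Cb : forall p : R * R, continuous (fun p => clamp 0 1 (fst p)) p)
    by (intros []; apply continuous_clamp, continuous_fst).
  assert (Cu : forall p : R * R, continuous (U := C_UniformSpace) (fun p => u (clamp a b (snd p)) - c)%C p).
  { intros p. apply continuous_Cminus; [|apply continuous_Cconst].
    apply (continuous_comp (V := R_UniformSpace) (W := C_UniformSpace) (fun p => clamp a b (snd p)) u); auto. }
  intros p. apply continuous_Cmult.
  - apply (continuous_on_C_comp D v (fun p : R * R => toward c u (clamp 0 1 (fst p)) (clamp a b (snd p)))); auto.
    + intros q. apply HD; apply clamp_in; lra.
    + unfold toward. apply continuous_Cplus; [apply continuous_Cconst|].
      apply continuous_Cmult; [apply continuous_RtoC|]; auto.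
  - apply continuous_Cdiv; auto.
    + apply Cminus_neq_0. apply H3, clamp_in. lra.
    + apply (continuous_comp (V := R_UniformSpace) (W := C_UniformSpace) (fun p => clamp a b (snd p)) du); auto.
Qed.

Lemma arc_integral_clamp s : 0 <= s <= 1 ->
  arc_integral v c u du a b s =
  CInt (fun t => v (toward c u (clamp 0 1 s) (clamp a b t)) * (du (clamp a b t) / (u (clamp a b t) - c)))%C a b.
Proof.
  intros Hs. apply CInt_ext; [apply Rlt_le, Harc|].
  intros t Ht. rewrite !clamp_id by assumption. reflexivity.
Qed.

(** Goursat for [v z / (z - c)] on the region swept between the scales [p] and [q]; [0 < p] keeps it
    away from the pole. The right-hand side comes from the two radial sides. *)
Lemma arc_integral_increment p q : 0 < p -> p <= q -> q < 1 ->
  (arc_integral v c u du a b q - arc_integral v c u du a b p =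
   CInt (fun s => v (toward c u s b) / RtoC s) p q - CInt (fun s => v (toward c u s a) / RtoC s) p q)%C.
Proof.
  intros Hp Hpq Hq. destruct Harc as [Hab [H1 [H2 H3]]].
  destruct (bounded1 (fun t => u t - c)%C a b) as [L1 [L10 HL1]].
  { intros; apply continuous_Cminus; [apply cu|apply continuous_Cconst]. }
  destruct (bounded1 du a b) as [L2 [L20 HL2]]; [intros; apply H2|].
  assert (Hn : forall s t, p <= s <= q -> a <= t <= b -> (toward c u s t - c)%C <> 0%C).
  { intros s t Hs Ht. unfold toward.
    replace (c + RtoC s * (u t - c) - c)%C with (RtoC s * (u t - c))%C by ring.
    apply Cmult_neq_0; [intros E; apply RtoC_inj in E; lra|apply Cminus_neq_0, H3, Ht]. }
  apply Ceq_minus.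
  rewrite <- (Goursat (fun z => v z / (z - c))%C (toward c u) (fun s t => u t - c)%C (fun s t => RtoC s * du t)%C
    p q a b (L1 + L2)).
  - unfold rect_boundary, arc_integral.
    assert (E1 : forall s, p <= s <= q -> forall t, a <= t <= b ->
      (v (toward c u s t) * (du t / (u t - c)) = v (toward c u s t) / (toward c u s t - c) * (RtoC s * du t))%C).
    { intros s Hs t Ht. unfold toward at 3.
      assert (u t - c <> 0)%C by (apply Cminus_neq_0, H3, Ht).
      assert (RtoC s <> 0)%C by (intros E; apply RtoC_inj in E; lra).
      replace (c + RtoC s * (u t - c) - c)%C with (RtoC s * (u t - c))%C by ring.
      generalize dependent (u t - c)%C. intros d Hd0. field. auto. }
    assert (E2 : forall t, a <= t <= b -> forall s, p <= s <= q ->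
      (v (toward c u s t) / RtoC s = v (toward c u s t) / (toward c u s t - c) * (u t - c))%C).
    { intros t Ht s Hs. unfold toward at 3.
      assert (u t - c <> 0)%C by (apply Cminus_neq_0, H3, Ht).
      assert (RtoC s <> 0)%C by (intros E; apply RtoC_inj in E; lra).
      replace (c + RtoC s * (u t - c) - c)%C with (RtoC s * (u t - c))%C by ring.
      generalize dependent (u t - c)%C. intros d Hd0. field. auto. }
    rewrite (CInt_ext _ _ a b (Rlt_le _ _ Hab) (E1 q ltac:(lra))).
    rewrite (CInt_ext _ _ a b (Rlt_le _ _ Hab) (E1 p ltac:(lra))).
    rewrite (CInt_ext _ _ p q Hpq (E2 a ltac:(lra))).
    rewrite (CInt_ext _ _ p q Hpq (E2 b ltac:(lra))). reflexivity.
  - exact Hpq.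
  - lra.
  - intros s t _ _. unfold toward. evar_last.
    + apply is_derive_Cplus; [apply is_derive_Cconst|].
      apply is_derive_Cmult; [apply is_derive_RtoC; auto_derive; auto|apply is_derive_Cconst].
    + simpl. ring.
  - intros s t _ _. unfold toward. evar_last.
    + apply is_derive_Cplus; [apply is_derive_Cconst|].
      apply is_derive_Cmult; [apply is_derive_Cconst|].
      apply (is_derive_Cplus u (fun _ => - c)%C); [apply H1|apply is_derive_Cconst].
    + simpl. ring.
  - intros; apply continuous_Cconst.
  - intros. apply continuous_Cmult; [apply continuous_Cconst|apply H2].
  - intros s t Hs Ht. specialize (HL1 t Ht). specialize (HL2 t Ht).
    split; [lra|]. rewrite Cmod_mult, Cmod_R, Rabs_pos_eq by lra.
    generalize (Cmod_ge_0 (du t)). nra.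
  - intros s t Hs Ht. apply cdiff_mult; [apply Hdv; lra|].
    apply cdiff_inv; [apply Hn; assumption|]. apply cdiff_minus; [apply cdiff_id|apply cdiff_const].
Qed.
End Arc.

Lemma continuous_comp_sub (f : R -> C) (s : R) :
  continuous (U := C_UniformSpace) f (1 - s) -> continuous (U := C_UniformSpace) (fun s => f (1 - s)) s.
Proof.
  intros H. apply (continuous_comp (V := R_UniformSpace) (W := C_UniformSpace) (fun s => 1 - s) f); [|exact H].
  apply continuous_R_minus; [apply continuous_const|apply continuous_id].
Qed.

Section TwoArcs.
Variables (D : C -> Prop) (c : C) (u1 du1 : R -> C) (a1 b1 : R) (u2 du2 : R -> C) (a2 b2 : R).
Hypothesis Harc1 : star_arc c u1 du1 a1 b1.
Hypothesis Harc2 : star_arc c u2 du2 a2 b2.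
Hypothesis Hend1 : u1 b1 = u2 a2.
Hypothesis Hend2 : u2 b2 = u1 a1.
Hypothesis HD1 : forall s t, 0 <= s <= 1 -> a1 <= t <= b1 -> D (toward c u1 s t).
Hypothesis HD2 : forall s t, 0 <= s <= 1 -> a2 <= t <= b2 -> D (toward c u2 s t).

(** The arcs share their endpoints, so their radial contributions cancel and the sum is independent
    of [s] in [(0, 1)]; continuity reaches both ends. At [s = 0] this becomes a mean value identity
    for [v c]. *)
Lemma two_arcs_integral (v : C -> C) : continuous_on_C D v ->
  (forall s t, 0 <= s < 1 -> a1 <= t <= b1 -> cdiff v (toward c u1 s t)) ->
  (forall s t, 0 <= s < 1 -> a2 <= t <= b2 -> cdiff v (toward c u2 s t)) ->
  (arc_integral v c u1 du1 a1 b1 1 + arc_integral v c u2 du2 a2 b2 1 =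
   arc_integral v c u1 du1 a1 b1 0 + arc_integral v c u2 du2 a2 b2 0)%C.
Proof.
  intros Hv Hd1 Hd2.
  pose proof (continuous_CInt_param _ a1 b1 (Rlt_le _ _ (proj1 Harc1))
    (arc_integral_kernel v D c u1 du1 a1 b1 Harc1 HD1 Hv)) as K1.
  pose proof (continuous_CInt_param _ a2 b2 (Rlt_le _ _ (proj1 Harc2))
    (arc_integral_kernel v D c u2 du2 a2 b2 Harc2 HD2 Hv)) as K2.
  rewrite !(arc_integral_clamp v c u1 du1 a1 b1 Harc1), !(arc_integral_clamp v c u2 du2 a2 b2 Harc2) by lra.
  pose proof (arc_integral_clamp v c u1 du1 a1 b1 Harc1) as E1.
  pose proof (arc_integral_clamp v c u2 du2 a2 b2 Harc2) as E2.
  set (f1 := fun s : R => CInt (fun t =>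
    v (toward c u1 (clamp 0 1 s) (clamp a1 b1 t)) * (du1 (clamp a1 b1 t) / (u1 (clamp a1 b1 t) - c)))%C a1 b1) in *.
  change (forall s, continuous (U := C_UniformSpace) f1 s) in K1.
  set (f2 := fun s : R => CInt (fun t =>
    v (toward c u2 (clamp 0 1 s) (clamp a2 b2 t)) * (du2 (clamp a2 b2 t) / (u2 (clamp a2 b2 t) - c)))%C a2 b2) in *.
  change (forall s, continuous (U := C_UniformSpace) f2 s) in K2.
  change (f1 1 + f2 1 = f1 0 + f2 0)%C.
  assert (Inc : forall p q, 0 < p -> p <= q -> q < 1 -> (f1 q + f2 q = f1 p + f2 p)%C).
  { intros p q Hp Hpq Hq.
    assert (I1 := arc_integral_increment v c u1 du1 a1 b1 Harc1 Hd1 p q Hp Hpq Hq).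
    assert (I2 := arc_integral_increment v c u2 du2 a2 b2 Harc2 Hd2 p q Hp Hpq Hq).
    rewrite !E1 in I1 by lra. rewrite !E2 in I2 by lra.
    change (f1 q - f1 p = CInt (fun s => v (toward c u1 s b1) / RtoC s) p q -
              CInt (fun s => v (toward c u1 s a1) / RtoC s) p q)%C in I1.
    change (f2 q - f2 p = CInt (fun s => v (toward c u2 s b2) / RtoC s) p q -
              CInt (fun s => v (toward c u2 s a2) / RtoC s) p q)%C in I2.
    unfold toward in I1, I2. rewrite Hend1 in I1. rewrite Hend2 in I2.
    apply Ceq_minus.
    replace (f1 q + f2 q - (f1 p + f2 p))%C with ((f1 q - f1 p) + (f2 q - f2 p))%C by ring.
    rewrite I1, I2. ring. }
  transitivity (f1 (1 / 2)%R + f2 (1 / 2)%R)%C.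
  - apply (continuous_left_eq (fun s => f1 s + f2 s)%C (fun _ => f1 (1 / 2)%R + f2 (1 / 2)%R)%C).
    + apply continuous_Cplus; auto.
    + apply continuous_Cconst.
    + intros s Hs. destruct (Rle_dec (1 / 2) s).
      * apply Inc; lra.
      * symmetry; apply Inc; lra.
  (* Written as [1 - 1] to reuse the left limit at 1 for the right limit at 0. *)
  - replace (f1 0 + f2 0)%C with (f1 (1 - 1)%R + f2 (1 - 1)%R)%C by (rewrite Rminus_diag; reflexivity).
    apply (continuous_left_eq (fun _ => f1 (1 / 2)%R + f2 (1 / 2)%R)%C (fun s => f1 (1 - s)%R + f2 (1 - s)%R)%C).
    + apply continuous_Cconst.
    + apply continuous_Cplus; apply continuous_comp_sub; auto.
    + intros s Hs. destruct (Rle_dec (1 / 2) (1 - s)).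
      * symmetry; apply Inc; lra.
      * apply Inc; lra.
Qed.

Lemma arc_kernel_continuous u du a b : star_arc c u du a b -> forall t, a <= t <= b ->
  continuous (U := C_UniformSpace) (fun t => du t / (u t - c))%C t.
Proof.
  intros [Hab [H1 [H2 H3]]] t Ht. apply continuous_Cdiv.
  - apply Cminus_neq_0, H3, Ht.
  - apply H2.
  - apply continuous_Cminus; [eapply is_derive_C_continuous, H1|apply continuous_Cconst].
Qed.

Lemma arc_winding_pos u du a b : star_arc c u du a b ->
  0 < Im (CInt (fun t => du t / (u t - c))%C a b).
Proof.
  intros H. pose proof (arc_kernel_continuous u du a b H) as K.
  destruct H as [Hab [H1 [H2 H3]]].
  destruct (CInt_components (fun t => du t / (u t - c))%C a b) as [_ [_ ->]].
  - apply ex_CInt; [lra|exact K].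
  - unfold Im; simpl snd at 1. apply RInt_gt_0; [exact Hab| |].
    + intros t Ht. apply H3. lra.
    + intros t Ht. apply (continuous_C_snd (fun t => du t / (u t - c))%C), K, Ht.
Qed.

(* Applying the mean value identity to the powers of [v] removes the constant. *)
Lemma max_principle_two_arcs (v : C -> C) (M : R) : continuous_on_C D v ->
  (forall s t, 0 <= s < 1 -> a1 <= t <= b1 -> cdiff v (toward c u1 s t)) ->
  (forall s t, 0 <= s < 1 -> a2 <= t <= b2 -> cdiff v (toward c u2 s t)) ->
  (forall t, a1 <= t <= b1 -> Cmod (v (u1 t)) <= M) ->
  (forall t, a2 <= t <= b2 -> Cmod (v (u2 t)) <= M) ->
  Cmod (v c) <= M.
Proof.
  intros Hv Hd1 Hd2 HM1 HM2.
  pose proof (arc_kernel_continuous _ _ _ _ Harc1) as K1.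
  pose proof (arc_kernel_continuous _ _ _ _ Harc2) as K2.
  pose proof (arc_winding_pos _ _ _ _ Harc1) as W1.
  pose proof (arc_winding_pos _ _ _ _ Harc2) as W2.
  destruct Harc1 as [Hab1 _]. destruct Harc2 as [Hab2 _].
  assert (M0 : 0 <= M) by (eapply Rle_trans; [apply Cmod_ge_0|apply (HM1 a1); lra]).
  destruct (bounded1 _ a1 b1 K1) as [L1 [L10 HL1]].
  destruct (bounded1 _ a2 b2 K2) as [L2 [L20 HL2]].
  (* The logarithmic increment around the closed contour. Its imaginary part is positive, so it is
     nonzero and can be divided out. *)
  set (W := (CInt (fun t => du1 t / (u1 t - c)) a1 b1 + CInt (fun t => du2 t / (u2 t - c)) a2 b2)%C).
  assert (HW : 0 < Cmod W).
  { apply Cmod_gt_0. intros E. assert (Im W = 0) by (rewrite E; reflexivity).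
    unfold W in H. rewrite im_plus in H. lra. }
  set (K := (b1 - a1) * L1 + (b2 - a2) * L2).
  assert (HK : 0 < K) by (unfold K; apply Rplus_lt_0_compat; apply Rmult_lt_0_compat; lra).
  assert (T1 : forall u t, toward c u 1 t = u t) by (intros; unfold toward; ring).
  assert (T0 : forall u t, toward c u 0 t = c) by (intros; unfold toward; ring).
  assert (Hpow : forall n, Cmod (v c) ^ n * Cmod W <= M ^ n * K).
  { intros n.
    assert (I := two_arcs_integral (fun z => v z ^ n)%C (continuous_on_C_pow D v n Hv)
      (fun s t Hs Ht => cdiff_pow v n _ (Hd1 s t Hs Ht)) (fun s t Hs Ht => cdiff_pow v n _ (Hd2 s t Hs Ht))).
    assert (B : forall u du a b L, a < b -> (forall t, a <= t <= b -> continuous (U := C_UniformSpace) (fun t => du t / (u t - c))%C t) ->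
      (forall s t, 0 <= s <= 1 -> a <= t <= b -> D (toward c u s t)) -> star_arc c u du a b ->
      (forall t, a <= t <= b -> Cmod (v (u t)) <= M) -> (forall t, a <= t <= b -> Cmod (du t / (u t - c)) <= L) ->
      Cmod (arc_integral (fun z => v z ^ n)%C c u du a b 1) <= (b - a) * (M ^ n * L)).
    { intros u du a b L Hab Ck HDu Ha HM HL. unfold arc_integral. apply Cmod_CInt_le; [lra| |].
      - assert (KK := arc_integral_kernel _ D c u du a b Ha HDu (continuous_on_C_pow D v n Hv)).
        apply (ex_RInt_ext (V := C_R_CompleteNormedModule)) with (f := fun t =>
          (v (toward c u (clamp 0 1 1) (clamp a b t)) ^ n * (du (clamp a b t) / (u (clamp a b t) - c)))%C).
        + rewrite Rmin_left, Rmax_right by lra. intros t Ht. rewrite !clamp_id by lra. reflexivity.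
        + apply ex_CInt; [lra|]. intros t _. apply (continuous2_r _ 1 t KK).
      - intros t Ht. rewrite T1, Cmod_mult, Cmod_pow.
        apply Rmult_le_compat; try apply Cmod_ge_0; try apply pow_le, Cmod_ge_0.
        + apply pow_incr. split; [apply Cmod_ge_0|apply HM, Ht].
        + apply HL, Ht. }
    assert (B1 := B u1 du1 a1 b1 L1 Hab1 K1 HD1 Harc1 HM1 HL1).
    assert (B2 := B u2 du2 a2 b2 L2 Hab2 K2 HD2 Harc2 HM2 HL2). clear B.
    assert (E0 : forall u du a b, a < b -> (forall t, a <= t <= b -> continuous (U := C_UniformSpace) (fun t => du t / (u t - c))%C t) ->
      arc_integral (fun z => v z ^ n)%C c u du a b 0 = (v c ^ n * CInt (fun t => du t / (u t - c)) a b)%C).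
    { intros u du a b Hab Ck. unfold arc_integral.
      rewrite (CInt_ext _ (fun t => v c ^ n * (du t / (u t - c)))%C) by (try lra; intros; rewrite T0; reflexivity).
      apply CInt_scal, ex_CInt; [lra|exact Ck]. }
    rewrite (E0 u1 du1 a1 b1 Hab1 K1), (E0 u2 du2 a2 b2 Hab2 K2) in I.
    replace (Cmod (v c) ^ n * Cmod W) with (Cmod (v c ^ n * W)) by (rewrite Cmod_mult, Cmod_pow; reflexivity).
    replace (v c ^ n * W)%C with (v c ^ n * CInt (fun t => du1 t / (u1 t - c)) a1 b1 +
      v c ^ n * CInt (fun t => du2 t / (u2 t - c)) a2 b2)%C by (unfold W; ring).
    rewrite <- I. eapply Rle_trans; [apply Cmod_triangle|]. unfold K. lra. }
  (* If [M < x], the powers of [M / x] tend to 0, yet [Hpow] keeps them above [Cmod W / K]. *)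
  apply Rnot_lt_le. intros Hlt. set (x := Cmod (v c)) in *.
  assert (Hq : Rabs (M / x) < 1).
  { rewrite Rabs_pos_eq; [|apply Rdiv_le_0_compat; lra].
    apply Rmult_lt_reg_r with x; [lra|]. unfold Rdiv. rewrite Rmult_assoc, Rinv_l; lra. }
  destruct (pow_lt_1_zero _ Hq (Cmod W / K)) as [N HN]; [apply Rdiv_lt_0_compat; lra|].
  specialize (HN N (le_n _)). specialize (Hpow N).
  assert (Hx : 0 < x ^ N) by (apply pow_lt; lra).
  apply (Rle_lt_trans _ _ _ (Rle_abs _)) in HN.
  assert (E : (M / x) ^ N = M ^ N / x ^ N).
  { unfold Rdiv. rewrite Rpow_mult_distr, pow_inv. reflexivity. }
  rewrite E in HN. apply (Rmult_lt_compat_r (x ^ N * K)) in HN; [|apply Rmult_lt_0_compat; lra].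
  replace (M ^ N / x ^ N * (x ^ N * K)) with (M ^ N * K) in HN by (field; lra).
  replace (Cmod W / K * (x ^ N * K)) with (x ^ N * Cmod W) in HN by (field; lra). lra.
Qed.
End TwoArcs.

Lemma Im_div (z w : C) :
  Im (z / w) = (Im z * Re w - Re z * Im w) / (Re w * (Re w * 1) + Im w * (Im w * 1)).
Proof. unfold Im, Re, Cdiv, Cmult, Cinv; simpl. unfold Rdiv. ring. Qed.

Lemma Cmod_sqr (z : C) : Re z * Re z + Im z * Im z = Cmod z * Cmod z.
Proof. generalize (Cmod2_alt z). simpl. lra. Qed.

(** For [|u| = 1], the imaginary part of [i u / (u - c)] is [1 - Re (u * Cconj c)] over [|u - c|^2],
    positive since [|c| < 1]. *)
Lemma star_arc_circle (c : C) (a b : R) : a < b -> Cmod c < 1 ->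
  star_arc c cis (fun t => Ci * cis t)%C a b.
Proof.
  intros Hab Hc. split; [exact Hab|]. split; [apply is_derive_cis|]. split.
  - intros t. apply continuous_Cmult; [apply continuous_Cconst|apply continuous_cis, continuous_id].
  - intros t _.
    assert (Hn : cis t <> c) by (intros <-; rewrite Cmod_cis in Hc; lra).
    split; [exact Hn|].
    rewrite Im_div.
    assert (N := Cnorm2_neq_0 _ (Cminus_neq_0 _ _ Hn)).
    assert (N2 := Cmod_sqr c). assert (N3 := Cmod_ge_0 c).
    assert (T := sin2_cos2 t). unfold Rsqr in T.
    unfold cis, Re, Im in *. simpl in *. destruct c as [p q]. simpl in *.
    set (x := cos t) in *. set (y := sin t) in *. set (m := Cmod (p, q)) in *. clearbody x y m.
    assert (m * m < 1) by nra.
    assert (0 <= (x - p) * (x - p)) by apply Rle_0_sqr. assert (0 <= (y - q) * (y - q)) by apply Rle_0_sqr.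
    apply Rdiv_lt_0_compat; [nra|].
    assert (D : (x + - p) * ((x + - p) * 1) + (y + - q) * ((y + - q) * 1) =
                (x - p) * (x - p) + (y - q) * (y - q)) by ring.
    rewrite D in *. lra.
Qed.

Lemma star_arc_segment (c : C) (a b : R) : a < b -> 0 < Im c ->
  star_arc c RtoC (fun _ => 1)%C a b.
Proof.
  intros Hab Hc. split; [exact Hab|]. split; [intros t; apply is_derive_RtoC; auto_derive; auto|]. split.
  - intros t. apply continuous_Cconst.
  - intros t _.
    assert (Hn : RtoC t <> c) by (intros <-; simpl in Hc; lra).
    split; [exact Hn|]. rewrite Im_div.
    assert (N := Cnorm2_neq_0 _ (Cminus_neq_0 _ _ Hn)).
    unfold Re, Im in *. simpl in *. destruct c as [p q]. simpl in *.
    apply Rdiv_lt_0_compat; [nra|].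
    assert (0 <= (t + - p) * (t + - p)) by apply Rle_0_sqr. nra.
Qed.

Lemma Cmod_toward c u s t : 0 <= s <= 1 -> Cmod (toward c u s t) <= (1 - s) * Cmod c + s * Cmod (u t).
Proof.
  intros Hs. unfold toward.
  replace (c + RtoC s * (u t - c))%C with (RtoC (1 - s) * c + RtoC s * u t)%C by (rewrite RtoC_minus; ring).
  eapply Rle_trans; [apply Cmod_triangle|]. rewrite !Cmod_mult, !Cmod_R, !Rabs_pos_eq by lra. lra.
Qed.

Lemma Im_toward c u s t : Im (toward c u s t) = (1 - s) * Im c + s * Im (u t).
Proof. unfold toward, Im; simpl. ring. Qed.

Definition unit_disc (z : C) : Prop := Cmod z <= 1.

(** The circle is cut into two half circles, so that one argument covers the disc and the half
    disc. *)
Lemma max_principle_disc (v : C -> C) (M : R) (c : C) :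
  continuous_on_C unit_disc v -> (forall z, Cmod z < 1 -> cdiff v z) ->
  (forall z, Cmod z = 1 -> Cmod (v z) <= M) -> Cmod c <= 1 -> Cmod (v c) <= M.
Proof.
  intros Hv Hd HM Hc. destruct (Rle_lt_or_eq_dec _ _ Hc) as [Hc1|]; [|auto].
  pose proof PI_RGT_0 as HPI. pose proof (Cmod_ge_0 c).
  apply (max_principle_two_arcs unit_disc c cis (fun t => Ci * cis t)%C 0 PI cis (fun t => Ci * cis t)%C PI (2 * PI));
    try assumption.
  1,2: apply star_arc_circle; lra.
  1: reflexivity.
  1: rewrite cis_2PI, cis_0; reflexivity.
  1,2: intros s t Hs Ht; eapply Rle_trans; [apply Cmod_toward; lra|rewrite Cmod_cis; nra].
  1,2: intros s t Hs Ht; apply Hd; eapply Rle_lt_trans; [apply Cmod_toward; lra|rewrite Cmod_cis; nra].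
  1,2: intros; apply HM, Cmod_cis.
Qed.

Lemma max_principle_half_disc (v : C -> C) (M : R) (c : C) :
  continuous_on_C closed_upper_half_disc v -> (forall z, Cmod z < 1 -> 0 < Im z -> cdiff v z) ->
  (forall t, 0 <= t <= PI -> Cmod (v (cis t)) <= M) ->
  (forall t, -1 <= t <= 1 -> Cmod (v (RtoC t)) <= M) ->
  Cmod c < 1 -> 0 < Im c -> Cmod (v c) <= M.
Proof.
  intros Hv Hd HM1 HM2 Hc Hic. pose proof PI_RGT_0 as HPI. pose proof (Cmod_ge_0 c).
  apply (max_principle_two_arcs closed_upper_half_disc c cis (fun t => Ci * cis t)%C 0 PI RtoC (fun _ => 1)%C (-1) 1);
    try assumption.
  - apply star_arc_circle; lra.
  - apply star_arc_segment; lra.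
  - rewrite cis_PI. unfold Copp, RtoC; simpl. f_equal; ring.
  - rewrite cis_0. reflexivity.
  - intros s t Hs Ht. split.
    + eapply Rle_trans; [apply Cmod_toward; lra|rewrite Cmod_cis; nra].
    + rewrite Im_toward. assert (0 <= Im (cis t)) by (apply sin_ge_0; lra). nra.
  - intros s t Hs Ht. assert (Rabs t <= 1) by (apply Rabs_le; lra). split.
    + eapply Rle_trans; [apply Cmod_toward; lra|rewrite Cmod_R; nra].
    + rewrite Im_toward. simpl. nra.
  - intros s t Hs Ht. apply Hd.
    + eapply Rle_lt_trans; [apply Cmod_toward; lra|rewrite Cmod_cis; nra].
    + rewrite Im_toward. assert (0 <= Im (cis t)) by (apply sin_ge_0; lra). nra.
  - intros s t Hs Ht. assert (Rabs t <= 1) by (apply Rabs_le; lra). apply Hd.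
    + eapply Rle_lt_trans; [apply Cmod_toward; lra|rewrite Cmod_R; nra].
    + rewrite Im_toward. simpl. nra.
Qed.

Lemma Rmult_pow_bounded_zero (x y M : R) : 0 <= x -> 1 < y -> (forall n, x * y ^ n <= M) -> x = 0.
Proof.
  intros Hx Hy H. apply Rle_antisym; [|exact Hx]. apply Rnot_lt_le. intros Hp.
  destruct (Pow_x_infinity y) with (b := (M + 1) / x) as [N HN]; [rewrite Rabs_pos_eq; lra|].
  specialize (HN N (le_n _)). specialize (H N).
  rewrite Rabs_pos_eq in HN by (apply pow_le; lra).
  apply Rge_le, (Rmult_le_compat_l x) in HN; [|lra].
  replace (x * ((M + 1) / x)) with (M + 1) in HN by (field; lra). lra.
Qed.

(* The weight [1 / (z + i eta)] is at most 1 on the upper half circle but larger than 1 at [z]. *)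
Lemma upper_half_disc_identity (v : C -> C) :
  continuous_on_C unit_disc v -> (forall z, Cmod z < 1 -> cdiff v z) ->
  (forall t, -1 <= t <= 1 -> v (RtoC t) = 0%C) ->
  forall z, Cmod z < 1 -> 0 < Im z -> v z = 0%C.
Proof.
  intros Hv Hd H0 z Hz Hiz.
  (* Then [|z + i eta| <= (1 + |z|) / 2 < 1], while [|u + i eta| >= 1] on the upper unit
     semicircle. *)
  set (eta := (1 - Cmod z) / 2). assert (He : 0 < eta) by (unfold eta; lra).
  set (g := fun w : C => (/ (w + RtoC eta * Ci))%C).
  assert (Hne : forall w, 0 <= Im w -> (w + RtoC eta * Ci)%C <> 0%C).
  { intros w Hw E. assert (E2 : Im (w + RtoC eta * Ci) = 0) by (rewrite E; reflexivity).
    unfold Im in *; simpl in *. lra. }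
  assert (Hgd : forall w, 0 <= Im w -> cdiff g w).
  { intros w Hw. apply cdiff_inv; [apply Hne, Hw|]. apply cdiff_plus; [apply cdiff_id|apply cdiff_const]. }
  assert (Hg1 : forall t, 0 <= t <= PI -> Cmod (g (cis t)) <= 1).
  { intros t Ht. assert (S0 : 0 <= sin t) by (apply sin_ge_0; lra). unfold g.
    rewrite Cmod_inv by (apply Hne; exact S0).
    apply Rle_trans with (/ 1); [|lra]. apply Rinv_le_contravar; [lra|].
    apply Rsqr_incr_0; [|lra|apply Cmod_ge_0]. unfold Rsqr. rewrite <- Cmod_sqr.
    generalize (sin2_cos2 t). unfold Rsqr, Re, Im, cis; simpl. nra. }
  assert (Hgz : 1 < Cmod (g z)).
  { unfold g. assert (Hn := Hne z (Rlt_le _ _ Hiz)). rewrite Cmod_inv by exact Hn.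
    apply Rle_lt_trans with (/ 1); [lra|]. apply Rinv_lt_contravar.
    - apply Cmod_gt_0 in Hn. lra.
    - eapply Rle_lt_trans; [apply Cmod_triangle|].
      rewrite Cmod_mult, Cmod_Ci, Cmod_R, Rabs_pos_eq by lra. unfold eta. lra. }
  destruct (bounded1 (fun t => v (cis t)) 0 PI) as [M [M0 HM]].
  { intros t Ht. apply (continuous_on_C_comp unit_disc v cis t Hv).
    - intros y. unfold unit_disc. rewrite Cmod_cis. lra.
    - apply continuous_cis, continuous_id. }
  apply Cmod_eq_0. apply (Rmult_pow_bounded_zero _ (Cmod (g z)) M (Cmod_ge_0 _) Hgz).
  intros n. rewrite <- Cmod_pow, <- Cmod_mult.
  (* On the diameter the powers of [g] may be huge, but [v] vanishes there; the bound [M] is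
     therefore independent of [n]. *)
  apply (max_principle_half_disc (fun w => v w * g w ^ n)%C M z); try assumption.
  - apply continuous_on_C_mult.
    + apply (continuous_on_C_subset unit_disc); [intros w [Hw _]; exact Hw|exact Hv].
    + apply continuous_on_C_of_continuous. intros w [_ Hw].
      apply (continuous_Cpow (T := C_UniformSpace) g), cdiff_continuous, Hgd, Hw.
  - intros w Hw1 Hw2. apply cdiff_mult; [apply Hd, Hw1|apply cdiff_pow, Hgd; lra].
  - intros t Ht. rewrite Cmod_mult, Cmod_pow.
    rewrite <- (Rmult_1_r M). apply Rmult_le_compat; try apply Cmod_ge_0; [apply pow_le, Cmod_ge_0|apply HM, Ht|].
    rewrite <- (pow1 n). apply pow_incr. split; [apply Cmod_ge_0|apply Hg1, Ht].
  - intros t Ht. rewrite H0 by exact Ht. rewrite Cmult_0_l, Cmod_0. lra.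
Qed.

(** The rotation [z -> - z] preserves the diameter and carries the lower half disc to the upper
    one. *)
Lemma disc_identity (v : C -> C) :
  continuous_on_C unit_disc v -> (forall z, Cmod z < 1 -> cdiff v z) ->
  (forall t, -1 <= t <= 1 -> v (RtoC t) = 0%C) ->
  forall z, Cmod z < 1 -> v z = 0%C.
Proof.
  intros Hv Hd H0 z Hz.
  destruct (Rtotal_order (Im z) 0) as [Hi|[Hi|Hi]].
  - assert (E : v (- - z)%C = 0%C).
    { apply (upper_half_disc_identity (fun w => v (- w)%C)).
      - apply (continuous_on_C_precomp unit_disc); [exact Hv| |].
        + intros w. apply continuous_Copp, (continuous_id (U := C_UniformSpace)).
        + intros w Hw. unfold unit_disc in *. rewrite Cmod_opp. exact Hw.
      - intros w Hw. apply (cdiff_comp v (fun w => - w)%C).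
        + apply Hd. rewrite Cmod_opp. exact Hw.
        + apply cdiff_opp, cdiff_id.
      - intros t Ht. rewrite <- RtoC_opp. apply H0. lra.
      - rewrite Cmod_opp. exact Hz.
      - rewrite im_opp. lra. }
    replace (- - z)%C with z in E by ring. exact E.
  - destruct z as [x y]. unfold Im in Hi; simpl in Hi. subst y. apply (H0 x).
    assert (Rabs x <= 1) by (rewrite <- Cmod_R; left; exact Hz). apply Rabs_le_between. assumption.
  - apply upper_half_disc_identity; assumption.
Qed.

(** * The family of extensions *)

(** The extensions for all centres at once. As a predicate on pairs it can be transported by
    translations and by conjugation. *)
Record extension_family (f : C -> C) (G : R -> C -> C) : Prop := {
  family_boundary_continuous : continuous_on_C closed_strip f;
  family_continuous : forall r, continuous_on_C (closed_unit_disc_at r) (G r);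
  family_cdiff : forall r z, open_unit_disc_at r z -> cdiff (G r) z;
  family_boundary : forall r z, unit_circle_at r z -> G r z = f z }.

Lemma continuous_translation (c z : C) :
  continuous (T := C_UniformSpace) (U := C_UniformSpace) (fun w => c + w)%C z.
Proof. apply continuous_Cplus; [apply continuous_Cconst|apply (continuous_id (U := C_UniformSpace))]. Qed.

Lemma cdiff_translation (f : C -> C) (c z : C) : cdiff f (c + z)%C -> cdiff (fun w => f (c + w)%C) z.
Proof.
  intros H. apply (cdiff_comp f (fun w => c + w)%C); [exact H|].
  apply cdiff_plus; [apply cdiff_const|apply cdiff_id].
Qed.

Section Family.
Variables (f : C -> C) (G : R -> C -> C).
Hypothesis HG : extension_family f G.

Lemma family_disc_continuous r : continuous_on_C unit_disc (fun z => G r (RtoC r + z))%C.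
Proof.
  apply (continuous_on_C_precomp (closed_unit_disc_at r)).
  - apply (family_continuous f G HG).
  - intros z. apply continuous_translation.
  - intros z Hz. unfold closed_unit_disc_at, unit_disc in *.
    replace (RtoC r + z - RtoC r)%C with z by ring. exact Hz.
Qed.

Lemma family_disc_cdiff r z : Cmod z < 1 -> cdiff (fun z => G r (RtoC r + z))%C z.
Proof.
  intros Hz. apply cdiff_translation, (family_cdiff f G HG).
  unfold open_unit_disc_at. replace (RtoC r + z - RtoC r)%C with z by ring. exact Hz.
Qed.

Lemma family_circle r z : Cmod z = 1 -> G r (RtoC r + z)%C = f (RtoC r + z)%C.
Proof.
  intros Hz. apply (family_boundary f G HG).
  unfold unit_circle_at. replace (RtoC r + z - RtoC r)%C with z by ring. exact Hz.
Qed.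

Lemma strip_clamped_continuous : continuous2 (fun x y => f (x, clamp (-1) 1 y)).
Proof.
  intros p. apply (continuous_on_C_comp closed_strip f (fun p : R * R => (fst p, clamp (-1) 1 (snd p)))).
  - apply HG.
  - intros q. unfold closed_strip; simpl. apply Rabs_le, clamp_in. lra.
  - apply continuous_C_pair; simpl; [|apply continuous_clamp]; destruct p;
      [apply continuous_fst|apply continuous_snd].
Qed.

(** On the circle the difference of the recentred extensions is small by uniform continuity of [f];
    the maximum principle carries this into the disc. It is the source of all regularity in [r]. *)
Lemma family_equicontinuous r0 eps : 0 < eps -> exists d, 0 < d /\
  forall r, Rabs (r - r0) < d -> forall z, Cmod z <= 1 ->
  Cmod (G r (RtoC r + z) - G r0 (RtoC r0 + z)) <= eps.
Proof.
  intros He.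
  destruct (Heine2 _ (r0 - 3) (r0 + 3) (-1) 1 eps strip_clamped_continuous He) as [d [Hd Hk]].
  exists (Rmin d 1). split; [apply Rmin_pos; lra|].
  intros r Hr z Hz. pose proof (Rmin_l d 1). pose proof (Rmin_r d 1).
  assert (-1 <= r - r0 <= 1) by (apply Rabs_le_between; lra).
  apply (max_principle_disc (fun z => G r (RtoC r + z) + - (1) * G r0 (RtoC r0 + z))%C eps z) in Hz.
  - replace (G r (RtoC r + z) - G r0 (RtoC r0 + z))%C
      with (G r (RtoC r + z) + - (1) * G r0 (RtoC r0 + z))%C by ring. exact Hz.
  - apply continuous_on_C_plus; [apply family_disc_continuous|].
    apply continuous_on_C_mult; [|apply family_disc_continuous].
    apply continuous_on_C_of_continuous. intros; apply continuous_Cconst.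
  - intros w Hw. apply cdiff_plus; [apply family_disc_cdiff, Hw|].
    apply cdiff_mult; [apply cdiff_const|apply family_disc_cdiff, Hw].
  - intros w Hw. rewrite !family_circle by exact Hw.
    pose proof (Rabs_fst_le_Cmod w) as W1. pose proof (Rabs_snd_le_Cmod w) as W2. rewrite Hw in W1, W2.
    apply Rabs_le_between in W1. apply Rabs_le_between in W2.
    assert (K := Hk (r0 + fst w) (r + fst w) (snd w) (snd w) ltac:(lra) ltac:(lra) ltac:(lra) ltac:(lra)).
    rewrite !clamp_id in K by lra.
    replace (RtoC r + w)%C with (r + fst w, snd w) by (destruct w; unfold Cplus, RtoC; simpl; f_equal; ring).
    replace (RtoC r0 + w)%C with (r0 + fst w, snd w) by (destruct w; unfold Cplus, RtoC; simpl; f_equal; ring).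
    match goal with |- Cmod ?x <= _ => replace x with (f ((r + fst w)%R, snd w) - f ((r0 + fst w)%R, snd w))%C by ring end.
    left. apply K.
    + replace (r + fst w - (r0 + fst w)) with (r - r0) by ring. lra.
    + rewrite Rminus_diag, Rabs_R0. lra.
Qed.

(** The point is given relative to the centre: equicontinuity then handles the change of [r], and
    continuity of the single [G r0] the change of [t]. *)
Lemma family_real_continuous : continuous2 (fun r t => G r (RtoC r + RtoC (clamp (-1) 1 t)))%C.
Proof.
  intros [r0 t0]. apply continuous_C_iff. intros eps.
  assert (He : 0 < eps / 2) by (destruct eps; simpl; lra).
  destruct (family_equicontinuous r0 (eps / 2) He) as [d1 [Hd1 H1]].
  assert (Hcl : forall t, Cmod (RtoC (clamp (-1) 1 t)) <= 1).
  { intros t. rewrite Cmod_R. apply Rabs_le, clamp_in. lra. }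
  assert (C0 : continuous (U := C_UniformSpace) (fun t => G r0 (RtoC r0 + RtoC (clamp (-1) 1 t)))%C t0).
  { apply (continuous_on_C_comp unit_disc (fun z => G r0 (RtoC r0 + z))%C (fun t => RtoC (clamp (-1) 1 t))).
    - apply family_disc_continuous.
    - exact Hcl.
    - apply continuous_RtoC, continuous_clamp, continuous_id. }
  destruct (proj1 (continuous_C_iff _ _) C0 (mkposreal _ He)) as [d2 H2].
  exists (mkposreal _ (Rmin_pos d1 d2 Hd1 (cond_pos d2))). intros [r t] [Hr Ht]. simpl in *.
  change (Rabs (r - r0) < Rmin d1 d2) in Hr. change (Rabs (t - t0) < Rmin d1 d2) in Ht.
  pose proof (Rmin_l d1 d2). pose proof (Rmin_r d1 d2).
  specialize (H2 t ltac:(change (Rabs (t - t0) < d2); lra)). simpl in H2.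
  specialize (H1 r ltac:(lra) _ (Hcl t)).
  match goal with |- Cmod (?x - ?y) < _ =>
    replace (x - y)%C with ((x - G r0 (RtoC r0 + RtoC (clamp (-1) 1 t))) + (G r0 (RtoC r0 + RtoC (clamp (-1) 1 t)) - y))%C by ring end.
  eapply Rle_lt_trans; [apply Cmod_triangle|]. lra.
Qed.
End Family.

(** * Changes of variable and concentration of the weight *)

(** The slope is 1 or -1, hence its own inverse; this covers translations and reflections
    together. *)
Lemma CInt_affine (f : R -> C) (u v a b : R) : a <= b -> u * u = 1 ->
  (forall t, continuous (U := C_UniformSpace) f t) ->
  CInt (fun t => f (u * t + v)) a b = scal (V := C_R_NormedModule) u (CInt f (u * a + v) (u * b + v)).
Proof.
  intros Hab Hu Hc.
  assert (Hc2 : forall t, continuous (U := C_UniformSpace) (fun t => f (u * t + v)) t).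
  { intros t. apply (continuous_comp (V := R_UniformSpace) (W := C_UniformSpace) (fun t => u * t + v) f); [|apply Hc].
    apply continuous_R_plus; [apply continuous_R_mult|]; try apply continuous_const. apply continuous_id. }
  unfold CInt at 2. rewrite <- (RInt_comp_lin (V := C_R_CompleteNormedModule) f u v a b) by apply ex_CInt_any, Hc.
  change (CInt (fun t => f (u * t + v)) a b =
    scal (V := C_R_NormedModule) u (CInt (fun t => scal (V := C_R_NormedModule) u (f (u * t + v))) a b)).
  rewrite CInt_rscal by apply ex_CInt_any, Hc2.
  rewrite (scal_assoc (V := C_R_NormedModule) u u). unfold mult; simpl. rewrite Hu.
  symmetry. apply (scal_one (V := C_R_NormedModule)).
Qed.

Lemma CInt_shift (f : R -> C) (v a b : R) : a <= b ->
  (forall t, continuous (U := C_UniformSpace) f t) ->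
  CInt (fun t => f (t + v)) a b = CInt f (a + v) (b + v).
Proof.
  intros Hab Hc. generalize (CInt_affine f 1 v a b Hab ltac:(ring) Hc).
  rewrite !Rmult_1_l. intros E. etransitivity; [etransitivity; [|exact E]|].
  - apply CInt_ext; [exact Hab|]. intros t _. now rewrite Rmult_1_l.
  - apply (scal_one (V := C_R_NormedModule)).
Qed.

Lemma CInt_reflect (f : R -> C) (v a b : R) : a <= b ->
  (forall t, continuous (U := C_UniformSpace) f t) ->
  CInt (fun t => f (v - t)) a b = CInt f (v - b) (v - a).
Proof.
  intros Hab Hc. generalize (CInt_affine f (-1) v a b Hab ltac:(ring) Hc).
  intros E. etransitivity; [etransitivity; [|exact E]|].
  - apply CInt_ext; [exact Hab|]. intros t _. f_equal. ring.
  - replace (-1 * a + v) with (v - a) by ring. replace (-1 * b + v) with (v - b) by ring.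
    unfold CInt. rewrite <- (opp_RInt_swap (V := C_R_CompleteNormedModule) f (v - a) (v - b)).
    + exact (scal_opp_one (V := C_R_NormedModule) (CInt f (v - a) (v - b))).
    + apply ex_CInt_any, Hc.
Qed.

(** The shifted window [[-3 + c, 3 + c]] misses two pieces of [[-4, 4]], of total length 2, both in
    the region [2 <= |x| <= 4]. *)
Lemma CInt_shifted_window (g : R -> C) (c M : R) : -1 <= c <= 1 ->
  (forall t, continuous (U := C_UniformSpace) g t) ->
  (forall x, 2 <= Rabs x <= 4 -> Cmod (g x) <= M) ->
  Cmod (CInt (fun r => g (r + c)) (-3) 3 - CInt g (-4) 4) <= 2 * M.
Proof.
  intros Hc Hg HM. rewrite CInt_shift by (try lra; exact Hg).
  rewrite <- (CInt_Chasles g (-4) (-3 + c) 4) by apply ex_CInt_any, Hg.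
  rewrite <- (CInt_Chasles g (-3 + c) (3 + c) 4) by apply ex_CInt_any, Hg.
  match goal with |- Cmod (?x - (?y + (?x + ?z))) <= _ =>
    replace (x - (y + (x + z)))%C with (- (y + z))%C by ring end.
  rewrite Cmod_opp. eapply Rle_trans; [apply Cmod_triangle|].
  apply Rle_trans with ((-3 + c - -4) * M + (4 - (3 + c)) * M).
  - apply Rplus_le_compat; (apply Cmod_CInt_le; [lra|apply ex_CInt_any, Hg|]); intros t Ht; apply HM.
    + rewrite Rabs_left; lra.
    + rewrite Rabs_pos_eq; lra.
  - lra.
Qed.

Definition peak (x : R) : R := 1 - x * x / 16.

Lemma peak_continuous n : forall x, continuous (fun x => peak x ^ n) x.
Proof.
  intros x. apply (ex_derive_continuous (V := R_NormedModule)). unfold peak. auto_derive. auto.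
Qed.

(** Only [|x| <= d / 2] is kept, an interval of length [d] on which [peak] is at least
    [1 - d^2 / 64]. *)
Lemma peak_mass_ge d n : 0 < d <= 1 -> d * (1 - d * d / 64) ^ n <= RInt (fun x => peak x ^ n) (-4) 4.
Proof.
  intros Hd.
  assert (Ex : forall a b, ex_RInt (fun x => peak x ^ n) a b).
  { intros. apply (ex_RInt_continuous (V := R_CompleteNormedModule)). intros; apply peak_continuous. }
  assert (P : forall x, -4 <= x <= 4 -> 0 <= peak x ^ n) by (intros; apply pow_le; unfold peak; nra).
  rewrite <- (RInt_Chasles (fun x => peak x ^ n) (-4) (- (d / 2)) 4) by apply Ex.
  rewrite <- (RInt_Chasles (fun x => peak x ^ n) (- (d / 2)) (d / 2) 4) by apply Ex.
  assert (A1 : 0 <= RInt (fun x => peak x ^ n) (-4) (- (d / 2)))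
    by (apply RInt_ge_0; [lra|apply Ex|intros; apply P; lra]).
  assert (A2 : 0 <= RInt (fun x => peak x ^ n) (d / 2) 4)
    by (apply RInt_ge_0; [lra|apply Ex|intros; apply P; lra]).
  assert (A3 : RInt (fun _ => (1 - d * d / 64) ^ n) (- (d / 2)) (d / 2) <= RInt (fun x => peak x ^ n) (- (d / 2)) (d / 2)).
  { apply RInt_le; [lra|apply ex_RInt_const|apply Ex|]. intros x Hx. apply pow_incr. unfold peak. nra. }
  rewrite RInt_const in A3. unfold scal, plus in *; simpl in *. unfold mult in A3; simpl in A3. lra.
Qed.

(** The weighted integrals are close to the mass of the weight times the value at [x = 0]. That mass
    decays more slowly than [(9 / 10) ^ n], so the value at 0 has to vanish. *)
Lemma peak_concentration (g : R -> R -> C) (K : R) : continuous2 g ->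
  (forall n, Cmod (CInt (fun t => CInt (fun x => g x t * RtoC (peak x ^ n)) (-4) 4) (-1) 1)%C <= K * (9 / 10) ^ n) ->
  CInt (fun t => g 0 t) (-1) 1 = RtoC 0.
Proof.
  intros Hg HK. apply Cmod_eq_0, Rle_antisym; [|apply Cmod_ge_0].
  apply le_epsilon. intros eps He. rewrite Rplus_0_l.
  apply Rnot_lt_le. intros Hlt.
  set (e := eps / 2). assert (He' : 0 < e) by (unfold e; lra).
  destruct (Heine2 g (-4) 4 (-1) 1 e Hg He') as [d0 [Hd0 Hk]].
  set (d := Rmin d0 1).
  assert (Hd : 0 < d <= 1 /\ d <= d0) by (unfold d, Rmin; destruct (Rle_dec _ _); lra).
  clearbody d. destruct Hd as [Hd Hd1].
  destruct (bounded2 g (-4) 4 (-1) 1 Hg) as [B [HB0 HB]].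
  (* [rho] bounds the weight for [|x| >= d], and [sigma] bounds it below for [|x| <= d / 2]. Since
     [d <= 1], [rho] is at least 15/16, above 9/10. The growth of [(sigma / rho) ^ n] gives the
     contradiction. *)
  set (rho := 1 - d * d / 16). set (sigma := 1 - d * d / 64).
  assert (Hr : 15 / 16 <= rho < sigma /\ sigma < 1) by (unfold rho, sigma; nra).
  set (I0 := CInt (fun t => g 0 t) (-1) 1) in *.
  assert (K0 : 0 <= K).
  { generalize (HK 0%nat) (Cmod_ge_0 (CInt (fun t => CInt (fun x => g x t * RtoC (peak x ^ 0)) (-4) 4) (-1) 1)%C).
    simpl. lra. }
  (* [32 * B] is the length 2 in [t], times the length 8 in [x], times the bound [2 * B] of a
     difference of values. *)
  assert (Main : forall n, (Cmod I0 - eps) * d * (sigma / rho) ^ n <= 32 * B + K).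
  { intros n. set (m := RInt (fun x => peak x ^ n) (-4) 4).
    assert (Cpk : forall x, continuous (U := C_UniformSpace) (fun x => RtoC (peak x ^ n)) x)
      by (intros; apply continuous_RtoC, peak_continuous).
    assert (Cg2 : continuous2 (fun t x => g x t * RtoC (peak x ^ n))%C).
    { intros p. apply continuous_Cmult; [apply (continuous2_swap _ Hg)|].
      apply (continuous_comp (V := R_UniformSpace) (W := C_UniformSpace) snd (fun x => RtoC (peak x ^ n))); [|apply Cpk].
      destruct p; apply continuous_snd. }
    assert (Em : CInt (fun x => RtoC (peak x ^ n)) (-4) 4 = RtoC m).
    { apply (is_RInt_unique (V := C_R_CompleteNormedModule)). apply is_CInt_pair; simpl.
      - apply (RInt_correct (V := R_CompleteNormedModule)), (ex_RInt_continuous (V := R_CompleteNormedModule)).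
        intros; apply peak_continuous.
      - evar_last; [apply (is_RInt_const (V := R_NormedModule))|]. apply (scal_zero_r (V := R_NormedModule)). }
    assert (Hm := peak_mass_ge d n Hd). fold m sigma in Hm.
    assert (Inner : forall t, -1 <= t <= 1 ->
      Cmod (CInt (fun x => g x t * RtoC (peak x ^ n)) (-4) 4 - RtoC m * g 0 t)%C <= e * m + 16 * B * rho ^ n).
    { intros t Ht. rewrite <- Em, Cmult_comm, <- CInt_scal by apply ex_CInt_any, Cpk.
      rewrite <- CInt_minus.
      2: apply (ex_CInt_r _ (-4) 4 t ltac:(lra) Cg2).
      2:{ apply ex_CInt_any. intros; apply continuous_Cmult; [apply continuous_Cconst|apply Cpk]. }
      rewrite <- norm_C_R.
      replace (e * m + 16 * B * rho ^ n) with (RInt (fun x => e * peak x ^ n + 2 * B * rho ^ n) (-4) 4).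
      2:{ apply is_RInt_unique. evar_last.
          - apply (is_RInt_plus (V := R_NormedModule)); [|apply (is_RInt_const (V := R_NormedModule))].
            apply (is_RInt_scal (V := R_NormedModule)), (RInt_correct (V := R_CompleteNormedModule)).
            apply (ex_RInt_continuous (V := R_CompleteNormedModule)). intros; apply peak_continuous.
          - unfold plus, scal; simpl. unfold mult; simpl. fold m. ring. }
      apply (norm_RInt_le (V := C_R_NormedModule)
        (fun x => g x t * RtoC (peak x ^ n) - g 0%R t * RtoC (peak x ^ n))%C
        (fun x => e * peak x ^ n + 2 * B * rho ^ n) (-4) 4); [lra| | |].
      - intros x Hx. rewrite norm_C_R.
        replace (g x t * RtoC (peak x ^ n) - g 0%R t * RtoC (peak x ^ n))%C
          with ((g x t - g 0%R t) * RtoC (peak x ^ n))%C by ring.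
        assert (P0 : 0 <= peak x) by (unfold peak; nra).
        assert (Pn : 0 <= peak x ^ n) by (apply pow_le, P0).
        assert (Rn : 0 <= rho ^ n) by (apply pow_le; lra).
        rewrite Cmod_mult, Cmod_R, (Rabs_pos_eq (peak x ^ n)) by exact Pn.
        destruct (Rlt_dec (Rabs x) d) as [Hxd|Hxd].
        + assert (Cmod (g x t - g 0%R t) < e).
          { apply Hk; try lra; [rewrite Rminus_0_r; lra|rewrite Rminus_diag, Rabs_R0; lra]. }
          assert (0 <= B * rho ^ n) by (apply Rmult_le_pos; assumption). nra.
        + assert (Hx2 : d * d <= x * x).
          { apply Rnot_lt_le in Hxd. replace (x * x) with (Rabs x * Rabs x).
            - apply Rmult_le_compat; lra.
            - rewrite <- Rabs_mult. apply Rabs_pos_eq. nra. }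
          assert (Hp : peak x ^ n <= rho ^ n) by (apply pow_incr; unfold peak, rho in *; nra).
          assert (Cmod (g x t - g 0%R t) <= 2 * B).
          { unfold Cminus. eapply Rle_trans; [apply Cmod_triangle|]. rewrite Cmod_opp.
            generalize (HB x t Hx Ht) (HB 0 t ltac:(lra) Ht). lra. }
          assert (0 <= e * peak x ^ n) by (apply Rmult_le_pos; lra).
          apply Rle_trans with (2 * B * rho ^ n); [|lra].
          apply Rmult_le_compat; try assumption. apply Cmod_ge_0.
      - apply (RInt_correct (V := C_R_CompleteNormedModule)), ex_CInt_any.
        intros x. apply continuous_Cminus.
        + apply continuous_Cmult; [apply continuous2_l, Hg|apply Cpk].
        + apply continuous_Cmult; [apply continuous_Cconst|apply Cpk].
      - apply (RInt_correct (V := R_CompleteNormedModule)), (ex_RInt_continuous (V := R_CompleteNormedModule)).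
        intros x _. apply continuous_R_plus; [|apply continuous_const].
        apply continuous_R_mult; [apply continuous_const|apply peak_continuous]. }
    assert (Cin : forall t, continuous (U := C_UniformSpace) (fun t => CInt (fun x => g x t * RtoC (peak x ^ n))%C (-4) 4) t).
    { apply (continuous_CInt_param _ (-4) 4 ltac:(lra) Cg2). }
    assert (Cg0 : forall t, continuous (U := C_UniformSpace) (fun t => g 0 t) t) by (intros; apply continuous2_r, Hg).
    assert (Outer : Cmod (CInt (fun t => CInt (fun x => g x t * RtoC (peak x ^ n)) (-4) 4) (-1) 1 - RtoC m * I0)%C
      <= (1 - -1) * (e * m + 16 * B * rho ^ n)).
    { unfold I0. rewrite <- CInt_scal by apply ex_CInt_any, Cg0.
      rewrite <- CInt_minus; try apply ex_CInt_any; auto.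
      - apply Cmod_CInt_le; [lra| |exact Inner].
        apply ex_CInt_any. intros; apply continuous_Cminus; auto. apply continuous_Cmult; [apply continuous_Cconst|auto].
      - intros; apply continuous_Cmult; [apply continuous_Cconst|auto]. }
    specialize (HK n).
    set (J := (CInt (fun t => CInt (fun x => g x t * RtoC (peak x ^ n)) (-4) 4) (-1) 1)%C) in *.
    assert (Hq : (9 / 10) ^ n <= rho ^ n) by (apply pow_incr; lra).
    assert (Rn : 0 < rho ^ n) by (apply pow_lt; lra).
    assert (Sn : 0 < sigma ^ n) by (apply pow_lt; lra).
    assert (Hm0 : 0 <= m) by (apply Rle_trans with (2 := Hm); nra).
    assert (T : m * Cmod I0 <= Cmod J + 2 * (e * m + 16 * B * rho ^ n)).
    { replace (m * Cmod I0) with (Cmod (RtoC m * I0)) by (rewrite Cmod_mult, Cmod_R, Rabs_pos_eq; auto).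
      replace (RtoC m * I0)%C with (J + - (J - RtoC m * I0))%C by ring.
      eapply Rle_trans; [apply Cmod_triangle|]. rewrite Cmod_opp. lra. }
    assert (K * (9 / 10) ^ n <= K * rho ^ n) by (apply Rmult_le_compat_l; assumption).
    assert (T2 : (Cmod I0 - eps) * (d * sigma ^ n) <= (32 * B + K) * rho ^ n).
    { apply Rle_trans with ((Cmod I0 - eps) * m); [apply Rmult_le_compat_l; lra|]. unfold e in *. nra. }
    unfold Rdiv. rewrite Rpow_mult_distr, pow_inv.
    apply Rmult_le_reg_r with (rho ^ n); [exact Rn|].
    replace ((Cmod I0 - eps) * d * (sigma ^ n * / rho ^ n) * rho ^ n) with ((Cmod I0 - eps) * (d * sigma ^ n)) by (field; lra).
    exact T2. }
  assert (Hz := Rmult_pow_bounded_zero ((Cmod I0 - eps) * d) (sigma / rho) (32 * B + K)).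
  assert (0 < (Cmod I0 - eps) * d) by (apply Rmult_lt_0_compat; lra).
  rewrite Hz in H; [lra|lra| |exact Main].
  apply Rmult_lt_reg_r with rho; [lra|]. unfold Rdiv. rewrite Rmult_assoc, Rinv_l; lra.
Qed.

(** * Vanishing of the moments *)

(* With [z' = r + z] and [w = r + 1 / z], which is the conjugate of [z'] when [|z| = 1], this is
   [1 / ((w - a) (w - b))] times the derivative of [w] with respect to [r] at fixed [z']. *)
Definition kernel (a b : C) (r : R) (z : C) : C :=
  ((z * z + 1) / (((RtoC r - a) * z + 1) * ((RtoC r - b) * z + 1)))%C.

Definition cpeak (z : C) : C := (1 - z * z / 16)%C.

Lemma cpeak_real x : cpeak (RtoC x) = RtoC (peak x).
Proof.
  unfold cpeak, peak. rewrite RtoC_minus, RtoC_div, RtoC_mult by lra. reflexivity.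
Qed.

(** With [u = x^2] and [v = y^2] the squared modulus is [(1 - (u - v) / 16)^2 + u v / 64]. Its
    maximum here is 185/256, at [u = 4] and [v = 1], below 81/100. *)
Lemma Cmod_cpeak_le x y : 2 <= Rabs x <= 4 -> 0 <= y <= 1 -> Cmod (cpeak (x, y)) <= 9 / 10.
Proof.
  intros Hx Hy. apply Rsqr_incr_0; [|apply Cmod_ge_0|lra].
  unfold Rsqr. rewrite <- Cmod_sqr.
  assert (E1 : Re (cpeak (x, y)) = 1 - (x * x - y * y) / 16).
  { unfold cpeak, Re, Cminus, Cdiv, Cmult, Cinv, Copp, Cplus, RtoC; simpl. field. }
  assert (E2 : Im (cpeak (x, y)) = - (x * y) / 8).
  { unfold cpeak, Im, Cminus, Cdiv, Cmult, Cinv, Copp, Cplus, RtoC; simpl. field. }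
  rewrite E1, E2.
  assert (X : 4 <= x * x <= 16).
  { replace (x * x) with (Rabs x * Rabs x); [nra|]. rewrite <- Rabs_mult. apply Rabs_pos_eq. nra. }
  replace (- (x * y) / 8 * (- (x * y) / 8)) with ((x * x) * (y * y) / 64) by field.
  assert (Y : 0 <= y * y <= 1) by nra.
  set (u := x * x) in *. set (v := y * y) in *. clearbody u v. nra.
Qed.

(** For [z <> 0] a zero would mean [a = r + 1 / z], whose imaginary part is nonpositive; at [z = 0]
    the factor is 1. *)
Lemma kernel_factor_neq_0 (a z : C) (r : R) : 0 < Im a -> 0 <= Im z -> ((RtoC r - a) * z + 1)%C <> 0%C.
Proof.
  intros Ha Hz E. destruct a as [p q], z as [x y].
  assert (E1 : Re ((RtoC r - (p, q)) * (x, y) + 1) = 0) by (rewrite E; reflexivity).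
  assert (E2 : Im ((RtoC r - (p, q)) * (x, y) + 1) = 0) by (rewrite E; reflexivity).
  unfold Re, Im in *; simpl in *. clear E.
  assert (F : q * (x * x + y * y) = - y).
  { replace (q * (x * x + y * y)) with (((r + - p) * x - (0 + - q) * y + 1) * y - y
      - ((r + - p) * y + (0 + - q) * x + 0) * x) by ring.
    rewrite E1, E2. ring. }
  assert (x * x + y * y = 0) by nra.
  assert (x = 0) by nra. assert (y = 0) by nra. subst. lra.
Qed.

Lemma cdiff_kernel a b r z : 0 < Im a -> 0 < Im b -> 0 <= Im z -> cdiff (kernel a b r) z.
Proof.
  intros Ha Hb Hz. unfold kernel. apply cdiff_mult.
  - apply cdiff_plus; [apply cdiff_mult; apply cdiff_id|apply cdiff_const].
  - assert (L : forall a, cdiff (fun w => (RtoC r - a) * w + 1)%C z).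
    { intros c. apply cdiff_plus; [apply cdiff_mult; [apply cdiff_const|apply cdiff_id]|apply cdiff_const]. }
    apply cdiff_inv; [apply Cmult_neq_0; apply kernel_factor_neq_0; assumption|].
    apply cdiff_mult; apply L.
Qed.

Lemma cdiff_cpeak z : cdiff cpeak z.
Proof.
  unfold cpeak. apply cdiff_minus; [apply cdiff_const|].
  apply cdiff_mult; [apply cdiff_mult; apply cdiff_id|apply cdiff_const].
Qed.

Lemma conj_line_neq (a : C) x y : 0 < Im a -> 0 <= y -> ((x, - y)%R - a)%C <> 0%C.
Proof.
  intros Ha Hy E. assert (E2 : Im ((x, - y)%R - a) = 0) by (rewrite E; reflexivity).
  unfold Im in *; simpl in *. lra.
Qed.

(** On the circle [1 / z] is the conjugate of [z], so the denominators see only the point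
    [r + cis t]. The centre survives in the factor [cos t] alone, whose sign tells apart the two
    semicircles through a point. *)
Lemma kernel_on_circle a b r t : 0 < Im a -> 0 < Im b -> 0 <= sin t ->
  (kernel a b r (cis t) * (Ci * cis t) =
   Ci * RtoC (2 * cos t) / (((r + cos t, - sin t)%R - a) * ((r + cos t, - sin t)%R - b)))%C.
Proof.
  intros Ha Hb Hs.
  assert (Hc : forall c, ((RtoC r - c) * cis t + 1 = cis t * ((r + cos t, - sin t)%R - c))%C).
  { intros [p q]. unfold cis. generalize (sin2_cos2 t). unfold Rsqr. intros T.
    apply injective_projections; simpl; nra. }
  unfold kernel. rewrite !Hc.
  assert (E : (cis t * cis t + 1 = cis t * RtoC (2 * cos t))%C).
  { unfold cis. generalize (sin2_cos2 t). unfold Rsqr. intros T.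
    apply injective_projections; simpl; nra. }
  rewrite E. field. split; [|split]; [apply conj_line_neq|apply conj_line_neq|apply cis_neq_0]; assumption.
Qed.

Section Moment.
Variables (f : C -> C) (G : R -> C -> C) (a b : C).
Hypothesis HG : extension_family f G.
Hypothesis Ha : 0 < Im a.
Hypothesis Hb : 0 < Im b.

Let k (r t : R) : C :=
  (G r (RtoC r + RtoC (clamp (-1) 1 t)) * kernel a b r (RtoC (clamp (-1) 1 t)))%C.

(** The part of the boundary integrand that depends on the point [x + i y] alone; [(x, - y)] is the
    conjugate point. *)
Let h (x y : R) : C :=
  (f (x, clamp 0 1 y) / (((x, - clamp 0 1 y)%R - a) * ((x, - clamp 0 1 y)%R - b)))%C.

Let pk (x y : R) : C := cpeak (x, clamp 0 1 y).

Lemma k_continuous : continuous2 k.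
Proof.
  intros p. apply continuous_Cmult; [apply (family_real_continuous f G HG)|].
  assert (C1 : continuous (U := C_UniformSpace) (fun p : R * R => RtoC (clamp (-1) 1 (snd p))) p).
  { apply continuous_RtoC, continuous_clamp. destruct p; apply continuous_snd. }
  assert (C2 : continuous (U := C_UniformSpace) (fun p : R * R => RtoC (fst p)) p).
  { apply continuous_RtoC. destruct p; apply continuous_fst. }
  unfold kernel. apply continuous_Cdiv.
  - apply Cmult_neq_0; apply kernel_factor_neq_0; try assumption; simpl; lra.
  - apply continuous_Cplus; [apply continuous_Cmult; exact C1|apply continuous_Cconst].
  - apply continuous_Cmult; (apply continuous_Cplus; [apply continuous_Cmult; [|exact C1]|apply continuous_Cconst]);
      (apply continuous_Cminus; [exact C2|apply continuous_Cconst]).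
Qed.

Lemma point_continuous : continuous2 (fun x y => (x, clamp 0 1 y) : C).
Proof.
  intros p. apply continuous_C_pair; simpl; [|apply continuous_clamp]; destruct p;
    [apply continuous_fst|apply continuous_snd].
Qed.

Lemma h_continuous : continuous2 h.
Proof.
  assert (Hcl : forall y, 0 <= clamp 0 1 y <= 1) by (intros; apply clamp_in; lra).
  intros p. unfold h. apply continuous_Cdiv.
  - apply Cmult_neq_0; apply conj_line_neq; try assumption; apply Hcl.
  - apply (continuous_on_C_comp closed_strip f (fun p : R * R => (fst p, clamp 0 1 (snd p)))).
    + apply HG.
    + intros q. change (Rabs (clamp 0 1 (snd q)) <= 1). specialize (Hcl (snd q)). apply Rabs_le; lra.
    + apply point_continuous.
  - apply continuous_Cmult; (apply continuous_Cminus; [|apply continuous_Cconst]);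
      apply (continuous_Cconj (fun p : R * R => (fst p, clamp 0 1 (snd p)) : C)), point_continuous.
Qed.

Lemma pk_continuous n : continuous2 (fun x y => pk x y ^ n)%C.
Proof.
  intros p. apply (continuous_Cpow (fun p : R * R => pk (fst p) (snd p))). unfold pk.
  apply (continuous_comp (V := C_UniformSpace) (W := C_UniformSpace)
    (fun p : R * R => (fst p, clamp 0 1 (snd p)) : C) cpeak).
  - apply point_continuous.
  - apply cdiff_continuous, cdiff_cpeak.
Qed.

(** Cauchy on the upper half disc of centre [r]. The weight depends on the point [r + z] and not on
    [z], so it too is the same for both semicircles through a point. *)
Lemma semicircle_identity n r :
  (CInt (fun t => k r t * RtoC (peak (r + t) ^ n)) (-1) 1 +
   CInt (fun t => Ci * RtoC (2 * cos t) * (h (r + cos t)%R (sin t) * pk (r + cos t)%R (sin t) ^ n)) 0 PI = 0)%C.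
Proof.
  pose proof PI_RGT_0 as HPI.
  rewrite <- (half_disc_Cauchy (fun z => G r (RtoC r + z) * (kernel a b r z * cpeak (RtoC r + z) ^ n))%C).
  - f_equal.
    + apply CInt_ext; [lra|]. intros t Ht. unfold k. rewrite clamp_id by lra.
      rewrite <- RtoC_plus, cpeak_real. rewrite RtoC_pow. ring.
    + apply CInt_ext; [lra|]. intros t Ht.
      assert (S0 : 0 <= sin t) by (apply sin_ge_0; lra).
      assert (S1 : sin t <= 1) by apply SIN_bound.
      replace (RtoC r + cis t)%C with (r + cos t, sin t) by
        (unfold cis, Cplus, RtoC; simpl; f_equal; ring).
      assert (EG : G r (r + cos t, sin t) = f (r + cos t, sin t)).
      { apply (family_boundary f G HG). unfold unit_circle_at.
        replace ((r + cos t, sin t)%R - RtoC r)%C with (cis t); [apply Cmod_cis|].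
        unfold cis, Cminus, Cplus, Copp, RtoC; simpl; f_equal; ring. }
      rewrite EG. unfold h, pk. rewrite clamp_id by lra.
      pose proof (kernel_on_circle a b r t Ha Hb S0) as KC.
      match goal with |- _ = (?F * (?K * ?P) * ?E)%C =>
        replace (F * (K * P) * E)%C with (F * P * (K * E))%C by ring end.
      rewrite KC. unfold Cdiv. ring.
  - apply continuous_on_C_mult.
    + apply (continuous_on_C_subset unit_disc); [intros w [Hw _]; exact Hw|apply (family_disc_continuous f G HG)].
    + apply continuous_on_C_of_continuous. intros w [_ Hw]. apply cdiff_continuous.
      apply cdiff_mult; [apply cdiff_kernel; assumption|].
      apply cdiff_pow, cdiff_translation, cdiff_cpeak.
  - intros z Hz1 Hz2. apply cdiff_mult; [apply (family_disc_cdiff f G HG), Hz1|].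
    apply cdiff_mult; [apply cdiff_kernel; assumption|].
    apply cdiff_pow, cdiff_translation, cdiff_cpeak.
Qed.

Lemma continuous2_comp_2 (g : R -> R -> C) (u v : R * R -> R) p : continuous2 g ->
  continuous u p -> continuous v p -> continuous (U := C_UniformSpace) (fun p => g (u p) (v p)) p.
Proof.
  intros Hg Hu Hv.
  apply (continuous_comp_2 (V := R_UniformSpace) (W := R_UniformSpace) (X := C_UniformSpace) u v g); auto.
Qed.

(* The semicircle is symmetric under [t -> PI - t], which reverses the sign of [cos t]. *)
Lemma cos_antisymmetric_integral (Q : R -> C) : (forall t, continuous (U := C_UniformSpace) Q t) ->
  CInt (fun t => Ci * RtoC (2 * cos t) * Q (sin t))%C 0 PI = RtoC 0.
Proof.
  intros HQ. pose proof PI_RGT_0 as HPI.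
  set (F := fun t => (Ci * RtoC (2 * cos t) * Q (sin t))%C).
  assert (CF : forall t, continuous (U := C_UniformSpace) F t).
  { intros t. apply continuous_Cmult.
    - apply continuous_Cmult; [apply continuous_Cconst|]. apply continuous_RtoC.
      apply continuous_R_mult; [apply continuous_const|]. apply (continuous_R_comp cos (fun t => t)); [apply continuity_cos|apply continuous_id].
    - apply (continuous_comp (V := R_UniformSpace) (W := C_UniformSpace) sin Q); [|apply HQ].
      apply (continuous_R_comp sin (fun t => t)); [apply continuity_sin|apply continuous_id]. }
  assert (R1 := CInt_reflect F PI 0 PI ltac:(lra) CF).
  rewrite Rminus_diag, Rminus_0_r in R1.
  rewrite (CInt_ext _ (fun t => - (1) * F t)%C) in R1.
  - rewrite CInt_scal in R1 by apply ex_CInt_any, CF.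
    change (CInt F 0 PI = RtoC 0).
    assert (E : (2 * CInt F 0 PI = 0)%C).
    { transitivity (CInt F 0 PI - - (1) * CInt F 0 PI)%C; [ring|]. rewrite R1. ring. }
    apply (f_equal (fun z => / 2 * z)%C) in E.
    transitivity (/ 2 * (2 * CInt F 0 PI))%C; [field|]. rewrite E. ring.
  - lra.
  - intros t _. unfold F. rewrite sin_minus, cos_minus, sin_PI, cos_PI.
    replace (0 * cos t - -1 * sin t) with (sin t) by ring.
    replace (2 * (-1 * cos t + 0 * sin t)) with (- (2 * cos t)) by ring.
    rewrite RtoC_opp. ring.
Qed.

(** After integration over [r] and exchange of integrals, each inner integral is a translate of one
    over the abscissa [x] in [[-4, 4]], up to an error of order [(9 / 10) ^ n]. The semicircles then
    contribute exactly zero, and the diameters a weighted integral of moments that concentrates at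
    [x = 0]. *)
Lemma moment_at_0 : CInt (fun t => G (- t) 0 * kernel a b (- t) (RtoC t))%C (-1) 1 = RtoC 0.
Proof.
  pose proof PI_RGT_0 as HPI.
  (* Here [x = r + t] is the absolute position and [t] the position relative to the centre. *)
  set (g := fun x t => k (x - t) t).
  assert (Cfst : forall p : R * R, continuous fst p) by (intros []; apply continuous_fst).
  assert (Csnd : forall p : R * R, continuous snd p) by (intros []; apply continuous_snd).
  assert (Cg : continuous2 g).
  { intros p. apply (continuous2_comp_2 k (fun p => fst p - snd p) snd); auto; [apply k_continuous|].
    apply continuous_R_minus; auto. }
  assert (E : CInt (fun t => g 0 t) (-1) 1 = RtoC 0).
  2:{ etransitivity; [|exact E]. apply CInt_ext; [lra|]. intros t Ht. unfold g, k.
      rewrite clamp_id, Rminus_0_l by lra.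
      replace (RtoC (- t) + RtoC t)%C with (RtoC 0) by (rewrite RtoC_opp; ring). reflexivity. }
  destruct (bounded2 g (-4) 4 (-1) 1 Cg) as [B1 [B10 HB1]].
  destruct (bounded2 h (-4) 4 0 1 h_continuous) as [B2 [B20 HB2]].
  (* [4 * B1] is the length 2 of the range of [t] times a window error [2 * B1]; [PI * (4 * B2)] is
     the length [PI] times [|2 cos t| <= 2] times [2 * B2]. *)
  apply (peak_concentration g (4 * B1 + PI * (4 * B2)) Cg).
  intros n. set (qn := (9 / 10) ^ n).
  assert (Qn : 0 < qn) by (apply pow_lt; lra).
  set (k2 := fun r t => (k r t * RtoC (peak (r + t) ^ n))%C).
  set (h2 := fun r t => (Ci * RtoC (2 * cos t) * (h (r + cos t)%R (sin t) * pk (r + cos t)%R (sin t) ^ n))%C).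
  set (hp := fun x y => (h x y * pk x y ^ n)%C).
  set (gp := fun x t => (g x t * RtoC (peak x ^ n))%C).
  assert (Cpk : forall x, continuous (U := C_UniformSpace) (fun x => RtoC (peak x ^ n)) x)
    by (intros; apply continuous_RtoC, peak_continuous).
  assert (Chp : continuous2 hp) by (intros p; apply continuous_Cmult; [apply h_continuous|apply (pk_continuous n)]).
  assert (Cgp : continuous2 gp).
  { intros p. apply continuous_Cmult; [apply Cg|].
    apply (continuous_comp (V := R_UniformSpace) (W := C_UniformSpace) fst (fun x => RtoC (peak x ^ n))); auto. }
  assert (Ck2 : continuous2 k2).
  { intros p. apply continuous_Cmult; [apply k_continuous|].
    apply (continuous_comp (V := R_UniformSpace) (W := C_UniformSpace) (fun p : R * R => fst p + snd p) (fun x => RtoC (peak x ^ n))); auto.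
    apply continuous_R_plus; auto. }
  assert (Ccos : forall p : R * R, continuous (fun p => cos (snd p)) p)
    by (intros p; apply continuous_R_comp; [apply continuity_cos|auto]).
  assert (Csin : forall p : R * R, continuous (fun p => sin (snd p)) p)
    by (intros p; apply continuous_R_comp; [apply continuity_sin|auto]).
  assert (Cw : forall p : R * R, continuous (U := C_UniformSpace) (fun p => Ci * RtoC (2 * cos (snd p)))%C p).
  { intros p. apply continuous_Cmult; [apply continuous_Cconst|apply continuous_RtoC].
    apply continuous_R_mult; [apply continuous_const|auto]. }
  assert (Ch2 : continuous2 h2).
  { intros p. apply continuous_Cmult; [apply Cw|].
    apply (continuous2_comp_2 hp (fun p => fst p + cos (snd p)) (fun p => sin (snd p))); auto.
    apply continuous_R_plus; auto. }
  assert (Sum : (CInt (fun t => CInt (fun r => k2 r t) (-3) 3) (-1) 1 +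
                 CInt (fun t => CInt (fun r => h2 r t) (-3) 3) 0 PI = 0)%C).
  { rewrite <- (Fubini_C k2) by (try lra; exact Ck2). rewrite <- (Fubini_C h2) by (try lra; exact Ch2).
    rewrite <- CInt_plus by (apply ex_CInt_any; intros; apply continuous_CInt_param; [lra|assumption]).
    rewrite (CInt_ext _ (fun _ => RtoC 0)).
    - rewrite CInt_const. apply (scal_zero_r (V := C_R_NormedModule)).
    - lra.
    - intros r _. apply (semicircle_identity n r). }
  assert (Hwin : forall t, -1 <= t <= 1 ->
    Cmod (CInt (fun r => k2 r t) (-3) 3 - CInt (fun x => gp x t) (-4) 4)%C <= 2 * (B1 * qn)).
  { intros t Ht. rewrite (CInt_ext (fun r => k2 r t) (fun r => gp (r + t) t)).
    - apply (CInt_shifted_window (fun x => gp x t)); [exact Ht|intros; apply continuous2_l, Cgp|].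
      intros x Hx. unfold gp. rewrite Cmod_mult, Cmod_R.
      assert (-4 <= x <= 4) by (apply Rabs_le_between; lra).
      assert (Hx2 : 4 <= x * x <= 16).
      { replace (x * x) with (Rabs x * Rabs x); [nra|]. rewrite <- Rabs_mult. apply Rabs_pos_eq. nra. }
      assert (P0 : 0 <= peak x <= 9 / 10) by (unfold peak; lra).
      rewrite Rabs_pos_eq by (apply pow_le; lra).
      apply Rmult_le_compat; [apply Cmod_ge_0|apply pow_le; lra|apply HB1; lra|apply pow_incr; lra].
    - lra.
    - intros r _. unfold k2, gp, g. replace (r + t - t) with r by ring. reflexivity. }
  (* On the fixed window the arc integrand depends on [t] only through the height [sin t], apart
     from the factor [cos t]. *)
  set (Q := fun y => CInt (fun x => hp x y) (-4) 4).
  assert (CQ : forall y, continuous (U := C_UniformSpace) Q y).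
  { intros y. apply (continuous_CInt_param (fun y x => hp x y)); [lra|apply continuous2_swap, Chp]. }
  assert (Hwin2 : forall t, 0 <= t <= PI ->
    Cmod (CInt (fun r => h2 r t) (-3) 3 - Ci * RtoC (2 * cos t) * Q (sin t))%C <= 4 * (B2 * qn)).
  { intros t Ht.
    assert (S0 : 0 <= sin t) by (apply sin_ge_0; lra).
    assert (S1 : sin t <= 1) by apply SIN_bound.
    assert (C1 : -1 <= cos t <= 1) by apply COS_bound.
    unfold h2. rewrite (CInt_scal (Ci * RtoC (2 * cos t))%C (fun r => hp (r + cos t) (sin t))).
    2:{ apply ex_CInt_any. intros r. apply (continuous_comp (V := R_UniformSpace) (W := C_UniformSpace) (fun r => r + cos t) (fun x => hp x (sin t))).
        - apply continuous_R_plus; [apply continuous_id|apply continuous_const].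
        - apply continuous2_l, Chp. }
    match goal with |- Cmod (?w * ?x - ?w * ?y)%C <= _ => replace (w * x - w * y)%C with (w * (x - y))%C by ring end.
    rewrite !Cmod_mult, Cmod_Ci, Cmod_R, Rmult_1_l.
    replace (4 * (B2 * qn)) with (2 * (2 * (B2 * qn))) by ring.
    apply Rmult_le_compat; [apply Rabs_pos|apply Cmod_ge_0|apply Rabs_le; lra|].
    apply (CInt_shifted_window (fun x => hp x (sin t))); [exact C1|intros; apply continuous2_l, Chp|].
    intros x Hx. unfold hp. rewrite Cmod_mult, Cmod_pow.
    assert (-4 <= x <= 4) by (apply Rabs_le_between; lra).
    apply Rmult_le_compat; [apply Cmod_ge_0|apply pow_le, Cmod_ge_0|apply HB2; lra|].
    apply pow_incr. split; [apply Cmod_ge_0|]. unfold pk. rewrite clamp_id by lra. apply Cmod_cpeak_le; lra. }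
  assert (Ck2i : forall t, continuous (U := C_UniformSpace) (fun t => CInt (fun r => k2 r t) (-3) 3) t)
    by (apply (continuous_CInt_param (fun t r => k2 r t)); [lra|apply continuous2_swap, Ck2]).
  assert (Ch2i : forall t, continuous (U := C_UniformSpace) (fun t => CInt (fun r => h2 r t) (-3) 3) t)
    by (apply (continuous_CInt_param (fun t r => h2 r t)); [lra|apply continuous2_swap, Ch2]).
  assert (Cgpi : forall t, continuous (U := C_UniformSpace) (fun t => CInt (fun x => gp x t) (-4) 4) t)
    by (apply (continuous_CInt_param (fun t x => gp x t)); [lra|apply continuous2_swap, Cgp]).
  assert (Cwq : forall t, continuous (U := C_UniformSpace) (fun t => Ci * RtoC (2 * cos t) * Q (sin t))%C t).
  { intros t. apply continuous_Cmult.
    - apply continuous_Cmult; [apply continuous_Cconst|]. apply continuous_RtoC.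
      apply continuous_R_mult; [apply continuous_const|]. apply (continuous_R_comp cos (fun t => t)); [apply continuity_cos|apply continuous_id].
    - apply (continuous_comp (V := R_UniformSpace) (W := C_UniformSpace) sin Q); [|apply CQ].
      apply (continuous_R_comp sin (fun t => t)); [apply continuity_sin|apply continuous_id]. }
  set (J1 := CInt (fun t => CInt (fun r => k2 r t) (-3) 3) (-1) 1) in *.
  set (J2 := CInt (fun t => CInt (fun r => h2 r t) (-3) 3) 0 PI) in *.
  change (Cmod (CInt (fun t => CInt (fun x => gp x t) (-4) 4) (-1) 1) <= (4 * B1 + PI * (4 * B2)) * qn).
  set (J := CInt (fun t => CInt (fun x => gp x t) (-4) 4) (-1) 1).
  assert (D1 : Cmod (J1 - J) <= (1 - -1) * (2 * (B1 * qn))).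
  { unfold J1, J. rewrite <- CInt_minus by (apply ex_CInt_any; assumption).
    apply Cmod_CInt_le; [lra| |exact Hwin]. apply ex_CInt_any. intros; apply continuous_Cminus; auto. }
  assert (D2 : Cmod J2 <= (PI - 0) * (4 * (B2 * qn))).
  { replace J2 with (J2 - CInt (fun t => Ci * RtoC (2 * cos t) * Q (sin t)) 0 PI)%C
      by (rewrite (cos_antisymmetric_integral Q CQ); ring).
    unfold J2. rewrite <- CInt_minus by (apply ex_CInt_any; assumption).
    apply Cmod_CInt_le; [lra| |exact Hwin2]. apply ex_CInt_any. intros; apply continuous_Cminus; auto. }
  replace J with (- (J1 - J) + (J1 + J2) + - J2)%C by ring. rewrite Sum.
  replace (- (J1 - J) + 0 + - J2)%C with (- (J1 - J) + - J2)%C by ring.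
  eapply Rle_trans; [apply Cmod_triangle|]. rewrite !Cmod_opp. lra.
Qed.
End Moment.

(** * The extensions on the real axis *)

(** Carries the vanishing of the moment from 0 to an arbitrary real point. *)
Lemma family_translation (f : C -> C) (G : R -> C -> C) (x : R) : extension_family f G ->
  extension_family (fun z => f (RtoC x + z)%C) (fun r z => G (x + r) (RtoC x + z)%C).
Proof.
  intros HG.
  assert (E : forall r z, (RtoC x + z - RtoC (x + r) = z - RtoC r)%C) by (intros; rewrite RtoC_plus; ring).
  split.
  - apply (continuous_on_C_precomp closed_strip); [apply HG|apply continuous_translation|].
    intros [u v] Hz. unfold closed_strip, Im in *; simpl in *. rewrite Rplus_0_l. exact Hz.
  - intros r. apply (continuous_on_C_precomp (closed_unit_disc_at (x + r)));
      [apply (family_continuous f G HG)|apply continuous_translation|].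
    intros z Hz. unfold closed_unit_disc_at in *. rewrite E. exact Hz.
  - intros r z Hz. apply cdiff_translation, (family_cdiff f G HG).
    unfold open_unit_disc_at in *. rewrite E. exact Hz.
  - intros r z Hz. apply (family_boundary f G HG). unfold unit_circle_at in *. rewrite E. exact Hz.
Qed.

Lemma Cmod_conj z : Cmod (Cconj z) = Cmod z.
Proof. unfold Cmod, Cconj; simpl. f_equal. ring. Qed.

Lemma Cconj_minus_real z r : (Cconj z - RtoC r = Cconj (z - RtoC r))%C.
Proof. apply injective_projections; simpl; ring. Qed.

Lemma continuous_on_C_conj (D : C -> Prop) f : continuous_on_C D f -> continuous_on_C D (fun z => Cconj (f z)).
Proof.
  intros Hf z Hz. apply (filterlim_comp _ _ _ f Cconj _ (locally (T := C_UniformSpace) (f z)) _ (Hf z Hz)).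
  apply (continuous_Cconj (T := C_UniformSpace) (fun z => z)), (continuous_id (U := C_UniformSpace)).
Qed.

(** Replaces the argument on the lower half discs: its moments are the conjugates of moments of [G]
    with poles in the lower half plane. *)
Lemma family_conj (f : C -> C) (G : R -> C -> C) : extension_family f G ->
  extension_family (fun z => Cconj (f (Cconj z))) (fun r z => Cconj (G r (Cconj z))).
Proof.
  intros HG.
  assert (Cc : forall z, continuous (T := C_UniformSpace) (U := C_UniformSpace) Cconj z)
    by (intros z; apply (continuous_Cconj (T := C_UniformSpace) (fun z => z)), (continuous_id (U := C_UniformSpace))).
  split.
  - apply (continuous_on_C_conj closed_strip (fun z => f (Cconj z))).
    apply (continuous_on_C_precomp closed_strip); [apply HG|exact Cc|].
    intros z Hz. unfold closed_strip in *. rewrite im_conj, Rabs_Ropp. exact Hz.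
  - intros r. apply (continuous_on_C_conj _ (fun z => G r (Cconj z))).
    apply (continuous_on_C_precomp (closed_unit_disc_at r)); [apply (family_continuous f G HG)|exact Cc|].
    intros z Hz. unfold closed_unit_disc_at in *. rewrite Cconj_minus_real, Cmod_conj. exact Hz.
  - intros r z Hz. apply cdiff_conj, (family_cdiff f G HG).
    unfold open_unit_disc_at in *. rewrite Cconj_minus_real, Cmod_conj. exact Hz.
  - intros r z Hz. rewrite (family_boundary f G HG); [reflexivity|].
    unfold unit_circle_at in *. rewrite Cconj_minus_real, Cmod_conj. exact Hz.
Qed.

(** Through it the identity for slices yields the equality of the masses of all Poisson kernels,
    without computing any integral. *)
Lemma family_const : extension_family (fun _ => 1%C) (fun _ _ => 1%C).
Proof.
  split; intros; try apply cdiff_const; try reflexivity;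
    apply continuous_on_C_of_continuous; intros; apply continuous_Cconst.
Qed.

Lemma CInt_conj (f : R -> C) a b : ex_RInt (V := C_R_CompleteNormedModule) f a b ->
  CInt (fun t => Cconj (f t)) a b = Cconj (CInt f a b).
Proof.
  intros H. destruct (CInt_components f a b H) as [H1 [H2 E]]. rewrite E.
  apply (is_RInt_unique (V := C_R_CompleteNormedModule)). apply is_CInt_pair; simpl.
  - apply (RInt_correct (V := R_CompleteNormedModule)), H1.
  - apply (is_RInt_opp (V := R_NormedModule)), (RInt_correct (V := R_CompleteNormedModule)), H2.
Qed.

Lemma Cconj_mult z w : (Cconj (z * w) = Cconj z * Cconj w)%C.
Proof. apply injective_projections; simpl; ring. Qed.

Lemma Cconj_plus z w : (Cconj (z + w) = Cconj z + Cconj w)%C.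
Proof. apply injective_projections; simpl; ring. Qed.

Lemma Cconj_opp z : (Cconj (- z) = - Cconj z)%C.
Proof. apply injective_projections; simpl; ring. Qed.

Lemma Cconj_inv z : (Cconj (/ z) = / Cconj z)%C.
Proof.
  apply injective_projections; simpl; unfold Rdiv; [f_equal; f_equal; ring|].
  replace (- snd z * (- snd z * 1)) with (snd z * (snd z * 1)) by ring. ring.
Qed.

Lemma Cconj_R x : Cconj (RtoC x) = RtoC x.
Proof. apply injective_projections; simpl; ring. Qed.

Lemma Cconj_conj z : Cconj (Cconj z) = z.
Proof. apply injective_projections; simpl; ring. Qed.

Lemma kernel_conj a b r t : Cconj (kernel a b r (RtoC t)) = kernel (Cconj a) (Cconj b) r (RtoC t).
Proof.
  unfold kernel, Cdiv, Cminus.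
  rewrite !Cconj_mult, !Cconj_plus, Cconj_inv, !Cconj_mult, !Cconj_plus, !Cconj_mult, !Cconj_plus, !Cconj_opp, !Cconj_R.
  reflexivity.
Qed.

(* Twice the Poisson kernel of the upper half plane at [s + i al], in the real variable [w = 1 / t - t]
   and multiplied by [|dw / dt|]. *)
Definition poisson (s al t : R) : R :=
  2 * al * (t * t + 1) / ((t * t + s * t - 1) * (t * t + s * t - 1) + al * al * (t * t)).

Lemma poisson_den_pos s al t : 0 < al ->
  0 < (t * t + s * t - 1) * (t * t + s * t - 1) + al * al * (t * t).
Proof.
  intros Hal.
  assert (0 <= (t * t + s * t - 1) * (t * t + s * t - 1)) by apply Rle_0_sqr.
  destruct (Req_dec t 0) as [->|Ht]; [nra|].
  assert (0 < t * t) by nra. assert (0 < al * al) by nra.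
  assert (0 < al * al * (t * t)) by (apply Rmult_lt_0_compat; assumption). lra.
Qed.

Lemma poisson_pos s al t : 0 < al -> 0 < poisson s al t.
Proof.
  intros Hal. apply Rdiv_lt_0_compat; [|apply poisson_den_pos, Hal].
  apply Rmult_lt_0_compat; [lra|]. generalize (Rle_0_sqr t). unfold Rsqr. lra.
Qed.

Lemma poisson_continuous s al t : 0 < al -> continuous (fun t => poisson s al t) t.
Proof.
  intros Hal. apply (ex_derive_continuous (V := R_NormedModule)). unfold poisson. auto_derive.
  generalize (poisson_den_pos s al t Hal). lra.
Qed.

(** Up to the derivative of [w], [(a - b) / ((w - a) (w - b))] is [1 / (w - a) - 1 / (w - b)]. For
    real [w], subtracting the same expression with conjugate poles leaves a difference of imaginary
    parts. *)
Lemma poisson_kernel s al s' al' t : 0 < al -> 0 < al' ->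
  let a : C := (s, al) in let b : C := (s', al') in
  ((a - b) * kernel a b (- t)%R (RtoC t) - (Cconj a - Cconj b) * kernel (Cconj a) (Cconj b) (- t)%R (RtoC t)
   = Ci * RtoC (poisson s al t) - Ci * RtoC (poisson s' al' t))%C.
Proof.
  intros Hal Hal' a b.
  assert (Hn : forall s al, 0 < al -> ((RtoC (- t) - (s, al)) * RtoC t + 1)%C <> 0%C /\
                                      ((RtoC (- t) - Cconj (s, al)) * RtoC t + 1)%C <> 0%C).
  { intros u v Hv.
    assert (N : ((RtoC (- t) - (u, v)) * RtoC t + 1)%C <> 0%C)
      by (apply kernel_factor_neq_0; [exact Hv|apply Rle_refl]).
    split; [exact N|]. intros E. apply N.
    apply (f_equal Cconj) in E.
    unfold Cminus in E. rewrite Cconj_plus, Cconj_mult, Cconj_plus, Cconj_opp, Cconj_conj, !Cconj_R in E. exact E. }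
  (* The Poisson kernel is itself a kernel with the two poles [s + i al] and its conjugate. *)
  assert (HP : forall s al, 0 < al -> (Ci * RtoC (poisson s al t) =
    ((s, al) - Cconj (s, al)) * (RtoC t * RtoC t + 1) /
      (((RtoC (- t) - (s, al)) * RtoC t + 1) * ((RtoC (- t) - Cconj (s, al)) * RtoC t + 1)))%C).
  { intros u v Hv. destruct (Hn u v Hv) as [N1 N2]. pose proof (poisson_den_pos u v t Hv) as DP.
    unfold poisson. set (d := (t * t + u * t - 1) * (t * t + u * t - 1) + v * v * (t * t)) in *.
    assert (Ed : (((RtoC (- t) - (u, v)) * RtoC t + 1) * ((RtoC (- t) - Cconj (u, v)) * RtoC t + 1) = RtoC d)%C).
    { unfold d. apply injective_projections; simpl; ring. }
    rewrite Ed. rewrite RtoC_div by lra.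
    assert (En : ((u, v) - Cconj (u, v) = Ci * RtoC (2 * v))%C) by (apply injective_projections; simpl; ring).
    rewrite En, !RtoC_mult, RtoC_plus, !RtoC_mult. field.
    intros E. apply RtoC_inj in E. lra. }
  unfold a, b. rewrite (HP s al Hal), (HP s' al' Hal'). unfold kernel.
  destruct (Hn s al Hal) as [N1 N2]. destruct (Hn s' al' Hal') as [N3 N4].
  set (A := (s, al) : C) in *. set (B := (s', al') : C) in *. set (A' := Cconj A) in *. set (B' := Cconj B) in *.
  clearbody A B A' B'. rewrite RtoC_opp in *. field. repeat split; assumption.
Qed.

Section RealPoints.
Variables (f : C -> C) (G : R -> C -> C).
Hypothesis HG : extension_family f G.

(** With [r = x - t], the value at [x] is [G r (r + t)], which is jointly continuous in [r] and
    [t]. *)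
Lemma slice_continuous (x : R) : forall t,
  continuous (U := C_UniformSpace) (fun t => G (x - clamp (-1) 1 t)%R (RtoC x)) t.
Proof.
  intros t.
  apply (continuous_ext (T := R_UniformSpace) (U := C_UniformSpace)
    (fun t => G (x - clamp (-1) 1 t) (RtoC (x - clamp (-1) 1 t) + RtoC (clamp (-1) 1 t)))%C).
  - intros u. rewrite RtoC_minus. f_equal. ring.
  - apply (continuous_comp_2 (V := R_UniformSpace) (W := R_UniformSpace) (X := C_UniformSpace)
      (fun t => x - clamp (-1) 1 t) (fun t => t) (fun r t => G r (RtoC r + RtoC (clamp (-1) 1 t))%C)).
    + apply continuous_R_minus; [apply continuous_const|apply continuous_clamp, continuous_id].
    + apply continuous_id.
    + apply (family_real_continuous f G HG (x - clamp (-1) 1 t, t)).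
Qed.

Lemma kernel_real_continuous a b t : 0 < Im a -> 0 < Im b ->
  continuous (U := C_UniformSpace) (fun t => kernel a b (- t)%R (RtoC t)) t.
Proof.
  intros Ha Hb. unfold kernel.
  assert (C1 : continuous (U := C_UniformSpace) (fun t => RtoC t) t) by apply continuous_RtoC, continuous_id.
  assert (C2 : continuous (U := C_UniformSpace) (fun t => RtoC (- t)) t) by (apply continuous_RtoC, continuous_R_opp, continuous_id).
  apply continuous_Cdiv.
  - apply Cmult_neq_0; apply kernel_factor_neq_0; try assumption; apply Rle_refl.
  - apply continuous_Cplus; [apply continuous_Cmult; exact C1|apply continuous_Cconst].
  - apply continuous_Cmult; (apply continuous_Cplus; [apply continuous_Cmult; [|exact C1]|apply continuous_Cconst]);
      (apply continuous_Cminus; [exact C2|apply continuous_Cconst]).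
Qed.
End RealPoints.

Lemma slice_moment f G (x : R) a b : extension_family f G -> 0 < Im a -> 0 < Im b ->
  CInt (fun t => G (x - clamp (-1) 1 t)%R (RtoC x) * kernel a b (- t)%R (RtoC t))%C (-1) 1 = RtoC 0.
Proof.
  intros HG Ha Hb.
  rewrite <- (moment_at_0 _ _ a b (family_translation f G x HG) Ha Hb).
  apply CInt_ext; [lra|]. intros t Ht. rewrite clamp_id by lra.
  rewrite Cplus_0_r. reflexivity.
Qed.

(** Combines the moment of [G] for [a], [b] with that of the conjugate family, which supplies the
    conjugate poles. *)
Lemma slice_poisson f G (x s al s' al' : R) : extension_family f G -> 0 < al -> 0 < al' ->
  CInt (fun t => G (x - clamp (-1) 1 t)%R (RtoC x) * RtoC (poisson s al t))%C (-1) 1 =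
  CInt (fun t => G (x - clamp (-1) 1 t)%R (RtoC x) * RtoC (poisson s' al' t))%C (-1) 1.
Proof.
  intros HG Hal Hal'.
  set (a := (s, al) : C). set (b := (s', al') : C).
  set (g := fun t => G (x - clamp (-1) 1 t)%R (RtoC x)).
  assert (Cg : forall t, continuous (U := C_UniformSpace) g t) by apply (slice_continuous f G HG x).
  assert (Ck : forall t, continuous (U := C_UniformSpace) (fun t => kernel a b (- t)%R (RtoC t)) t)
    by (intros; apply kernel_real_continuous; assumption).
  assert (Ck' : forall t, continuous (U := C_UniformSpace) (fun t => kernel (Cconj a) (Cconj b) (- t)%R (RtoC t)) t).
  { intros t. apply (continuous_ext (T := R_UniformSpace) (U := C_UniformSpace) (fun t => Cconj (kernel a b (- t)%R (RtoC t)))).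
    - intros u. apply kernel_conj.
    - apply continuous_Cconj, Ck. }
  assert (Cp : forall s al, 0 < al -> forall t, continuous (U := C_UniformSpace) (fun t => RtoC (poisson s al t)) t)
    by (intros; apply continuous_RtoC, poisson_continuous; assumption).
  assert (M1 : CInt (fun t => g t * kernel a b (- t)%R (RtoC t))%C (-1) 1 = RtoC 0)
    by (apply (slice_moment f G x a b HG); assumption).
  assert (M2 : CInt (fun t => g t * kernel (Cconj a) (Cconj b) (- t)%R (RtoC t))%C (-1) 1 = RtoC 0).
  { pose proof (slice_moment _ _ x a b (family_conj f G HG) Hal Hal') as M.
    rewrite (CInt_ext _ (fun t => Cconj (g t * kernel (Cconj a) (Cconj b) (- t)%R (RtoC t)))%C) in M.
    - rewrite CInt_conj in M by (apply ex_CInt_any; intros; apply continuous_Cmult; auto).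
      apply (f_equal Cconj) in M. rewrite Cconj_conj, Cconj_R in M. exact M.
    - lra.
    - intros t _. rewrite Cconj_mult, kernel_conj, !Cconj_conj, Cconj_R. reflexivity. }
  apply Ceq_minus.
  rewrite <- CInt_minus by (apply ex_CInt_any; intros; apply continuous_Cmult; auto).
  (* The factor [- Ci] removes the [Ci] in front of the Poisson kernels. *)
  rewrite (CInt_ext _ (fun t => - Ci * ((a - b) * (g t * kernel a b (- t)%R (RtoC t)) -
     (Cconj a - Cconj b) * (g t * kernel (Cconj a) (Cconj b) (- t)%R (RtoC t))))%C).
  - assert (Cm1 : forall t, continuous (U := C_UniformSpace) (fun t => (a - b) * (g t * kernel a b (- t)%R (RtoC t)))%C t)
      by (intros; apply continuous_Cmult; [apply continuous_Cconst|apply continuous_Cmult; auto]).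
    assert (Cm2 : forall t, continuous (U := C_UniformSpace) (fun t => (Cconj a - Cconj b) * (g t * kernel (Cconj a) (Cconj b) (- t)%R (RtoC t)))%C t)
      by (intros; apply continuous_Cmult; [apply continuous_Cconst|apply continuous_Cmult; auto]).
    rewrite CInt_scal by (apply ex_CInt_any; intros; apply continuous_Cminus; auto).
    rewrite CInt_minus by (apply ex_CInt_any; auto).
    rewrite !CInt_scal by (apply ex_CInt_any; intros; apply continuous_Cmult; auto).
    rewrite M1, M2. ring.
  - lra.
  - intros t _. pose proof (poisson_kernel s al s' al' t Hal Hal') as PK. cbv zeta in PK.
    fold a b in PK. change (fun t => G (x - clamp (-1) 1 t)%R (RtoC x)) with g. change (G (x - clamp (-1) 1 t)%R (RtoC x)) with (g t).
    replace (- Ci * ((a - b) * (g t * kernel a b (- t)%R (RtoC t)) -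
     (Cconj a - Cconj b) * (g t * kernel (Cconj a) (Cconj b) (- t)%R (RtoC t))))%C
      with (- Ci * g t * ((a - b) * kernel a b (- t)%R (RtoC t) - (Cconj a - Cconj b) * kernel (Cconj a) (Cconj b) (- t)%R (RtoC t)))%C by ring.
    rewrite PK.
    assert (I2 : (Ci * Ci = - (1))%C) by (apply injective_projections; simpl; ring).
    transitivity (- (Ci * Ci) * (g t * RtoC (poisson s al t) - g t * RtoC (poisson s' al' t)))%C; [rewrite I2|]; ring.
Qed.

Lemma poisson_mass s al s' al' : 0 < al -> 0 < al' ->
  RInt (poisson s al) (-1) 1 = RInt (poisson s' al') (-1) 1.
Proof.
  intros Hal Hal'. pose proof (slice_poisson _ _ 0 s al s' al' family_const Hal Hal') as E. cbv beta in E.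
  assert (EE : forall s al, 0 < al -> CInt (fun t => 1 * RtoC (poisson s al t))%C (-1) 1 = RtoC (RInt (poisson s al) (-1) 1)).
  { intros u v Hv. rewrite (CInt_ext _ (fun t => RtoC (poisson u v t))) by (try lra; intros; ring).
    apply (is_RInt_unique (V := C_R_CompleteNormedModule)). apply is_CInt_pair; simpl.
    - apply (RInt_correct (V := R_CompleteNormedModule)), (ex_RInt_continuous (V := R_CompleteNormedModule)).
      intros; apply poisson_continuous, Hv.
    - evar_last; [apply (is_RInt_const (V := R_NormedModule))|]. apply (scal_zero_r (V := R_NormedModule)). }
  rewrite !EE in E by assumption. apply RtoC_inj, E.
Qed.

(* As [al -> 0] the kernels concentrate at the root [t0] of [t^2 + s t - 1]. *)
Lemma poisson_concentration (g : R -> C) (c : C) :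
  (forall t, continuous (U := C_UniformSpace) g t) ->
  (forall s al, 0 < al -> CInt (fun t => g t * RtoC (poisson s al t))%C (-1) 1 =
     (c * RtoC (RInt (poisson s al) (-1) 1))%C) ->
  forall t0, -1 < t0 < 1 -> t0 <> 0 -> g t0 = c.
Proof.
  intros Cg Hg t0 Ht0 Hn0.
  set (m := RInt (poisson 0 1) (-1) 1).
  assert (Ep : forall s al, 0 < al -> ex_RInt (poisson s al) (-1) 1).
  { intros. apply (ex_RInt_continuous (V := R_CompleteNormedModule)). intros; apply poisson_continuous; assumption. }
  assert (Hm : 0 < m).
  { apply RInt_gt_0; [lra|intros; apply poisson_pos; lra|intros; apply poisson_continuous; lra]. }
  assert (Mass : forall s al, 0 < al -> RInt (poisson s al) (-1) 1 = m) by (intros; apply poisson_mass; lra).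
  (* This makes [t0] a root of [t^2 + s t - 1]; the other root is [- 1 / t0]. *)
  set (s := (1 - t0 * t0) / t0).
  assert (Ha0 : 0 < Rabs t0 < 1) by (split; [apply Rabs_pos_lt, Hn0|apply Rabs_def1; lra]).
  (* A lower bound on [[-1, 1]] for the distance to the other root, positive because [|t0| < 1]. *)
  set (ka := / Rabs t0 - 1).
  assert (Hka : 0 < ka).
  { unfold ka. assert (1 < / Rabs t0); [|lra]. rewrite <- Rinv_1. apply Rinv_lt_contravar; lra. }
  assert (Fac : forall t, -1 <= t <= 1 -> (t - t0) * (t - t0) * (ka * ka) <= (t * t + s * t - 1) * (t * t + s * t - 1)).
  { intros t Ht. replace (t * t + s * t - 1) with ((t - t0) * (t + / t0)) by (unfold s; field; exact Hn0).
    replace ((t - t0) * (t + / t0) * ((t - t0) * (t + / t0))) with ((t - t0) * (t - t0) * ((t + / t0) * (t + / t0))) by ring.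
    apply Rmult_le_compat_l; [apply Rle_0_sqr|].
    assert (K : ka <= Rabs (t + / t0)).
    { unfold ka. rewrite <- Rabs_inv. assert (Rabs t <= 1) by (apply Rabs_le; lra).
      generalize (Rabs_triang_inv (/ t0) (- t)). rewrite Rabs_Ropp. replace (/ t0 - - t) with (t + / t0) by ring. lra. }
    replace ((t + / t0) * (t + / t0)) with (Rabs (t + / t0) * Rabs (t + / t0)).
    - apply Rmult_le_compat; lra.
    - rewrite <- Rabs_mult. apply Rabs_pos_eq, Rle_0_sqr. }
  destruct (bounded1 g (-1) 1) as [B [B0 HB]]; [intros; apply Cg|].
  apply Ceq_minus, Cmod_eq_0, Rle_antisym; [|apply Cmod_ge_0].
  apply le_epsilon. intros eps He. rewrite Rplus_0_l.
  assert (He2 : 0 < eps / 2) by lra.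
  destruct (proj1 (continuous_C_iff g t0) (Cg t0) (mkposreal _ He2)) as [d Hd]. simpl in Hd.
  set (D := d * d * (ka * ka)).
  assert (HD : 0 < D) by (unfold D; destruct d as [d Hd0]; simpl; repeat apply Rmult_lt_0_compat; lra).
  (* Makes the contribution [16 * B * al / D] of the points far from [t0] equal to [eps / 2 * m]. *)
  set (al := eps * m * D / (32 * B)).
  assert (Hal : 0 < al).
  { unfold al. apply Rdiv_lt_0_compat; [|lra]. apply Rmult_lt_0_compat; [apply Rmult_lt_0_compat; lra|exact HD]. }
  assert (Cp : forall t, continuous (U := C_UniformSpace) (fun t => RtoC (poisson s al t)) t)
    by (intros; apply continuous_RtoC, poisson_continuous, Hal).
  assert (Em : CInt (fun t => RtoC (poisson s al t)) (-1) 1 = RtoC m).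
  { rewrite <- (Mass s al Hal). apply (is_RInt_unique (V := C_R_CompleteNormedModule)). apply is_CInt_pair; simpl.
    - apply (RInt_correct (V := R_CompleteNormedModule)), Ep, Hal.
    - evar_last; [apply (is_RInt_const (V := R_NormedModule))|]. apply (scal_zero_r (V := R_NormedModule)). }
  assert (Eq : (RtoC m * (g t0 - c) = CInt (fun t => g t0 * RtoC (poisson s al t) - g t * RtoC (poisson s al t)) (-1) 1)%C).
  { rewrite CInt_minus by (apply ex_CInt_any; intros; apply continuous_Cmult; auto; apply continuous_Cconst).
    rewrite Hg, CInt_scal, Em, Mass by (try exact Hal; apply ex_CInt_any; assumption). ring. }
  assert (Bd : Cmod (RtoC m * (g t0 - c)) <= eps / 2 * m + 16 * B * al / D).
  { rewrite Eq, <- norm_C_R.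
    replace (eps / 2 * m + 16 * B * al / D) with (RInt (fun t => eps / 2 * poisson s al t + 8 * B * al / D) (-1) 1).
    2:{ apply is_RInt_unique. evar_last.
        - apply (is_RInt_plus (V := R_NormedModule)); [|apply (is_RInt_const (V := R_NormedModule))].
          apply (is_RInt_scal (V := R_NormedModule)), (RInt_correct (V := R_CompleteNormedModule)), Ep, Hal.
        - unfold plus, scal; simpl. unfold mult; simpl. rewrite Mass by exact Hal. field. lra. }
    apply (norm_RInt_le (V := C_R_NormedModule)
      (fun t => g t0 * RtoC (poisson s al t) - g t * RtoC (poisson s al t))%C
      (fun t => eps / 2 * poisson s al t + 8 * B * al / D) (-1) 1); [lra| | |].
    - intros t Ht. rewrite norm_C_R.
      replace (g t0 * RtoC (poisson s al t) - g t * RtoC (poisson s al t))%C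
        with (- (g t - g t0) * RtoC (poisson s al t))%C by ring.
      pose proof (poisson_pos s al t Hal) as PP.
      rewrite Cmod_mult, Cmod_opp, Cmod_R, (Rabs_pos_eq (poisson s al t)) by lra.
      assert (0 < 8 * B * al / D).
      { apply Rdiv_lt_0_compat; [|exact HD]. apply Rmult_lt_0_compat; [lra|exact Hal]. }
      destruct (Rlt_dec (Rabs (t - t0)) d) as [Hc|Hc].
      + assert (Cmod (g t - g t0) < eps / 2) by (apply Hd; exact Hc). nra.
      + assert (Hp : poisson s al t <= 4 * al / D).
        { unfold poisson. apply Rmult_le_compat.
          - apply Rmult_le_pos; [lra|]. generalize (Rle_0_sqr t). unfold Rsqr. lra.
          - apply Rlt_le, Rinv_0_lt_compat, poisson_den_pos, Hal.
          - assert (t * t <= 1) by nra. nra.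
          - apply Rinv_le_contravar; [exact HD|]. specialize (Fac t Ht).
            assert (d * d <= (t - t0) * (t - t0)).
            { apply Rnot_lt_le in Hc. replace ((t - t0) * (t - t0)) with (Rabs (t - t0) * Rabs (t - t0)).
              - destruct d as [d Hd0]; simpl in *. apply Rmult_le_compat; lra.
              - rewrite <- Rabs_mult. apply Rabs_pos_eq, Rle_0_sqr. }
            assert (D <= (t - t0) * (t - t0) * (ka * ka)) by (unfold D; apply Rmult_le_compat_r; [apply Rle_0_sqr|assumption]).
            assert (0 <= al * al * (t * t)) by (apply Rmult_le_pos; apply Rle_0_sqr). lra. }
        assert (Cmod (g t - g t0) <= 2 * B).
        { unfold Cminus. eapply Rle_trans; [apply Cmod_triangle|]. rewrite Cmod_opp.
          generalize (HB t Ht) (HB t0 ltac:(lra)). lra. }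
        assert (0 <= eps / 2 * poisson s al t) by (apply Rmult_le_pos; lra).
        apply Rle_trans with (2 * B * (4 * al / D)).
        * apply Rmult_le_compat; try assumption; [apply Cmod_ge_0|lra].
        * replace (2 * B * (4 * al / D)) with (8 * B * al / D) by (field; lra). lra.
    - apply (RInt_correct (V := C_R_CompleteNormedModule)), ex_CInt_any.
      intros t. apply continuous_Cminus.
      + apply continuous_Cmult; [apply continuous_Cconst|apply Cp].
      + apply continuous_Cmult; [apply Cg|apply Cp].
    - apply (RInt_correct (V := R_CompleteNormedModule)), (ex_RInt_continuous (V := R_CompleteNormedModule)).
      intros t _. apply continuous_R_plus; [|apply continuous_const].
      apply continuous_R_mult; [apply continuous_const|apply poisson_continuous, Hal]. }
  rewrite Cmod_mult, Cmod_R, Rabs_pos_eq in Bd by lra.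
  replace (16 * B * al / D) with (eps / 2 * m) in Bd by (unfold al; field; lra).
  apply Rmult_le_reg_l with m; lra.
Qed.

(** The slice at [x] is constant away from [t = 0], where [w] is infinite, and from the ends [t = 1]
    and [t = -1]; continuity fills in these points. At [t = 1] the point [x] lies on the circle of
    centre [x - 1], so the constant is [f x]. *)
Lemma family_real_points f G : extension_family f G ->
  forall r x, Rabs (x - r) <= 1 -> G r (RtoC x) = f (RtoC x).
Proof.
  intros HG r x Hrx. apply Rabs_le_between in Hrx.
  set (g := fun t => G (x - clamp (-1) 1 t)%R (RtoC x)).
  assert (Cg : forall t, continuous (U := C_UniformSpace) g t) by apply (slice_continuous f G HG x).
  set (m := RInt (poisson 0 1) (-1) 1).
  assert (Hm : 0 < m).
  { apply RInt_gt_0; [lra|intros; apply poisson_pos; lra|intros; apply poisson_continuous; lra]. }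
  set (c := (CInt (fun t => g t * RtoC (poisson 0 1 t)) (-1) 1 / RtoC m)%C).
  assert (Hint : forall t, -1 < t < 1 -> t <> 0 -> g t = c).
  { apply poisson_concentration; [exact Cg|]. intros s al Hal.
    rewrite (poisson_mass s al 0 1 Hal Rlt_0_1). fold m.
    transitivity (CInt (fun t => g t * RtoC (poisson 0 1 t))%C (-1) 1).
    - apply (slice_poisson f G x s al 0 1 HG Hal Rlt_0_1).
    - unfold c. field. intros E. apply RtoC_inj in E. lra. }
  assert (G1 : g 1 = c).
  { apply (continuous_left_eq g (fun _ => c)); [apply Cg|apply continuous_Cconst|].
    intros s Hs. apply Hint; lra. }
  assert (G0 : g 0 = c).
  { replace 0 with (1 - 1) by ring.
    apply (continuous_left_eq (fun s => g (1 - s)) (fun _ => c)); [apply continuous_comp_sub, Cg|apply continuous_Cconst|].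
    intros s Hs. apply Hint; lra. }
  assert (Gm : g (-1) = c).
  { apply (continuous_left_eq (fun s => g (- s)) (fun _ => c)); [|apply continuous_Cconst|].
    - apply (continuous_comp (V := R_UniformSpace) (W := C_UniformSpace) Ropp g); [apply continuous_R_opp, continuous_id|apply Cg].
    - intros s Hs. apply Hint; lra. }
  assert (Hall : forall t, -1 <= t <= 1 -> g t = c).
  { intros t Ht. destruct (Req_dec t 0) as [->|N0]; [exact G0|].
    destruct (Req_dec t 1) as [->|N1]; [exact G1|].
    destruct (Req_dec t (-1)) as [->|N2]; [exact Gm|]. apply Hint; [lra|exact N0]. }
  transitivity (g (x - r)).
  - unfold g. rewrite clamp_id by lra. f_equal. ring.
  - rewrite Hall by lra. rewrite <- G1. unfold g. rewrite clamp_id by lra.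
    apply (family_boundary f G HG). unfold unit_circle_at.
    rewrite <- RtoC_minus, Cmod_R. replace (x - (x - 1)) with 1 by ring. apply Rabs_R1.
Qed.

(** * Gluing *)

Section Gluing.
Variables (f : C -> C) (G : R -> C -> C).
Hypothesis HG : extension_family f G.

(** The hypothesis describes the largest disc centred on the axis and contained in both discs. On
    its diameter both extensions equal [f], and the identity theorem applies after rescaling. *)
Lemma family_agree r r' z : Cmod (z - RtoC ((r + r') / 2)) < 1 - Rabs (r - r') / 2 -> G r z = G r' z.
Proof.
  set (c := (r + r') / 2). set (rho := 1 - Rabs (r - r') / 2). intros Hz.
  assert (Hrho : 0 < rho) by (generalize (Cmod_ge_0 (z - RtoC c)); lra).
  assert (Hdist : forall s, s = r \/ s = r' -> Rabs (c - s) <= 1 - rho).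
  { intros s Hs. unfold c, rho.
    destruct Hs as [-> | ->]; unfold Rabs; repeat destruct (Rcase_abs _); lra. }
  assert (Hin : forall s w, s = r \/ s = r' -> Cmod (RtoC c + RtoC rho * w - RtoC s) <= 1 - rho + rho * Cmod w).
  { intros s w Hs. replace (RtoC c + RtoC rho * w - RtoC s)%C with (RtoC (c - s) + RtoC rho * w)%C
      by (rewrite RtoC_minus; ring).
    eapply Rle_trans; [apply Cmod_triangle|]. rewrite Cmod_mult, !Cmod_R, (Rabs_pos_eq rho) by lra.
    generalize (Hdist s Hs). lra. }
  assert (Caff : forall w, continuous (T := C_UniformSpace) (U := C_UniformSpace) (fun w => RtoC c + RtoC rho * w)%C w).
  { intros w. apply continuous_Cplus; [apply continuous_Cconst|].
    apply continuous_Cmult; [apply continuous_Cconst|apply (continuous_id (U := C_UniformSpace))]. }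
  assert (Cont : forall s, s = r \/ s = r' -> continuous_on_C unit_disc (fun w => G s (RtoC c + RtoC rho * w)%C)).
  { intros s Hs. apply (continuous_on_C_precomp (closed_unit_disc_at s)); [apply (family_continuous f G HG)|exact Caff|].
    intros w Hw. unfold unit_disc in Hw. unfold closed_unit_disc_at.
    eapply Rle_trans; [apply Hin, Hs|]. nra. }
  assert (Diff : forall s w, s = r \/ s = r' -> Cmod w < 1 -> cdiff (fun w => G s (RtoC c + RtoC rho * w)%C) w).
  { intros s w Hs Hw. apply (cdiff_comp (G s) (fun w => RtoC c + RtoC rho * w)%C).
    - apply (family_cdiff f G HG). unfold open_unit_disc_at.
      eapply Rle_lt_trans; [apply Hin, Hs|]. nra.
    - apply cdiff_plus; [apply cdiff_const|]. apply cdiff_mult; [apply cdiff_const|apply cdiff_id]. }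
  assert (Hr0 : RtoC rho <> 0%C) by (intros E; apply RtoC_inj in E; lra).
  assert (E := disc_identity (fun w => G r (RtoC c + RtoC rho * w) + - (1) * G r' (RtoC c + RtoC rho * w))%C).
  specialize (fun H1 H2 H3 => E H1 H2 H3 ((z - RtoC c) / RtoC rho)%C). cbv beta in E.
  replace (RtoC c + RtoC rho * ((z - RtoC c) / RtoC rho))%C with z in E by (field; exact Hr0).
  apply Ceq_minus. rewrite <- E.
  - ring.
  - apply continuous_on_C_plus; [apply Cont; auto|].
    apply continuous_on_C_mult; [|apply Cont; auto].
    apply continuous_on_C_of_continuous. intros; apply continuous_Cconst.
  - intros w Hw. apply cdiff_plus; [apply Diff; auto|]. apply cdiff_mult; [apply cdiff_const|apply Diff; auto].
  - intros t Ht. rewrite <- RtoC_mult, <- RtoC_plus.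
    assert (Hreal : forall s, s = r \/ s = r' -> G s (RtoC (c + rho * t)) = f (RtoC (c + rho * t))).
    { intros s Hs. apply (family_real_points f G HG). generalize (Hin s (RtoC t) Hs).
      rewrite <- RtoC_mult, <- RtoC_plus, <- RtoC_minus, !Cmod_R.
      assert (Rabs t <= 1) by (apply Rabs_le; lra). nra. }
    rewrite !Hreal by auto. ring.
  - rewrite Cmod_div, Cmod_R, (Rabs_pos_eq rho) by (exact Hr0 || lra).
    apply Rmult_lt_reg_r with rho; [exact Hrho|]. unfold Rdiv. rewrite Rmult_assoc, Rinv_l by lra. lra.
Qed.

(** For [|s - r| < 1 - |z - r|] the point lies in the common disc of the centres [r] and [s].
    Stating this as a zero derivative lets integration give constancy along an interval of
    centres. *)
Lemma family_locally_constant z r : Cmod (z - RtoC r) < 1 ->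
  is_derive (V := C_R_NormedModule) (fun s => G s z) r (RtoC 0).
Proof.
  intros Hz. apply (is_derive_ext_loc (V := C_R_NormedModule) (fun _ => G r z)); [|apply is_derive_Cconst].
  assert (Hd : 0 < 1 - Cmod (z - RtoC r)) by lra.
  exists (mkposreal _ Hd). intros s Hs. change (Rabs (s - r) < 1 - Cmod (z - RtoC r)) in Hs.
  apply family_agree. rewrite (Rabs_minus_sym r s).
  replace (z - RtoC ((r + s) / 2))%C with ((z - RtoC r) + RtoC (- ((s - r) / 2)))%C.
  - eapply Rle_lt_trans; [apply Cmod_triangle|].
    rewrite Cmod_R, Rabs_Ropp. unfold Rdiv at 1. rewrite Rabs_mult, (Rabs_pos_eq (/ 2)) by lra. lra.
  - replace ((r + s) / 2) with (r + (s - r) / 2) by field. rewrite RtoC_plus, RtoC_opp. ring.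
Qed.

(** The centre is moved left from [r0], with the value at [z] unchanged, until the circle passes
    through [z], where the extension is [f]. *)
Lemma family_interior r0 z : Cmod (z - RtoC r0) < 1 -> f z = G r0 z.
Proof.
  intros Hz. destruct z as [x y].
  assert (Hsq : forall r, Cmod ((x, y) - RtoC r) * Cmod ((x, y) - RtoC r) = (x - r) * (x - r) + y * y).
  { intros r. rewrite <- Cmod_sqr. unfold Re, Im; simpl. ring. }
  assert (H0 := Hsq r0). assert (P0 := Cmod_ge_0 ((x, y) - RtoC r0)).
  assert (Hy : (x - r0) * (x - r0) + y * y < 1) by nra.
  assert (Sx := Rle_0_sqr (x - r0)). unfold Rsqr in Sx.
  set (w := sqrt (1 - y * y)).
  assert (Hw : w * w = 1 - y * y) by (apply sqrt_sqrt; lra).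
  assert (Hw0 : 0 <= w) by apply sqrt_pos.
  (* The leftmost centre whose circle contains [z]: [w] is half the chord of the unit circle at
     height [y]. *)
  set (r1 := x - w).
  assert (Hr1 : r1 < r0) by (unfold r1; nra).
  assert (Hr2 : r0 < x + w) by nra.
  assert (Hin : forall r, r1 < r <= r0 -> Cmod ((x, y) - RtoC r) < 1).
  { intros r Hr. specialize (Hsq r). pose proof (Cmod_ge_0 ((x, y) - RtoC r)).
    unfold r1 in Hr. assert ((x - r) * (x - r) < w * w) by nra. nra. }
  assert (Hon : Cmod ((x, y) - RtoC r1) = 1).
  { specialize (Hsq r1). pose proof (Cmod_ge_0 ((x, y) - RtoC r1)).
    unfold r1 in Hsq at 3 4. assert (Cmod ((x, y) - RtoC r1) * Cmod ((x, y) - RtoC r1) = 1) by (rewrite Hsq; nra). nra. }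
  assert (Hconst : forall r, r1 < r <= r0 -> G r0 (x, y) = G r (x, y)).
  { intros r Hr. apply Ceq_minus.
    rewrite <- (CInt_derive (fun s => G s (x, y)) (fun _ => RtoC 0) r r0); [|lra| |].
    - rewrite CInt_const. apply (scal_zero_r (V := C_R_NormedModule)).
    - intros t Ht. apply family_locally_constant, Hin. lra.
    - intros; apply continuous_Cconst. }
  rewrite <- (family_boundary f G HG r1 (x, y) Hon).
  apply Ceq_minus, Cmod_eq_0, Rle_antisym; [|apply Cmod_ge_0].
  apply le_epsilon. intros eps He. rewrite Rplus_0_l.
  assert (He2 : 0 < eps / 2) by lra.
  destruct (family_equicontinuous f G HG r1 (eps / 2) He2) as [d1 [Hd1 H1]].
  destruct (proj1 (continuous_on_C_iff _ _) (family_continuous f G HG r1) (x, y)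
    (Req_le _ _ Hon) (eps / 2) He2) as [d2 [Hd2 H2]].
  set (d := Rmin (Rmin d1 d2) (r0 - r1)).
  assert (Hd : 0 < d /\ d <= d1 /\ d <= d2 /\ d <= r0 - r1).
  { unfold d, Rmin. repeat destruct (Rle_dec _ _); lra. }
  (* The point with the same position relative to [r1] as [z] has to [r] is [z - d / 2]. It lies in
     the closed disc of centre [r1], so equicontinuity compares the centres and continuity of [G r1]
     the points. *)
  set (r := r1 + d / 2).
  assert (Hr : r1 < r <= r0) by (unfold r; lra).
  rewrite (Hconst r Hr).
  assert (Hzr : Cmod ((x, y) - RtoC r) <= 1) by (left; apply Hin, Hr).
  assert (E1 := H1 r ltac:(unfold r; rewrite Rabs_pos_eq; lra) _ Hzr).
  assert (Ed : (RtoC r1 + ((x, y) - RtoC r) - (x, y) = RtoC (- (d / 2)))%C).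
  { unfold r. rewrite RtoC_plus, RtoC_opp. ring. }
  assert (E2 := H2 (RtoC r1 + ((x, y) - RtoC r))%C).
  rewrite Ed, Cmod_R, Rabs_Ropp, Rabs_pos_eq in E2 by lra.
  assert (E3 : Cmod (G r1 (RtoC r1 + ((x, y) - RtoC r)) - G r1 (x, y)) < eps / 2).
  { apply E2; [|lra]. unfold closed_unit_disc_at.
    replace (RtoC r1 + ((x, y) - RtoC r) - RtoC r1)%C with ((x, y) - RtoC r)%C by ring. exact Hzr. }
  assert (Ez : (RtoC r + ((x, y) - RtoC r) = (x, y))%C) by ring.
  rewrite Ez in E1.
  set (q := G r1 (RtoC r1 + ((x, y) - RtoC r))%C) in *.
  replace (G r1 (x, y) - G r (x, y))%C with (- (G r (x, y) - q) + - (q - G r1 (x, y)))%C by ring.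
  eapply Rle_trans; [apply Cmod_triangle|]. rewrite !Cmod_opp. lra.
Qed.
End Gluing.

Theorem mainTheorem1 (f : C -> C)
  (hcont : continuous_on_C closed_strip f)
  (hext : forall r : R, extends_holomorphically_inside f r) :
  holomorphic_on open_strip f.
Proof.
  (* The extensions are chosen independently for each [r]; their continuity in [r] comes from the
     maximum principle. *)
  set (G := fun r => proj1_sig (constructive_indefinite_description _ (hext r))).
  assert (HG : extension_family f G).
  { assert (S : forall r, _) by exact (fun r => proj2_sig (constructive_indefinite_description _ (hext r))).
    cbv beta in S. split.
    - exact hcont.
    - intros r. apply S.
    - intros r z Hz. apply cdiff_ex_derive, S, Hz.
    - intros r z Hz. apply S, Hz. }
  intros z Hz. apply cdiff_ex_derive.
  assert (Hd : 0 < 1 - Cmod (z - RtoC (Re z))).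
  { replace (z - RtoC (Re z))%C with (RtoC (Im z) * Ci)%C.
    - rewrite Cmod_mult, Cmod_Ci, Cmod_R. unfold open_strip in Hz. lra.
    - destruct z as [x y]. apply injective_projections; simpl; ring. }
  apply (cdiff_ext_loc (G (Re z))).
  - apply locally_Cmod. exists (mkposreal _ Hd). simpl. intros w Hw. symmetry.
    apply (family_interior f G HG).
    replace (w - RtoC (Re z))%C with ((w - z) + (z - RtoC (Re z)))%C by ring.
    eapply Rle_lt_trans; [apply Cmod_triangle|]. lra.
  - apply (family_cdiff f G HG). unfold open_unit_disc_at. lra.
Qed.
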